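(* For each $\varepsilon>0$ the quartile operator is bounded $$ \mathsf V_{\mathbf{Qt}}: L\log L(\log\log L)^{\frac12}(\log\log\log L)^{\frac12+\varepsilon}(\mathbb R)\times L^2(\mathbb R)\to X, $$ i.e. there exists a constant $C_\varepsilon>0$ such that $\|\mathsf V_{\mathbf{Qt}}(f_1,f_2)\|_X\le C_\varepsilon\,\|f_1\|_{L^{\varphi}}\|f_2\|_2$ for all $f_1\in L^\varphi(\mathbb R)$ and $f_2\in L^2(\mathbb R)$, where $L^\varphi(\mathbb R)=L\log L(\log\log L)^{\frac12}(\log\log\log L)^{\frac12+\varepsilon}(\mathbb R)$ is the Orlicz space with Orlicz function $$ \varphi(t)=t\log(\mathrm e+t)\big(\log\log(\mathrm e^{\mathrm e}+t)\big)^{\frac12}\big(\log\log\log(\mathrm e^{\mathrm e^{\mathrm e}}+t)\big)^{\frac12+\varepsilon}. $$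
   Context: For a Young's function $\varphi$, the Orlicz space $L^\varphi(\mathbb R)$ is the space of measurable functions on $\mathbb R$ with finite norm $\|f\|_{L^\varphi}=\inf\{\lambda>0:\int_{\mathbb R}\varphi(|f(x)|/\lambda)\,dx\le1\}$. Let $f^*:\mathbb R_+\to[0,\infty)$ be the decreasing rearrangement of $f$. $X$ is the weak type weighted Lorentz space with quasi-norm $$\|f\|_X=\sup_{t>0}\frac{t^{\frac32}}{\log(\mathrm e+t)}f^*(t).$$ Walsh system: for an integer $n\ge 0$ with binary expansion $n=\sum_{k\ge0}\varepsilon_k2^k$, $\varepsilon_k\in\{0,1\}$, let $W_0=\mathbf 1_{[0,1]}$ and, for $n\ge1$, $W_n(x)=\prod_{k\ge0}\big(\mathrm{sign}\sin(2^k2\pi x)\big)^{\varepsilon_k}$ for $x\in[0,1]$, with $W_n=0$ outside $[0,1]$. Let $\mathcal D$ be the standard dyadic grid on $\mathbb R$ and $\ell(I)$ the left endpoint of a dyadic interval $I$. A tile is a dyadic rectangle $s=I_s\times\omega_s\subset\mathbb R\times\mathbb R_+$ with $I_s,\omega_s\in\mathcal D$ and $|I_s||\omega_s|=1$; its Walsh wave packet is $w_s(x)=|I_s|^{-1/2}W_{n_s}\big(\frac{x-\ell(I_s)}{|I_s|}\big)$, where $n_s=|I_s|\ell(\omega_s)$. A quartile is a dyadic rectangle $s=I_s\times\omega_s\subset\mathbb R\times\mathbb R_+$ ($I_s,\omega_s\in\mathcal D$) with $|\omega_s|=4|I_s|^{-1}$; $\omega_{s_1},\dots,\omega_{s_4}$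 denote the dyadic grandchildren of $\omega_s$ ordered so that $\ell(\omega_{s_1})<\dots<\ell(\omega_{s_4})$, and $s_j=I_s\times\omega_{s_j}$ are the corresponding tiles. $\mathbf{Qt}$ is the set of all quartiles. For $\mathbf S\subset\mathbf{Qt}$ the quartile operator is $$\mathsf V_{\mathbf S}(f_1,f_2)(x)=\sum_{s\in\mathbf S}\frac1{\sqrt{|I_s|}}\langle f_1,w_{s_1}\rangle\langle f_2,w_{s_2}\rangle w_{s_3}(x).$$ A bound for $\mathsf V_{\mathbf{Qt}}$ is understood as the same bound for $\mathsf V_{\mathbf S}$ for every finite $\mathbf S\subset\mathbf{Qt}$, with constant independent of $\mathbf S$. *)

(* Defs.v *)
From mathcomp Require Import all_boot all_order all_algebra finmap complex.
From mathcomp Require Import all_classical all_reals all_analysis.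

Set Implicit Arguments.
Unset Strict Implicit.
Unset Printing Implicit Defensive.

Import Order.TTheory GRing.Theory Num.Theory.
Import numFieldNormedType.Exports.

Local Open Scope classical_set_scope.
Local Open Scope complex_scope.
Local Open Scope ring_scope.

Section FunctionSpaces.
Context {R : realType}.
Local Notation mu := (@lebesgue_measure R).
Implicit Types (f : R -> R[i]) (phi : R -> R) (s t : R).

Definition modulus (z : R[i]) : R := ComplexField.Normc.normc z.

Definition cmeasurable f : Prop :=
  measurable_fun setT (fun x => complex.Re (f x)) /\
  measurable_fun setT (fun x => complex.Im (f x)).

(* +oo when no lam is admissible, since ereal_inf set0 = +oo. *)
Definition Orlicz_norm phi f : \bar R :=
  ereal_inf [set lam%:E | lam in [set lam : R | 0 < lam /\
    (\int[mu]_x (phi (modulus (f x) / lam))%:E <= 1)%E]].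

Definition in_Orlicz phi f : Prop :=
  cmeasurable f /\ (Orlicz_norm phi f < +oo)%E.

Definition L2_norm f : \bar R :=
  Lnorm mu 2%:E (fun x => (modulus (f x))%:E).

Definition in_L2 f : Prop := cmeasurable f /\ (L2_norm f < +oo)%E.

Definition decreasing_rearrangement f t : \bar R :=
  ereal_inf [set s%:E | s in [set s : R | 0 <= s /\
    (mu [set x | (s < modulus (f x))%R] <= t%:E)%E]].

Definition X_norm f : \bar R :=
  ereal_sup [set ((t `^ (3 / 2) / ln (expR 1 + t))%:E
                  * decreasing_rearrangement f t)%E | t in [set t : R | 0 < t]].

Definition orlicz_phi (eps t : R) : R :=
  t * ln (expR 1 + t)
    * (ln (ln (expR (expR 1) + t))) `^ (1 / 2)
    * (ln (ln (ln (expR (expR (expR 1)) + t)))) `^ (1 / 2 + eps).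

End FunctionSpaces.

(* (j, k) encodes the half-open interval [k 2^j, (k + 1) 2^j[; the encoding
   is a bijection between int * int and the standard dyadic grid. *)
Definition dyadic := (int * int)%type.

Definition rectangle := (dyadic * dyadic)%type.

Section QuartileOperator.
Variable R : realType.
Local Notation mu := (@lebesgue_measure R).
Implicit Types (I : dyadic) (s : rectangle) (f : R -> R[i]).

Definition dyadic_len I : R := 2 ^ I.1.

Definition dyadic_left I : R := I.2%:~R * dyadic_len I.

Definition dyadic_set I : set R :=
  `[dyadic_left I, dyadic_left I + dyadic_len I[%classic.

(* The k-th binary digit of n is odd (n %/ 2 ^ k); it vanishes for k >= n, so
   the product over all k reduces to k < n. *)
Definition walsh (n : nat) (x : R) : R :=
  if (0 <= x <= 1)
  then \prod_(k < n) Num.sg (sin (2 ^+ k * 2 * pi * x)) ^+ odd (n %/ 2 ^ k)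
  else 0.

(* For a tile s, |I_s| * l(omega_s) is a natural number, and Num.truncn
   returns it. *)
Definition wave_packet s (x : R) : R :=
  (Num.sqrt (dyadic_len s.1))^-1
  * walsh (Num.truncn (dyadic_len s.1 * dyadic_left s.2))
          ((x - dyadic_left s.1) / dyadic_len s.1).

Definition is_quartile s : Prop :=
  dyadic_set s.2 `<=` [set y : R | 0 <= y] /\
  dyadic_len s.2 = 4 * (dyadic_len s.1)^-1.

(* The dyadic grandchildren of (j, k) are (j - 2, 4 k + i), 0 <= i < 4, with
   left endpoints increasing in i; m = 1, 2, 3, 4 gives the tile s_m. *)
Definition quartile_tile s (m : nat) : rectangle :=
  (s.1, (s.2.1 - 2, 4 * s.2.2 + (m%:Z - 1))).

Definition pairing f (w : R -> R) : R[i] :=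
  (\int[mu]_x (complex.Re (f x) * w x))
  +i* (\int[mu]_x (complex.Im (f x) * w x)).

Definition quartile_operator (S : {fset rectangle}) f1 f2 (x : R) : R[i] :=
  \sum_(s <- S)
    ((Num.sqrt (dyadic_len s.1))^-1)%:C
    * pairing f1 (wave_packet (quartile_tile s 1))
    * pairing f2 (wave_packet (quartile_tile s 2))
    * (wave_packet (quartile_tile s 3) x)%:C.

End QuartileOperator.

(* Main.v *)
(** After splitting into real and imaginary parts, the trilinear form
    [sum_s |I_s|^(-1/2) <f1, w_{s1}> <f2, w_{s2}> <f3, w_{s3}>] is estimated by
    time-frequency analysis.  The Walsh packets on an interval and on its four
    grandchildren are related by
    [sum_r <f, w_{I, 4n+r}>^2 = sum_q <f, w_{I_q, n}>^2], which yields Bessel's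
    inequality for disjoint tiles and lets trees be selected greedily until each
    of the three sizes is small.  With [f1] bounded by [A] and off the set where
    the averages of [|f1|] or [f2^2] are large, the form is at most
    [C |f1|_1 |f2|_2 tau^(-1/2) ln (e + A tau / |f1|_1)], where [tau] is the
    measure of that set.

    A general [f1] is cut at the heights [exp (exp j)].  The j-th part is given
    the share [lev j^(-2 eps) - lev (j+1)^(-2 eps)] of the exceptional measure,
    with [lev j = 1 + ln (j+1)]; these shares telescope, and the j-th loss
    [share^(-1/2)] is comparable to the factors
    [(log log)^(1/2) (log log log)^(1/2 + eps)] of the Orlicz function at that
    height.  Testing a superlevel set against signs turns the resulting
    restricted estimate into the weak type bound. *)

Require Import Defs.
From mathcomp Require Import all_boot all_order all_algebra finmap complex.
From mathcomp Require Import all_classical all_reals all_analysis.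
From mathcomp Require Import measurable_realfun ring lra zify.

Import Order.TTheory GRing.Theory Num.Theory.
Import numFieldNormedType.Exports.

Set Implicit Arguments.
Unset Strict Implicit.
Unset Printing Implicit Defensive.

Local Open Scope classical_set_scope.
Local Open Scope complex_scope.
Local Open Scope ring_scope.

(** * Trees in a 4-adic model of the tiles *)

(* A word, most recent digit first, encodes a 4-adic descendant of a root
   interval: in time, [q :: u] is the q-th quarter of [u]; in frequency,
   [r :: v] has index [4 n + r] where [v] has index [n].  A quartile is a
   pair [(u, v)] with [size u + size v = m], and its tiles are [(u, j :: v)]. *)
Section Words.
Context {R : realType}.
Local Notation word := (seq 'I_4).
Implicit Types (u v w xi : word) (S P : seq (word * word)).

(** The factor [log L] of the Orlicz function counts rounds. The [L^2] mass of a bounded part of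
    [f1] may exceed what its size and the measure [tau] allow by a factor [4 ^ n]; only the sizes of
    [f2] and [f3] can be halved meanwhile, each such round costs the same, and there are about
    [ln (A tau / |f1|_1)] of them. The two slower factors are the price of giving each height its
    own exceptional set: the measures must be summable while a set of measure [tau] costs
    [tau^(-1/2)], so that the exponents 1/2 are square roots of the barely convergent series with
    terms [1 / (j (log j)^(1 + 2 eps))]. Two obstacles shape the summation. The estimate at measure
    [tau] wants [f3] of mass about [tau], whereas the shares are far smaller than the mass of [f3];
    therefore [f3] is cut into layers along larger exceptional sets. And the logarithm is large at a
    height that carries very little of [f1]; therefore each mass is raised by a multiple of [2^-j],
    which keeps the logarithm of order [exp j] and stays summable. *)

Lemma suffix_leq u w : suffix u w -> (size u <= size w)%N.
Proof. exact: size_suffix. Qed.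

Definition tile_size (p : word * word) := (size p.1 + size p.2)%N.

Lemma suffix_cat_cons (q q0 : 'I_4) s u :
  suffix (q :: u) (s ++ q0 :: u) = (q == q0).
Proof.
rewrite -(cat1s q u) -(cat1s q0 u) catA suffix_catl // eqxx /=.
by rewrite cats1 -[[:: q]]/(rcons [::] q) suffix_rcons suffix0s andbT.
Qed.

Lemma suffixS u w : suffix u w -> w != u ->
  exists2 q : 'I_4, suffix (q :: u) w
                  & forall q', suffix (q' :: u) w = (q' == q).
Proof.
case/suffixP => s ->; case: (lastP s) => [|s' q]; first by rewrite eqxx.
rewrite cat_rcons => _; exists q; first by rewrite suffix_cat_cons.
by move=> q'; rewrite suffix_cat_cons.
Qed.

Lemma suffix_consl (q : 'I_4) u w : suffix (q :: u) w -> suffix u w.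
Proof. by rewrite -cat1s => /catl_suffix. Qed.

Lemma suffix_size_eq u w : suffix u w -> size u = size w -> u = w.
Proof.
by case/suffixP => s -> /eqP; rewrite size_cat -{1}[size u]add0n eqn_add2r
  eq_sym size_eq0 => /eqP ->.
Qed.

Lemma suffix_linear u w xi : suffix u xi -> suffix w xi ->
  (size u <= size w)%N -> suffix u w.
Proof.
rewrite !suffixE => /eqP hu /eqP hw le.
rewrite -[X in drop _ X]hw drop_drop.
have lw : (size w <= size xi)%N.
  by move/eqP: hw => /eqP <-; rewrite size_drop leq_subr.
have -> : (size w - size u + (size xi - size w) = size xi - size u)%N by lia.
by rewrite hu.
Qed.


Lemma sum_suffix_pointwise (b : bool) (x : R) u w :
  (if suffix u w && b then x else 0) =
  (if (w == u) && b then x else 0) +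
  \sum_(q < 4) (if suffix (q :: u) w && b then x else 0).
Proof.
case: b; rewrite ?andbF ?andbT; last first.
  by rewrite !big1 ?addr0 // => q _; rewrite andbF.
have [->|neq] := eqVneq w u.
  rewrite suffix_refl big1 ?addr0 // => q _; rewrite andbT ifF //.
  by apply/negP => /size_suffix /=; rewrite ltnn.
rewrite add0r; case: ifPn => [su|nsu].
  have [q sq qE] := suffixS su neq.
  rewrite (bigD1 q) //= sq big1 ?addr0 // => q' neq'.
  by rewrite qE (negbTE neq').
rewrite big1 // => q _; rewrite andbT ifF //.
by apply/negP => /suffix_consl; apply/negP.
Qed.

Lemma sum_suffixl S (p : pred (word * word)) (F : word * word -> R) u :
  \sum_(s <- S | suffix u s.1 && p s) F s =
  \sum_(s <- S | (s.1 == u) && p s) F s +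
  \sum_(q < 4) \sum_(s <- S | suffix (q :: u) s.1 && p s) F s.
Proof.
under [X in _ + X]eq_bigr do rewrite big_mkcond.
rewrite exchange_big /= [in LHS]big_mkcond [X in X + _]big_mkcond -big_split /=.
by apply: eq_bigr => s _; exact: sum_suffix_pointwise.
Qed.

Lemma sum_suffixr S (p : pred (word * word)) (F : word * word -> R) v :
  \sum_(s <- S | suffix v s.2 && p s) F s =
  \sum_(s <- S | (s.2 == v) && p s) F s +
  \sum_(q < 4) \sum_(s <- S | suffix (q :: v) s.2 && p s) F s.
Proof.
under [X in _ + X]eq_bigr do rewrite big_mkcond.
rewrite exchange_big /= [in LHS]big_mkcond [X in X + _]big_mkcond -big_split /=.
by apply: eq_bigr => s _; exact: sum_suffix_pointwise.
Qed.

(** * Bessel's inequality for disjoint tiles *)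

Section Coefficients.
Variable a : word -> word -> R.
Hypothesis a_split : forall u v,
  \sum_(r < 4) a u (r :: v) ^+ 2 = \sum_(q < 4) a (q :: u) v ^+ 2.

(* The energy of the rectangle with time word u and frequency word v whose
   area is 4 ^ d. *)
Fixpoint energy d u v : R :=
  if d is d'.+1 then \sum_(q < 4) energy d' (q :: u) v else a u v ^+ 2.

(** On a rectangle of area 4 the cut in frequency agrees with the cut in time by [a_split]; on
    larger ones the two cuts commute, so their order is immaterial. *)
Lemma energy_split d u v :
  energy d.+1 u v = \sum_(r < 4) energy d u (r :: v).
Proof.
elim: d u v => [|d IH] u v; first by rewrite /= -a_split.
rewrite -[LHS]/(\sum_(q < 4) energy d.+1 (q :: u) v).
under eq_bigr do rewrite IH.
by rewrite exchange_big.
Qed.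

Lemma energy_ge0 d u v : 0 <= energy d u v.
Proof.
elim: d u v => [|d IH] u v /=; first exact: sqr_ge0.
by apply: sumr_ge0.
Qed.

Definition overlap (p p' : word * word) :=
  (suffix p.1 p'.1 || suffix p'.1 p.1) && (suffix p.2 p'.2 || suffix p'.2 p.2).

Definition disjoint_tiles P := {in P &, forall p p', overlap p p' -> p = p'}.

(* Two tiles spanning the rectangle in time and in frequency respectively
   overlap, so the rectangle may be cut so that no tile is. *)
Lemma bessel_rect d P u v : uniq P ->
  {in P, forall p, tile_size p = (size u + size v + d)%N} ->
  disjoint_tiles P ->
  \sum_(p <- P | suffix u p.1 && suffix v p.2) a p.1 p.2 ^+ 2 <= energy d u v.
Proof.
move=> uP sP dP; elim: d u v sP => [|d IH] u v sP.
  rewrite /= big_mkcond /=.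
  have h p : p \in P -> suffix u p.1 && suffix v p.2 -> p = (u, v).
    case: p => u' v' pP /= /andP[su sv].
    have := sP _ pP; rewrite /tile_size /=; have := suffix_leq su; have := suffix_leq sv.
    move=> h1 h2 h3.
    congr pair; apply/esym/suffix_size_eq => //; lia.
  have [uvP|nuvP] := boolP ((u, v) \in P).
    rewrite (bigD1_seq (u, v)) //= !suffix_refl /= big1_seq ?addr0 //.
    move=> p /andP[neq pP]; case: ifPn => // hs; case/eqP: neq; exact: h.
  rewrite big1_seq ?sqr_ge0 // => p /andP[_ pP]; case: ifPn => // hs.
  by move: nuvP; rewrite -(h p pP hs) pP.
have [/hasP[p0 p0P /andP[/eqP e1 e2]]|/hasPn hn] :=
    boolP (has (fun p => (p.1 == u) && suffix v p.2) P); last first.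
  rewrite sum_suffixl big_seq_cond big1 ?add0r; last first.
    by move=> p /andP[pP]; rewrite (negbTE (hn _ pP)).
  by apply: ler_sum => q _; apply: IH => p /sP ->; rewrite /=; lia.
rewrite (eq_bigl (fun p => suffix v p.2 && suffix u p.1)); last by move=> p; rewrite andbC.
rewrite sum_suffixr big_seq_cond big1 ?add0r; last first.
  move=> p /and3P[pP /eqP ev su].
  have ep : p0 = p by apply: (dP _ _ p0P pP); rewrite /overlap ev e1 su e2 orbT.
  have ep1 : p.1 = u by rewrite -ep.
  by have := sP _ pP; rewrite /tile_size ep1 ev; lia.
rewrite energy_split; apply: ler_sum => q _.
rewrite (eq_bigl (fun p => suffix u p.1 && suffix (q :: v) p.2)); last by move=> p; rewrite andbC.
by apply: IH => p /sP ->; rewrite /=; lia.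
Qed.

Lemma bessel m P : uniq P -> {in P, forall p, tile_size p = m} ->
  disjoint_tiles P -> \sum_(p <- P) a p.1 p.2 ^+ 2 <= energy m [::] [::].
Proof.
move=> uP sP dP; have := @bessel_rect m P [::] [::] uP sP dP.
by under eq_bigl do rewrite !suffix0s.
Qed.

End Coefficients.


(** * Trees, their energies and their selection *)

Section Trees.
Variables (a : word -> word -> R) (l : word -> R) (m : nat).
Hypothesis a_split : forall u v,
  \sum_(r < 4) a u (r :: v) ^+ 2 = \sum_(q < 4) a (q :: u) v ^+ 2.
Hypothesis l_gt0 : forall u, 0 < l u.
Hypothesis l_cons : forall q u, l (q :: u) = l u / 4.

Definition quartiles S := uniq S /\ {in S, forall s, tile_size s = m}.

(* The i-th part of the tree with top time word u and top frequency xi,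
   measured through the j-th tiles. *)
Definition tree_energy S (i j : 'I_4) u xi : R :=
  \sum_(s <- S | suffix u s.1 && suffix (i :: s.2) xi) a s.1 (j :: s.2) ^+ 2.

Lemma suffix_split xi v : suffix v xi -> (size v < size xi)%N ->
  exists i : 'I_4, suffix (i :: v) xi.
Proof.
move=> sv lt; have neq : xi != v by apply: contraTneq lt => ->; rewrite ltnn.
by have [q hq _] := suffixS sv neq; exists q.
Qed.

Lemma suffix_uniq_size v w xi : suffix v xi -> suffix w xi ->
  size v = size w -> v = w.
Proof.
move=> sv sw e; apply: suffix_size_eq => //.
by apply: (@suffix_linear _ _ xi) => //; rewrite e.
Qed.

Section SizeBound.
Variable L : word -> R.
Hypothesis L_ge0 : forall u, 0 <= L u.
Hypothesis L_cons : forall q u, L (q :: u) <= L u.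
Hypothesis a_le : forall u v, a u v ^+ 2 * l u <= L u ^+ 2.
Variables (c : R) (S : seq (word * word)).
Hypothesis c_ge0 : 0 <= c.
Hypothesis SQ : quartiles S.
Hypothesis L_S : {in S, forall s u, suffix u s.1 -> L u <= c * l u}.

Lemma coefficient_le k u v : 0 <= k -> L u <= k * l u -> a u v ^+ 2 <= k ^+ 2 * l u.
Proof.
move=> k0 h; rewrite -(ler_pM2r (l_gt0 u)); apply: le_trans (a_le u v) _.
rewrite -mulrA -expr2 -exprMn lerXn2r ?nnegrE ?mulr_ge0 //; exact: ltW.
Qed.

(** Over [u] the tree has at most the quartile [(u, v)], and the [i]-th tile of it then contains the
    top frequency, so that [i = r]. As [i != j], the two squares on the left are different terms of
    the sum over frequencies in [a_split]. *)
Lemma tree_energy_top i j xi u v r : i != j -> size xi = m.+1 ->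
  (size u + size v = m)%N -> suffix (r :: v) xi ->
  \sum_(s <- S | (s.1 == u) && suffix (i :: s.2) xi) a s.1 (j :: s.2) ^+ 2
    + a u (r :: v) ^+ 2 <= \sum_(q < 4) a (q :: u) v ^+ 2.
Proof.
move=> neq sxi suv srv; rewrite -a_split.
have [uS sS] := SQ.
have h s : s \in S -> (s.1 == u) && suffix (i :: s.2) xi -> s = (u, v) /\ i = r.
  case: s => u' v' /= sP /andP[/eqP eu hs].
  have e : i :: v' = r :: v.
    apply: (@suffix_uniq_size _ _ xi) => /=; [by []|by []|congr (_.+1)].
    by have := sS _ sP; rewrite /tile_size /= eu -{1}suv => /addnI.
  by case: e => -> ->; rewrite eu.
have rest : a u (r :: v) ^+ 2 <= \sum_(r0 < 4) a u (r0 :: v) ^+ 2.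
  by rewrite (bigD1 r) //= lerDl; apply: sumr_ge0 => k _; exact: sqr_ge0.
have [/hasP[s sP hs]|/hasPn hn] :=
    boolP (has (fun s => (s.1 == u) && suffix (i :: s.2) xi) S); last first.
  by rewrite big_seq_cond big1 ?add0r // => s /andP[/hn /negbTE ->].
have [es ei] := h _ sP hs; rewrite es in sP hs.
rewrite big_mkcond (bigD1_seq (u, v)) //= hs big1_seq ?addr0; last first.
  move=> s' /andP[neq' s'P]; case: ifPn => // /(h _ s'P)[e _].
  by rewrite e eqxx in neq'.
rewrite -ei (bigD1 j) //= (bigD1 i) //= addrA lerDl.
by apply: sumr_ge0 => k _; exact: sqr_ge0.
Qed.

(** Adding the coefficient of the tile over [u] that contains [xi] makes the estimate pass from [u]
    to its quarters, by [tree_energy_top]. The descent stops where the tree has no quartile below;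
    there the bound inherited from the parent applies. It has the factor 4 because [L] does not grow
    while [l] is divided by 4, and its square is the constant 16. *)
Lemma tree_energy_aux i j xi d u v : i != j -> size xi = m.+1 ->
  (size u + d = m.+1)%N -> suffix v xi -> size v = d -> L u <= 4 * c * l u ->
  tree_energy S i j u xi + a u v ^+ 2 <= 16 * c ^+ 2 * l u.
Proof.
move=> neq sxi; elim: d u v => [|d IH] u v sud sv sd Lu.
  rewrite /tree_energy big_seq_cond big1 ?add0r; last first.
    case=> u' v' /= /and3P[sP /suffix_leq su _].
    have := (proj2 SQ) _ sP; rewrite /tile_size /=; lia.
  have -> : 16 * c ^+ 2 * l u = (4 * c) ^+ 2 * l u by ring.
  by apply: coefficient_le => //; rewrite mulr_ge0.
have [/hasP[s sP /andP[su _]]|/hasPn hn] :=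
    boolP (has (fun s => suffix u s.1 && suffix (i :: s.2) xi) S); last first.
  rewrite /tree_energy big_seq_cond big1 ?add0r; last first.
    by move=> s /andP[/hn /negbTE ->].
  have -> : 16 * c ^+ 2 * l u = (4 * c) ^+ 2 * l u by ring.
  by apply: coefficient_le => //; rewrite mulr_ge0.
have {}Lu := L_S sP su.
case: v sv sd => // r v srv /= [sd].
have sv := suffix_consl srv.
rewrite /tree_energy sum_suffixl addrAC.
apply: le_trans (lerD (tree_energy_top neq sxi _ srv) (lexx _)) _.
  by rewrite sd; lia.
rewrite -big_split /=.
have -> : 16 * c ^+ 2 * l u = \sum_(q < 4) 16 * c ^+ 2 * l (q :: u).
  under eq_bigr do rewrite l_cons.
  by rewrite sumr_const card_ord -mulr_natr; field.
apply: ler_sum => q _; rewrite addrC; apply: IH => //=; first by lia.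
apply: le_trans (L_cons q u) _; apply: le_trans Lu _.
by rewrite l_cons le_eqVlt; apply/orP; left; apply/eqP; field.
Qed.

End SizeBound.

Definition in_tree (t s : word * word) := suffix t.1 s.1 && suffix s.2 t.2.

Definition prune (ts S : seq (word * word)) : seq (word * word) :=
  [seq s <- S | ~~ has (in_tree^~ s) ts].

Lemma prune_cat ts ts' S : prune ts (prune ts' S) = prune (ts' ++ ts) S.
Proof.
rewrite /prune -filter_predI; apply: eq_filter => s /=.
by rewrite has_cat negb_or andbC.
Qed.

Lemma prune_quartiles ts S : quartiles S -> quartiles (prune ts S).
Proof.
move=> [uS sS]; split; first exact: filter_uniq.
by move=> s; rewrite mem_filter => /andP[_ /sS].
Qed.

Lemma sum_prune ts S (P : pred (word * word)) (F : word * word -> R) :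
  (forall s, 0 <= F s) ->
  \sum_(s <- prune ts S | P s) F s <= \sum_(s <- S | P s) F s.
Proof.
move=> F0; rewrite big_filter_cond /= big_mkcond [leRHS]big_mkcond /=.
apply: ler_sum => s _; case: (P s); rewrite ?andbF // andbT.
by case: ifP.
Qed.

Lemma tree_energy_prune ts S i j u xi :
  tree_energy (prune ts S) i j u xi <= tree_energy S i j u xi.
Proof. by apply: sum_prune => s; exact: sqr_ge0. Qed.

Fixpoint word_num v : nat := if v is r :: v' then (4 * word_num v' + r)%N else 0%N.

Lemma num_cat v w : word_num (v ++ w) = (word_num v + 4 ^ size v * word_num w)%N.
Proof. elim: v => [|r v IH] /=; first by rewrite mul1n. rewrite IH expnS; lia. Qed.

Lemma num_lt v : (word_num v < 4 ^ size v)%N.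
Proof.
elim: v => [|r v IH] //=; rewrite expnS; have := ltn_ord r; lia.
Qed.

(** The oldest digits, which end a word, are the most significant ones, so the first digit after the
    common part [v] decides the order. *)
Lemma num_lt_of_suffix (i j : 'I_4) v xi xi' : size xi = size xi' -> (i < j)%N ->
  suffix (i :: v) xi -> suffix (j :: v) xi' -> (word_num xi < word_num xi')%N.
Proof.
move=> es ij /suffixP[s exi] /suffixP[s' exi']; move: es; rewrite exi exi'.
rewrite !size_cat /= => /addIn es; rewrite !num_cat /= es.
have := num_lt s; rewrite es; nia.
Qed.

(** Frequencies are ordered upwards or downwards according to the order of [i] and [j]. In both
    cases a frequency in the [j]-th tile of a quartile ranks above one in its [i]-th tile, so that
    one selection procedure serves both. *)
Definition rank (i j : 'I_4) xi : nat :=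
  if (i < j)%N then word_num xi else (4 ^ size xi - word_num xi)%N.

Lemma rank_lt_of_suffix (i j : 'I_4) v xi xi' : size xi = size xi' -> i != j ->
  suffix (i :: v) xi -> suffix (j :: v) xi' -> (rank i j xi < rank i j xi')%N.
Proof.
move=> es neq h h'; rewrite /rank; case: (ltngtP i j) => [ij|ji|e].
- exact: num_lt_of_suffix es ij h h'.
- have := num_lt_of_suffix (esym es) ji h' h.
  have := num_lt xi; have := num_lt xi'; rewrite es; lia.
- by case/eqP: neq; apply: ord_inj.
Qed.

Definition jtiles (j : 'I_4) (Q : seq (word * word)) :=
  [seq (s.1, j :: s.2) | s <- Q].

(** A shorter time interval goes with longer frequency intervals: the one of the [j]-th tile of [s']
    contains the whole frequency interval of [s], and with it [xi]. *)
Lemma overlap_tree i j u0 xi s s' : i != j -> tile_size s = m -> tile_size s' = m ->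
  in_tree (u0, xi) s -> (size s.1 < size s'.1)%N ->
  overlap (s.1, j :: s.2) (s'.1, j :: s'.2) ->
  in_tree (u0, xi) s' /\ suffix (j :: s'.2) xi.
Proof.
case: s s' => [u v] [u' v'] /=; rewrite /tile_size /= => neq sz sz' /andP[/= su sv].
move=> lt /andP[/= /orP[suu|/suffix_leq]]; last by lia.
move=> /orP[/suffix_leq /=|svv]; first by lia.
have svv' : suffix (j :: v') v.
  apply: (@suffix_linear _ _ (j :: v)) => //; first exact: suffix_cons.
  by rewrite /=; lia.
have h := suffix_trans svv' sv.
by split=> //; rewrite /in_tree /= (suffix_trans su suu) (suffix_consl h).
Qed.

Lemma overlapC p p' : overlap p p' = overlap p' p.
Proof. by rewrite /overlap orbC [X in _ && X]orbC. Qed.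

Lemma overlap_same_size j s s' : tile_size s = m -> tile_size s' = m ->
  size s.1 = size s'.1 -> overlap (s.1, j :: s.2) (s'.1, j :: s'.2) -> s = s'.
Proof.
case: s s' => [u v] [u' v']; rewrite /tile_size /= => sz sz' es /andP[/= h1 h2].
have ev : size v = size v' by lia.
congr pair.
  by case/orP: h1 => h; [|apply/esym]; apply: suffix_size_eq.
have : j :: v = j :: v'.
  by case/orP: h2 => h; [|apply/esym]; apply: suffix_size_eq => //=; rewrite ev.
by case.
Qed.

(* The top of largest rank is removed first: a tile of a later tree lying above
   a tile of an earlier one in time would have a top of larger rank. *)
Lemma select_trees (i j : 'I_4) (t : R) S rho : i != j -> 0 < t -> quartiles S ->
  (forall u xi, size xi = m.+1 -> t * l u < tree_energy S i j u xi ->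
     (rank i j xi <= rho)%N) ->
  exists ts Q, [/\ all (fun t => size t.2 == m.+1) ts,
    (forall u xi, size xi = m.+1 -> tree_energy (prune ts S) i j u xi <= t * l u),
    t * (\sum_(t <- ts) l t.1) <= \sum_(s <- Q) a s.1 (j :: s.2) ^+ 2 &
    [/\ uniq Q, {subset Q <= S}, disjoint_tiles (jtiles j Q) &
     {in Q, forall s, exists xi, [/\ size xi = m.+1, suffix (i :: s.2) xi &
        (rank i j xi <= rho)%N]}]].
Proof.
move=> neq t0; have [n] := ubnP (size S).
elim: n S rho => // n IH S rho; rewrite ltnS => leS SQ hrho.
pose heavy k := exists u xi, [/\ size xi = m.+1, t * l u < tree_energy S i j u xi &
  rank i j xi = k].
have [hh|nh] := pselect (exists k, heavy k); last first.
  exists [::], [::]; split; first by [].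
  - move=> u xi sxi; rewrite leNgt; apply/negP => h; apply: nh.
    exists (rank i j xi), u, xi; split=> //.
    apply: lt_le_trans h _; exact: tree_energy_prune.
  - by rewrite !big_nil mulr0.
  - split; [by []|by []| |by []].
    by move=> p p'; rewrite in_nil.
have hb : exists k, `[< heavy k >] by case: hh => k hk; exists k; apply/asboolP.
have hmax k : `[< heavy k >] -> (k <= rho)%N.
  by move/asboolP => [u [xi [sxi h <-]]]; apply: hrho h.
case: (ex_maxnP hb hmax) => k /asboolP[u [xi [sxi hu ek]]] kmax.
pose S1 := prune [:: (u, xi)] S.
pose T := [seq s <- S | suffix u s.1 && suffix (i :: s.2) xi].
have TS : {subset T <= S} by move=> s; rewrite mem_filter => /andP[].
have Ttree s : s \in T -> in_tree (u, xi) s.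
  by rewrite mem_filter => /andP[/andP[su sx] _]; rewrite /in_tree /= su (suffix_consl sx).
have ltS1 : (size S1 < size S)%N.
  have : has (in_tree (u, xi)) S.
    have [/hasP[s sT _]|] := boolP (has predT T).
      by apply/hasP; exists s; [exact: TS|exact: Ttree].
    rewrite has_predT -leqNgt leqn0 size_eq0 => /eqP T0.
    move: hu; rewrite /tree_energy -big_filter -/T T0 big_nil ltNge.
    by rewrite mulr_ge0 ?ltW.
  rewrite /S1 /prune size_filter -(count_predC (in_tree (u, xi)) S).
  rewrite has_count => h; rewrite (@eq_count _ _ (predC (in_tree (u, xi)))); first by lia.
  by move=> s /=; rewrite orbF.
have S1Q : quartiles S1 by exact: prune_quartiles.
have rS1 u' xi' : size xi' = m.+1 -> t * l u' < tree_energy S1 i j u' xi' ->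
    (rank i j xi' <= rank i j xi)%N.
  move=> sxi' h; rewrite ek; apply: kmax; apply/asboolP; exists u', xi'; split=> //.
  apply: lt_le_trans h _; exact: tree_energy_prune.
have [|ts [Q [sts small sumQ [uQ QS1 dQ hQ]]]] := IH S1 _ _ S1Q rS1.
  exact: leq_trans ltS1 leS.
have QS : {subset Q <= S} by move=> s /QS1; rewrite mem_filter => /andP[].
have Qntree s : s \in Q -> ~~ in_tree (u, xi) s.
  by move/QS1; rewrite mem_filter /= orbF => /andP[].
have sS := proj2 SQ.
exists ((u, xi) :: ts), (T ++ Q); split.
- by rewrite /= sxi eqxx.
- by move=> u' xi' sxi'; rewrite -cat1s -prune_cat; apply: small.
- rewrite big_cons big_cat mulrDr; apply: lerD => //=.
  by rewrite big_filter; exact: ltW.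
- split.
  + rewrite cat_uniq filter_uniq ?uQ ?andbT ?(proj1 SQ) //=.
    apply/hasPn => s /Qntree; apply: contra; exact: Ttree.
  + by move=> s; rewrite mem_cat => /orP[/TS|/QS].
  + have key s s' : s \in T ++ Q -> s' \in T ++ Q -> (size s.1 < size s'.1)%N ->
        ~~ overlap (s.1, j :: s.2) (s'.1, j :: s'.2).
      move=> sin s'in lt; apply/negP => ov.
      have sSs : s \in S by move: sin; rewrite mem_cat => /orP[/TS|/QS].
      have sSs' : s' \in S by move: s'in; rewrite mem_cat => /orP[/TS|/QS].
      move: sin; rewrite mem_cat => /orP[sT|sQ].
        (* If [s] is in the first tree, then so is [s'], which excludes [Q]; and [s'] cannot be in
           [T], since [xi] would lie both in its [i]-th and in its [j]-th tile. *)
        have [it js'] := overlap_tree neq (sS _ sSs) (sS _ sSs') (Ttree _ sT) lt ov.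
        move: s'in; rewrite mem_cat => /orP[|/Qntree]; last by rewrite it.
        rewrite mem_filter => /andP[/andP[_ is'] _].
        have [] := suffix_uniq_size is' js' erefl.
        by move/eqP; rewrite (negbTE neq).
      move: s'in; rewrite mem_cat => /orP[s'T|s'Q]; last first.
        have h1 : (s.1, j :: s.2) \in jtiles j Q by apply: map_f.
        have h2 : (s'.1, j :: s'.2) \in jtiles j Q by apply: map_f.
        by have [e _] := dQ _ _ h1 h2 ov; rewrite e ltnn in lt.
      have [xi1 [sxi1 sx1 r1]] := hQ _ sQ.
      have it1 : in_tree (s.1, xi1) s.
        by rewrite /in_tree /= suffix_refl (suffix_consl sx1).
      have [_ js'] := overlap_tree neq (sS _ sSs) (sS _ sSs') it1 lt ov.
      move: s'T; rewrite mem_filter => /andP[/andP[_ is'] _].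
      have := rank_lt_of_suffix (etrans sxi (esym sxi1)) neq is' js'.
      by rewrite ltnNge r1.
    move=> p p' /mapP[s sin ->] /mapP[s' s'in ->] ov.
    have sSs : s \in S by move: sin; rewrite mem_cat => /orP[/TS|/QS].
    have sSs' : s' \in S by move: s'in; rewrite mem_cat => /orP[/TS|/QS].
    case: (ltngtP (size s.1) (size s'.1)) => [lt|lt|e].
    * by move: (key _ _ sin s'in lt); rewrite ov.
    * by move: (key _ _ s'in sin lt); rewrite overlapC ov.
    * by rewrite (overlap_same_size (sS _ sSs) (sS _ sSs') e ov).
  + have rle : (rank i j xi <= rho)%N by apply: hrho hu.
    move=> s; rewrite mem_cat => /orP[|/hQ[xi1 [sxi1 sx1 r1]]].
      by rewrite mem_filter => /andP[/andP[_ is'] _]; exists xi.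
    by exists xi1; split=> //; apply: leq_trans r1 rle.
Qed.

(** This is the size of time-frequency analysis, the normalized energy of lacunary trees: for
    [i != j] the [j]-th tiles of the [i]-th part avoid the top frequency. *)
Definition size_le S (j : 'I_4) (sigma : R) := forall i, i != j ->
  forall u xi, size xi = m.+1 -> tree_energy S i j u xi <= sigma ^+ 2 * l u.

Lemma size_le_prune ts S j sigma : size_le S j sigma -> size_le (prune ts S) j sigma.
Proof.
move=> h i neq u xi sxi; apply: le_trans (h i neq u xi sxi).
exact: tree_energy_prune.
Qed.

Lemma jtiles_bessel j Q : quartiles Q -> disjoint_tiles (jtiles j Q) ->
  \sum_(s <- Q) a s.1 (j :: s.2) ^+ 2 <= energy a m.+1 [::] [::].
Proof.
move=> [uQ sQ] dQ.
have := @bessel a a_split m.+1 (jtiles j Q) _ _ dQ; rewrite big_map; apply.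
  by rewrite map_inj_uniq // => -[u v] [u' v'] [-> ->].
move=> p /mapP[s /sQ]; rewrite /tile_size => h -> /=; lia.
Qed.

(** The selection is run once for each [i != j]; later prunings only lower the energies that are
    already controlled. The tops of each run are paid for by disjoint tiles through Bessel's
    inequality, and 4 bounds the number of runs. *)
Lemma select_size (j : 'I_4) (tau : R) S : 0 < tau -> quartiles S ->
  exists ts, [/\ all (fun t => size t.2 == m.+1) ts, size_le (prune ts S) j tau &
    tau ^+ 2 * (\sum_(t <- ts) l t.1) <= 4 * energy a m.+1 [::] [::]].
Proof.
move=> tau0 SQ.
have t0 : 0 < tau ^+ 2 by rewrite exprn_gt0.
have key (is_ : seq 'I_4) : all (fun i => i != j) is_ ->
    exists ts, [/\ all (fun t => size t.2 == m.+1) ts,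
    {in is_, forall i u xi, size xi = m.+1 ->
       tree_energy (prune ts S) i j u xi <= tau ^+ 2 * l u} &
    tau ^+ 2 * (\sum_(t <- ts) l t.1) <= (size is_)%:R * energy a m.+1 [::] [::]].
  elim: is_ => [|i is_ IH] /=.
    by exists [::]; split=> //; rewrite big_nil mulr0 mul0r.
  case/andP=> neq /IH[ts [sts hts hsum]].
  have S1Q := prune_quartiles ts SQ.
  (* No rank exceeds [4 ^ m.+1], so this bound is harmless as a start. *)
  have [|ts1 [Q [sts1 small sumQ [uQ QS dQ _]]]] :=
    @select_trees i j (tau ^+ 2) (prune ts S) (4 ^ m.+1) neq t0 S1Q.
    move=> u xi sxi _; rewrite /rank; case: ifP => _; last by rewrite sxi leq_subr.
    by rewrite -sxi ltnW // num_lt.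
  exists (ts ++ ts1); split.
  - by rewrite all_cat sts sts1.
  - move=> i'; rewrite in_cons => /orP[/eqP->|i'in] u xi sxi; rewrite -prune_cat.
      exact: small.
    apply: le_trans (hts i' i'in u xi sxi); exact: tree_energy_prune.
  - rewrite big_cat mulrDr -natr1 mulrDl mul1r; apply: lerD => //.
    apply: le_trans sumQ _; apply: jtiles_bessel => //; split=> //.
    by move=> s /QS; apply: (proj2 S1Q).
have [|ts [sts hts hsum]] := key [seq i <- enum 'I_4 | i != j].
  by apply/allP => i; rewrite mem_filter => /andP[].
exists ts; split=> //.
  by move=> i neq u xi sxi; apply: hts => //; rewrite mem_filter neq mem_enum.
apply: le_trans hsum _; apply: ler_wpM2r; first exact: energy_ge0.
rewrite ler_nat; apply: leq_trans (size_subseq (filter_subseq _ _)) _.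
by rewrite size_enum_ord.
Qed.

(** A single quartile belongs to the tree whose top consists of its own time interval and a
    frequency in its [i]-th tile, for any [i != j]. Padding with zeros gives that frequency the full
    length. *)
Lemma coefficient_size_le S j sigma s : quartiles S ->
  size_le S j sigma -> s \in S -> a s.1 (j :: s.2) ^+ 2 <= sigma ^+ 2 * l s.1.
Proof.
move=> [uS sS] h sP.
have [i neq] : exists i : 'I_4, i != j.
  by exists (if j == ord0 then ord_max else ord0); case: (eqVneq j ord0) => [->|]; rewrite // eq_sym.
pose xi := nseq (size s.1) ord0 ++ i :: s.2.
have sxi : size xi = m.+1.
  by rewrite size_cat size_nseq /= addnS; congr _.+1; exact: sS.
apply: le_trans (h i neq s.1 xi sxi).
rewrite /tree_energy big_mkcond (bigD1_seq s) //= suffix_refl suffix_suffix lerDl.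
by apply: sumr_ge0 => s' _; case: ifP => // _; exact: sqr_ge0.
Qed.

(** This gives the initial sizes, before any pruning. If the tree has a quartile in [S], the average
    over its top is controlled, and the descent of [tree_energy_aux] starts from the tile over [u]
    that contains [xi]. *)
Lemma size_le_average (L : word -> R) (c : R) S j :
  (forall u, 0 <= L u) -> (forall q u, L (q :: u) <= L u) ->
  (forall u v, a u v ^+ 2 * l u <= L u ^+ 2) -> 0 <= c -> quartiles S ->
  {in S, forall s u, suffix u s.1 -> L u <= c * l u} -> size_le S j (4 * c).
Proof.
move=> L0 Lc aL c0 SQ LS i neq u xi sxi; rewrite exprMn (_ : 4 ^+ 2 = 16); last by ring.
have [/hasP[s sP /andP[su _]]|/hasPn hn] :=
    boolP (has (fun s => suffix u s.1 && suffix (i :: s.2) xi) S); last first.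
  rewrite /tree_energy big_seq_cond big1; last by move=> s /andP[/hn /negbTE ->].
  by rewrite !mulr_ge0 ?sqr_ge0 // ltW.
have su' : (size u <= m)%N.
  by rewrite -((proj2 SQ) _ sP) (leq_trans (suffix_leq su)) // leq_addr.
apply: le_trans (tree_energy_aux (d := (m.+1 - size u)%N) L0 Lc aL c0 SQ LS neq sxi _ (suffix_drop xi (size u)) _ _).
- by rewrite lerDl sqr_ge0.
- by rewrite subnKC // leqW.
- by rewrite size_drop sxi.
- apply: le_trans (LS _ sP _ su) _; apply: ler_wpM2r; first exact: ltW.
  by rewrite ler_peMl // (ler_nat R 1 4).
Qed.

End Trees.

(** * The trilinear form estimated by sizes and masses *)

Section Forms.
Variables (A : 'I_3 -> word -> word -> R) (l : word -> R) (m : nat).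
Hypothesis A_split : forall k u v,
  \sum_(r < 4) A k u (r :: v) ^+ 2 = \sum_(q < 4) A k (q :: u) v ^+ 2.
Hypothesis l_gt0 : forall u, 0 < l u.
Hypothesis l_cons : forall q u, l (q :: u) = l u / 4.

Definition tile_index (k : 'I_3) : 'I_4 := widen_ord (isT : 3 <= 4)%N k.

Lemma tile_index_inj : injective tile_index.
Proof. by move=> k k' /(congr1 val) /= /ord_inj. Qed.

Definition form_term (s : word * word) : R :=
  (Num.sqrt (l s.1))^-1 * \prod_(k < 3) `|A k s.1 (tile_index k :: s.2)|.

Definition form S : R := \sum_(s <- S) form_term s.

Lemma form_term_ge0 s : 0 <= form_term s.
Proof. by rewrite mulr_ge0 ?invr_ge0 ?sqrtr_ge0 ?prodr_ge0. Qed.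

Definition sizes_le S (sigma : 'I_3 -> R) :=
  forall k, size_le (A k) l m S (tile_index k) (sigma k).

Lemma coefficient_norm_le S sigma k s : quartiles m S -> sizes_le S sigma ->
  0 < sigma k -> s \in S ->
  `|A k s.1 (tile_index k :: s.2)| <= sigma k * Num.sqrt (l s.1).
Proof.
move=> SQ h s0 sP; have e : Num.sqrt (sigma k ^+ 2) = sigma k.
  by rewrite sqrtr_sqr gtr0_norm.
rewrite -sqrtr_sqr -[X in X * _]e -sqrtrM ?sqr_ge0 // ler_wsqrtr //.
exact: (coefficient_size_le SQ (h k) sP).
Qed.

(* The coefficients of index k0 are bounded pointwise and the two remaining
   families of coefficients, for which the part is lacunary, in l^2. *)
Lemma tree_part_le S sigma (k0 k1 k2 : 'I_3) i u xi : quartiles m S ->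
  sizes_le S sigma -> (forall k, 0 < sigma k) -> size xi = m.+1 ->
  (forall F : 'I_3 -> R, \prod_(k < 3) F k = F k0 * F k1 * F k2) ->
  i != tile_index k1 -> i != tile_index k2 ->
  \sum_(s <- S | suffix u s.1 && suffix (i :: s.2) xi) form_term s
    <= (\prod_(k < 3) sigma k) * l u.
Proof.
move=> SQ h s0 sxi hp n1 n2.
have e1 := h k1 i n1 u xi sxi; have e2 := h k2 i n2 u xi sxi.
pose x k s := A k s.1 (tile_index k :: s.2).
rewrite hp.
(* The two lacunary coefficients are divided by their sizes before the arithmetic-geometric mean
   inequality is applied, so that each of the two sums of squares is at most [l u]. *)
apply: (@le_trans _ _ (\sum_(s <- S | suffix u s.1 && suffix (i :: s.2) xi)
    sigma k0 * (sigma k1 * sigma k2 / 2) *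
      (x k1 s ^+ 2 / sigma k1 ^+ 2 + x k2 s ^+ 2 / sigma k2 ^+ 2))).
  rewrite big_seq_cond [leRHS]big_seq_cond; apply: ler_sum => s /andP[sP _].
  rewrite /form_term hp -/(x k0 s) -/(x k1 s) -/(x k2 s).
  have sl : 0 < Num.sqrt (l s.1) by rewrite sqrtr_gt0.
  rewrite [leLHS](_ : _ = (`|x k0 s| / Num.sqrt (l s.1)) * (`|x k1 s| * `|x k2 s|)); last by ring.
  rewrite -[leRHS]mulrA; apply: ler_pM => //.
  - rewrite ler_pdivrMr //; exact: coefficient_norm_le SQ h _ sP.
  - have p1 := s0 k1; have p2 := s0 k2.
    have -> : sigma k1 * sigma k2 / 2 *
      (x k1 s ^+ 2 / sigma k1 ^+ 2 + x k2 s ^+ 2 / sigma k2 ^+ 2) =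
      sigma k1 * sigma k2 / 2 *
       ((`|x k1 s| / sigma k1) ^+ 2 + (`|x k2 s| / sigma k2) ^+ 2).
      by rewrite !expr_div_n !real_normK ?num_real; ring.
    have -> : `|x k1 s| * `|x k2 s| =
      sigma k1 * sigma k2 / 2 * (2 * (`|x k1 s| / sigma k1) * (`|x k2 s| / sigma k2)).
      by field; rewrite !gt_eqF.
    apply: ler_wpM2l; first by rewrite !mulr_ge0 // ltW.
    rewrite -subr_ge0.
    have := sqr_ge0 (`|x k1 s| / sigma k1 - `|x k2 s| / sigma k2); lra.
rewrite -mulr_sumr big_split /= -!mulr_suml.
have q1 : (\sum_(s <- S | suffix u s.1 && suffix (i :: s.2) xi) x k1 s ^+ 2)
    / sigma k1 ^+ 2 <= l u.
  by rewrite ler_pdivrMr ?exprn_gt0 // mulrC.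
have q2 : (\sum_(s <- S | suffix u s.1 && suffix (i :: s.2) xi) x k2 s ^+ 2)
    / sigma k2 ^+ 2 <= l u.
  by rewrite ler_pdivrMr ?exprn_gt0 // mulrC.
have -> : sigma k0 * sigma k1 * sigma k2 * l u =
  sigma k0 * (sigma k1 * sigma k2 / 2) * (l u + l u) by field.
apply: ler_wpM2l; last exact: lerD.
by rewrite !mulr_ge0 // ?ltW.
Qed.

Lemma prod3E (F : 'I_3 -> R) :
  \prod_(k < 3) F k = F ord0 * F (inord 1) * F (inord 2).
Proof.
rewrite !big_ord_recl big_ord0 mulr1 mulrA; congr (F _ * F _ * F _);
by apply/val_inj; rewrite /= ?inordK.
Qed.

(** Every quartile of a tree lies in one of its four parts. The part [i] is lacunary for each
    function whose tile index differs from [i], hence for at least two of the three; the remaining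
    one is taken as [k0]. *)
Lemma tree_form_le S sigma u xi : quartiles m S ->
  sizes_le S sigma -> (forall k, 0 < sigma k) -> size xi = m.+1 ->
  \sum_(s <- S | in_tree (u, xi) s) form_term s <= 4 * (\prod_(k < 3) sigma k) * l u.
Proof.
move=> SQ h s0 sxi.
apply: (@le_trans _ _ (\sum_(i < 4)
    \sum_(s <- S | suffix u s.1 && suffix (i :: s.2) xi) form_term s)).
  under [leRHS]eq_bigr do rewrite big_mkcond.
  rewrite exchange_big /= big_mkcond /=.
  rewrite big_seq_cond [leRHS]big_seq_cond; apply: ler_sum => s /andP[sP _].
  case: ifPn => [|_]; last first.
    by apply: sumr_ge0 => i _; case: ifP => // _; exact: form_term_ge0.
  case/andP => /= su sx.
  have lt : (size s.2 < size xi)%N.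
    by rewrite sxi ltnS -((proj2 SQ) _ sP) leq_addl.
  have [i si] := suffix_split sx lt.
  rewrite (bigD1 i) //= su si lerDl.
  by apply: sumr_ge0 => i' _; case: ifP => // _; exact: form_term_ge0.
have -> : 4 * (\prod_(k < 3) sigma k) * l u =
    \sum_(i < 4) (\prod_(k < 3) sigma k) * l u.
  by rewrite sumr_const card_ord -mulr_natr; ring.
apply: ler_sum => i _.
pose o0 : 'I_3 := ord0; pose o1 : 'I_3 := inord 1; pose o2 : 'I_3 := inord 2.
have P3 (F : 'I_3 -> R) : \prod_(k < 3) F k = F o0 * F o1 * F o2 by exact: prod3E.
case: (eqVneq i (tile_index o1)) => [->|n1].
  apply: (@tree_part_le _ _ o1 o0 o2) => //.
  - by move=> F; rewrite P3; ring.
  - by apply/eqP => /tile_index_inj /(congr1 val); rewrite /= !inordK.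
  - by apply/eqP => /tile_index_inj /(congr1 val); rewrite /= !inordK.
case: (eqVneq i (tile_index o2)) => [->|n2].
  apply: (@tree_part_le _ _ o2 o0 o1) => //.
  - by move=> F; rewrite P3; ring.
  - by apply/eqP => /tile_index_inj /(congr1 val); rewrite /= !inordK.
  - by apply/eqP => /tile_index_inj /(congr1 val); rewrite /= !inordK.
exact: (@tree_part_le _ _ o0 o1 o2).
Qed.

Lemma form_prune_le ts S :
  form S <= form (prune ts S) + \sum_(t <- ts) \sum_(s <- S | in_tree t s) form_term s.
Proof.
under eq_bigr do rewrite big_mkcond.
rewrite exchange_big /= /form /prune big_filter [X in _ <= X + _]big_mkcond -big_split /=.
apply: ler_sum => s _; case: ifPn => [_|].
  rewrite lerDl; apply: sumr_ge0 => t _; case: ifP => // _; exact: form_term_ge0.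
rewrite negbK add0r => /hasP[t tts /= ts_].
rewrite (big_rem t) //= ts_ lerDl.
by apply: sumr_ge0 => t' _; case: ifP => // _; exact: form_term_ge0.
Qed.

Definition halve (k : 'I_3) (sigma : 'I_3 -> R) k' :=
  if k' == k then sigma k' / 2 else sigma k'.

Lemma prod_halve k sigma :
  \prod_(k' < 3) halve k sigma k' = (\prod_(k' < 3) sigma k') / 2.
Proof.
rewrite (bigD1 k) //= [in RHS](bigD1 k) //= /halve eqxx mulrAC; congr (_ * _ / _).
by apply: eq_bigr => k' /negbTE ->.
Qed.

Local Notation mass k := (energy (A k) m.+1 [::] [::]).

(** Selecting at [sigma k / 2] removes trees whose tops have total length at most [16 * M], and a
    tree costs 4 times the product of the sizes per unit length of its top. *)
Lemma form_halve k S sigma M : quartiles m S -> sizes_le S sigma ->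
  (forall k, 0 < sigma k) -> mass k <= sigma k ^+ 2 * M ->
  exists ts, sizes_le (prune ts S) (halve k sigma) /\
    form S <= form (prune ts S) + 64 * (\prod_(k' < 3) sigma k') * M.
Proof.
move=> SQ h s0 hM.
have t0 : 0 < sigma k / 2 by rewrite divr_gt0.
have [ts [sts hts hsum]] := select_size (A_split k) l_gt0 (tile_index k) t0 SQ.
exists ts; split.
  move=> k'; rewrite /halve; case: eqP => [->//|_]; exact: size_le_prune.
apply: le_trans (form_prune_le ts S) _; rewrite lerD2l.
apply: (@le_trans _ _ (\sum_(t <- ts) 4 * (\prod_(k < 3) sigma k) * l t.1)).
  rewrite big_seq_cond [leRHS]big_seq_cond; apply: ler_sum => -[u xi] /andP[tP _].
  by apply: tree_form_le => //; apply/eqP; exact: (allP sts _ tP).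
rewrite -mulr_sumr.
have -> : 64 * (\prod_(k' < 3) sigma k') * M = 4 * (\prod_(k' < 3) sigma k') * (16 * M).
  by ring.
apply: ler_wpM2l; first by rewrite mulr_ge0 // prodr_ge0 // => k' _; rewrite ltW.
rewrite -(ler_pM2l (exprn_gt0 2 t0)); apply: le_trans hsum _.
rewrite expr_div_n.
have -> : sigma k ^+ 2 / 2 ^+ 2 * (16 * M) = 4 * (sigma k ^+ 2 * M) by field.
by rewrite ler_wpM2l.
Qed.

Lemma halve_gt0 k sigma : (forall k, 0 < sigma k) -> forall k', 0 < halve k sigma k'.
Proof. by move=> h k'; rewrite /halve; case: ifP => // _; rewrite divr_gt0. Qed.

Let o0 : 'I_3 := ord0.
Let o1 : 'I_3 := inord 1.
Let o2 : 'I_3 := inord 2.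

Lemma halveE k k' sigma : halve k sigma k' = if k' == k then sigma k' / 2 else sigma k'.
Proof. by []. Qed.

Lemma o01 : (o0 == o1) = false. Proof. by apply/eqP => /(congr1 val); rewrite /= inordK. Qed.
Lemma o02 : (o0 == o2) = false. Proof. by apply/eqP => /(congr1 val); rewrite /= inordK. Qed.
Lemma o12 : (o1 == o2) = false. Proof. by apply/eqP => /(congr1 val); rewrite /= !inordK. Qed.

Lemma ordP3 (P : 'I_3 -> Prop) : P o0 -> P o1 -> P o2 -> forall k, P k.
Proof.
move=> h0 h1 h2 [[|[|[|//]]] hk].
- by rewrite (_ : Ordinal hk = o0) //; apply: val_inj.
- by rewrite (_ : Ordinal hk = o1) //; apply: val_inj; rewrite /= inordK.
- by rewrite (_ : Ordinal hk = o2) //; apply: val_inj; rewrite /= inordK.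
Qed.

(** Three coefficients of order [sigma k * sqrt l] against one factor [1 / sqrt l] leave a full [l]
    for every quartile. The bound depends on [S] through [B], but it enters only after [n] rounds of
    halving, divided by [8 ^ n]. *)
Lemma form_trivial S sigma B : quartiles m S -> sizes_le S sigma ->
  (forall k, 0 < sigma k) -> \sum_(s <- S) l s.1 <= B ->
  form S <= (\prod_(k < 3) sigma k) * B.
Proof.
move=> SQ h s0 hB.
apply: (@le_trans _ _ ((\prod_(k < 3) sigma k) * \sum_(s <- S) l s.1)); last first.
  by apply: ler_wpM2l => //; rewrite prodr_ge0 // => k _; exact: ltW.
rewrite mulr_sumr /form big_seq_cond [leRHS]big_seq_cond.
apply: ler_sum => s /andP[sP _].
have sl : 0 < Num.sqrt (l s.1) by rewrite sqrtr_gt0.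
rewrite /form_term mulrC ler_pdivrMr //.
apply: (@le_trans _ _ (\prod_(k < 3) (sigma k * Num.sqrt (l s.1)))).
  by apply: ler_prod => k _; rewrite normr_ge0 /=; exact: coefficient_norm_le SQ h _ sP.
rewrite big_split /= prodr_const card_ord exprS sqr_sqrtr ?(ltW (l_gt0 _)) //.
by rewrite mulrA mulrAC.
Qed.

(** Halving all three sizes divides their product by 8 and replaces [M] by [4 * M]. A round costs
    [64 * (1 + 1/2 + 1/4) = 112] times the product and [M]; consecutive rounds decrease by the
    factor 1/2, which gives 224. *)
Lemma form_le_small n S sigma M B : quartiles m S -> sizes_le S sigma ->
  (forall k, 0 < sigma k) -> 0 <= M -> \sum_(s <- S) l s.1 <= B ->
  (forall k, mass k <= sigma k ^+ 2 * M) ->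
  form S <= (\prod_(k < 3) sigma k) * (224 * M + B / 8 ^+ n).
Proof.
elim: n S sigma M => [|n IH] S sigma M SQ h s0 M0 hB hM.
  apply: le_trans (form_trivial SQ h s0 hB) _.
  apply: ler_wpM2l; first by rewrite prodr_ge0 // => k _; exact: ltW.
  by rewrite expr0 divr1 lerDr mulr_ge0.
have [ts1 [h1 F1]] := form_halve SQ h s0 (hM o0).
have Q1 := prune_quartiles ts1 SQ; have p1 := halve_gt0 o0 s0.
have [|ts2 [h2 F2]] := @form_halve o1 _ _ M Q1 h1 p1.
  by rewrite halveE [_ == _]eq_sym o01; exact: hM.
have Q2 := prune_quartiles ts2 Q1; have p2 := halve_gt0 o1 p1.
have [|ts3 [h3 F3]] := @form_halve o2 _ _ M Q2 h2 p2.
  by rewrite !halveE (eq_sym _ o1) o12 (eq_sym _ o0) o02; exact: hM.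
have Q3 := prune_quartiles ts3 Q2; have p3 := halve_gt0 o2 p2.
have hB3 : \sum_(s <- prune ts3 (prune ts2 (prune ts1 S))) l s.1 <= B.
  apply: le_trans hB.
  by do 3 (apply: le_trans (sum_prune _ _ _ _) _; first by move=> s; exact: ltW).
have M4 : 0 <= 4 * M by rewrite mulr_ge0.
have := IH _ _ _ Q3 h3 p3 M4 hB3.
rewrite !prod_halve in F2 F3 *.
set P := \prod_(k < 3) sigma k in F1 F2 F3 *.
have key k : mass k <= halve o2 (halve o1 (halve o0 sigma)) k ^+ 2 * (4 * M).
  have -> : halve o2 (halve o1 (halve o0 sigma)) k = sigma k / 2.
    move: k; apply: ordP3; rewrite !halveE ?eqxx ?o01 ?o02 ?o12 //.
    - by rewrite (eq_sym o1 o0) o01.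
    - by rewrite (eq_sym o2 o0) o02 (eq_sym o2 o1) o12.
  apply: le_trans (hM k) _; rewrite expr_div_n le_eqVlt; apply/orP; left.
  by apply/eqP; field.
move=> /(_ key) F4.
apply: le_trans F1 _; rewrite -lerBrDr.
apply: le_trans F2 _; rewrite -lerBrDr.
apply: le_trans F3 _; rewrite -lerBrDr.
apply: le_trans F4 _.
rewrite exprS invfM le_eqVlt; apply/orP; left; apply/eqP; field.
by rewrite expf_neq0.
Qed.

(** With enough rounds [B / 8 ^ n <= M], so the dependence on [S] disappears at the price of turning
    224 into 225. *)
Lemma form_le_balanced S sigma M : quartiles m S -> sizes_le S sigma ->
  (forall k, 0 < sigma k) -> 0 < M ->
  (forall k, mass k <= sigma k ^+ 2 * M) ->
  form S <= 225 * (\prod_(k < 3) sigma k) * M.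
Proof.
move=> SQ h s0 M0 hM.
pose B := \sum_(s <- S) l s.1.
have B0 : 0 <= B by apply: sumr_ge0 => s _; exact: ltW.
pose n := Num.Def.archi_bound (B / M).
apply: le_trans (@form_le_small n S sigma M B SQ h s0 (ltW M0) (lexx _) hM) _.
rewrite [225 * _]mulrC -mulrA; apply: ler_wpM2l.
  by rewrite prodr_ge0 // => k _; exact: ltW.
have : B / 8 ^+ n <= M; last by lra.
rewrite ler_pdivrMr ?exprn_gt0 // -ler_pdivrMl // mulrC.
apply: le_trans (ltW (archi_boundP (divr_ge0 B0 (ltW M0)))) _.
rewrite -/n -natrX ler_nat ltnW //; exact: ltn_expl.
Qed.

(** Halving only the sizes of the second and third functions divides the product by 4 and replaces
    [M] by [4 * M]. Every round thus costs the same, [64 + 32 = 96] times the product and [M], and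
    after [n] rounds the mass of the first function is balanced with the others. *)
Lemma form_le n S sigma M : quartiles m S -> sizes_le S sigma ->
  (forall k, 0 < sigma k) -> 0 < M ->
  mass o1 <= sigma o1 ^+ 2 * M -> mass o2 <= sigma o2 ^+ 2 * M ->
  mass o0 <= sigma o0 ^+ 2 * (M * 4 ^+ n) ->
  form S <= (225 + 96 * n%:R) * (\prod_(k < 3) sigma k) * M.
Proof.
elim: n S sigma M => [|n IH] S sigma M SQ h s0 M0 hM1 hM2 hM0.
  rewrite mulr0 addr0; apply: form_le_balanced => //.
  by apply: ordP3 => //; rewrite expr0 mulr1 in hM0.
have [ts1 [h1 F1]] := form_halve SQ h s0 hM1.
have Q1 := prune_quartiles ts1 SQ; have p1 := halve_gt0 o1 s0.
have [|ts2 [h2 F2]] := @form_halve o2 _ _ M Q1 h1 p1.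
  by rewrite halveE [_ == _]eq_sym o12; exact: hM2.
have Q2 := prune_quartiles ts2 Q1; have p2 := halve_gt0 o2 p1.
have M4 : 0 < 4 * M by rewrite mulr_gt0.
have := IH _ _ _ Q2 h2 p2 M4.
rewrite !prod_halve in F2 *.
set P := \prod_(k < 3) sigma k in F1 F2 *.
rewrite !halveE !eqxx o01 o02 o12 (eq_sym o2 o1) o12.
have sq (x : R) : (x / 2) ^+ 2 * (4 * M) = x ^+ 2 * M by field.
rewrite !sq -mulrA [4 * (_ * _)]mulrCA -exprS => /(_ hM1 hM2 hM0) F4.
apply: le_trans F1 _; rewrite -lerBrDr.
apply: le_trans F2 _; rewrite -lerBrDr.
apply: le_trans F4 _.
rewrite -natr1 le_eqVlt; apply/orP; left; apply/eqP; by field.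
Qed.

End Forms.
End Words.

(** * Walsh packets *)

Section RealIntegrals.
Context {R : realType}.
Local Notation mu := (@lebesgue_measure R).
Implicit Types f g w : R -> R.

Definition integ f := mu.-integrable setT (EFin \o f).

Definition square_integrable f := measurable_fun setT f /\ integ (fun x => f x ^+ 2).

Lemma integ_measurable f : integ f -> measurable_fun setT f.
Proof. by move=> /measurable_int /measurable_EFinP. Qed.

Lemma integ_le f g : measurable_fun setT f -> (forall x, `|f x| <= g x) ->
  integ g -> integ f.
Proof.
move=> mf h ig; apply: (le_integrable _ _ _ ig) => //; first exact/measurable_EFinP.
by move=> x _ /=; rewrite lee_fin; apply: le_trans (h x) (ler_norm _).
Qed.

Lemma integD f g : integ f -> integ g -> integ (fun x => f x + g x).
Proof. by move=> h1 h2; exact: (integrableD measurableT h1 h2). Qed.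

Lemma integZ (k : R) f : integ f -> integ (fun x => k * f x).
Proof. by move=> h; exact: (integrableZl measurableT k h). Qed.

Lemma integ_itv (a b : R) : integ \1_(`[a, b]).
Proof. exact: integrable_indic_itv. Qed.

(** The three points are meant to be the ends and the midpoint of a dyadic interval. There the
    splitting of Walsh packets may fail, because packets live on closed intervals and the signs of
    the sines vanish. *)
Lemma Rintegral_off3 f g (a b c : R) : measurable_fun setT f -> measurable_fun setT g ->
  (forall x, x != a -> x != b -> x != c -> f x = g x) ->
  \int[mu]_x f x = \int[mu]_x g x.
Proof.
move=> mf mg h; congr fine; apply: ae_eq_integral => //.
- exact/measurable_EFinP.
- exact/measurable_EFinP.
have h0 : mu [set x | [|| x == a, x == b | x == c]] = 0%E.
  apply: countable_lebesgue_measure0; apply: finite_set_countable.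
  apply: (@sub_finite_set _ _ [set` [:: a; b; c]]); last exact: finite_seq.
  by move=> x /= ; rewrite !inE.
exists [set x | [|| x == a, x == b | x == c]]; split=> //.
  have -> : [set x | [|| x == a, x == b | x == c]] = [set a] `|` [set b] `|` [set c].
    apply/seteqP; split=> x /=.
      by case/or3P => /eqP ->; [left; left|left; right|right].
    by move=> [[->|->]|->]; rewrite eqxx ?orbT.
  by apply: measurableU => //; apply: measurableU.
move=> x /= hx; apply: contrapT => /negP; rewrite !negb_or => /and3P[xa xb xc].
by apply: hx => _; rewrite h.
Qed.

End RealIntegrals.

Section Walsh.
Context {R : realType}.
Local Notation mu := (@lebesgue_measure R).
Implicit Types (I : dyadic) (n : nat) (x z : R).

Lemma walsh_extend K n x : (n <= K)%N -> 0 <= x <= 1 ->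
  walsh n x = \prod_(k < K) Num.sg (sin (2 ^+ k * 2 * pi * x)) ^+ odd (n %/ 2 ^ k).
Proof.
move=> nK x01; rewrite /walsh x01 -(subnKC nK) big_split_ord /=.
rewrite [X in _ = _ * X]big1 ?mulr1 // => k _.
by rewrite divn_small // (leq_trans (ltn_expl n (isT : 1 < 2)%N)) // leq_pexp2l // leq_addr.
Qed.

(** The lowest binary digit [e] switches on the sign of [sin (2 pi x)], positive on the left half
    and negative on the right one; the factors of the higher digits are 1-periodic in [z]. At the
    end points the sine vanishes, hence the strict inequalities. *)
Lemma walsh_half n (e b : bool) z : 0 < z < 1 ->
  walsh (e + n.*2) ((z + b%:R) / 2) = (-1) ^+ (e && b) * walsh n z :> R.
Proof.
move=> /andP[z0 z1].
have zb : 0 <= (z + b%:R) / 2 <= 1 by apply/andP; case: b; rewrite /= ?mulr1n ?mulr0n; lra.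
have z01 : 0 <= z <= 1 by lra.
rewrite (@walsh_extend n.*2.+2.+1) //; last first.
  by rewrite -addn3 addnC leq_add2l; case: e.
rewrite big_ord_recl /= divn1 oddD odd_double addbF oddb.
congr (_ * _).
  case: e => //=; rewrite expr1 expr0 mul1r.
  have -> : 2 * pi * ((z + b%:R) / 2) = pi * z + pi *+ b :> R.
    by rewrite -mulr_natr; field.
  have pz : 0 < sin (pi * z) :> R.
    by apply: sin_gt0_pi; rewrite mulr_gt0 ?pi_gt0 //= gtr_pMr ?pi_gt0.
  by case: b {zb}; rewrite ?mulr1n ?mulr0n ?addr0 ?sinDpi ?sgrN gtr0_sg ?expr0 ?expr1.
rewrite (@walsh_extend n.*2.+2) //; last by rewrite -addnn -addn2 -addnA leq_addr.
apply: eq_bigr => k _; rewrite /bump /= add1n; congr (Num.sg _ ^+ _).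
- have -> : 2 ^+ k.+1 * 2 * pi * ((z + b%:R) / 2) =
    2 ^+ k * 2 * pi * z + (pi *+ 2) *+ (2 ^ k * b) :> R.
    rewrite -[X in _ = _ + X]mulr_natr.
    have -> : (2 ^ k * b)%:R = 2 ^+ k * b%:R :> R by rewrite natrM natrX.
    rewrite mulr2n exprS; move: (2 ^+ k) (b%:R : R) (pi : R) => X Y Z.
    by field.
  elim: (2 ^ k * b)%N => [|m IH]; first by rewrite mulr0n addr0.
  by rewrite (mulrSr (pi *+ 2)) addrA sinD2pi.
- by rewrite expnS divnMA divn2 half_bit_double.
Qed.

Lemma norm_walsh n x : `|walsh n x| <= (0 <= x <= 1)%R%:R.
Proof.
rewrite /walsh; case: ifP => _; last by rewrite normr0.
elim/big_rec: _ => [|k y _ hy]; first by rewrite normr1.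
rewrite normrM mulr_ile1 // normrX; case: (odd _); last by rewrite expr0.
by rewrite expr1 normr_sg; case: (_ != _).
Qed.

Lemma measurable_sg : measurable_fun setT (@Num.sg R).
Proof.
have -> : @Num.sg R = fun x => if x == 0 then 0 else if x < 0 then -1 else 1.
  by apply/funext => x.
apply: measurable_fun_ifT => //; first exact: measurable_fun_eqr.
by apply: measurable_fun_ifT => //; exact: measurable_fun_ltr.
Qed.

Lemma measurable_walsh n : measurable_fun setT (@walsh R n).
Proof.
apply: measurable_fun_ifT => //.
  by apply: measurable_and; exact: measurable_fun_ler.
apply: measurable_prod => k _; apply: measurable_funX.
apply: measurableT_comp; first exact: measurable_sg.
apply: measurableT_comp; last exact: measurable_funM.
by apply: continuous_measurable_fun; exact: continuous_sin.
Qed.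

(** The index is kept separate from the interval, since passing to halves of [I] changes both
    independently. *)
Definition wpack I n x : R :=
  (Num.sqrt (dyadic_len R I))^-1 * walsh n ((x - dyadic_left R I) / dyadic_len R I).

Lemma dyadic_len_gt0 I : 0 < dyadic_len R I.
Proof. by rewrite exprz_gt0. Qed.

Definition dyadic_half I (b : bool) : dyadic := (I.1 - 1, 2 * I.2 + b%:Z).

Lemma dyadic_len_half I b : dyadic_len R (dyadic_half I b) = dyadic_len R I / 2.
Proof. by rewrite /dyadic_len /= expfzDr // exprN1. Qed.

Lemma dyadic_left_half I b :
  dyadic_left R (dyadic_half I b) = dyadic_left R I + b%:R * (dyadic_len R I / 2).
Proof.
rewrite /dyadic_left dyadic_len_half /= intrD intrM /=.
rewrite (_ : b%:Z%:~R = b%:R :> R) //; by field.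
Qed.

Lemma measurable_wpack I n : measurable_fun setT (wpack I n).
Proof.
apply: measurable_funM => //; apply: measurableT_comp; first exact: measurable_walsh.
by apply: measurable_funM => //; exact: measurable_funB.
Qed.

Lemma norm_wpack I n x : `|wpack I n x| <= (Num.sqrt (dyadic_len R I))^-1 *
  \1_(`[dyadic_left R I, dyadic_left R I + dyadic_len R I]) x.
Proof.
have l0 := dyadic_len_gt0 I.
have s0 : 0 < (Num.sqrt (dyadic_len R I))^-1 by rewrite invr_gt0 sqrtr_gt0.
rewrite normrM gtr0_norm // ler_pM2l //; apply: le_trans (norm_walsh _ _) _.
rewrite indicE mem_setE in_itv /= ler_pdivlMr // ler_pdivrMr // mul0r mul1r.
by rewrite subr_ge0 lerBlDl.
Qed.

Lemma sqr_wpack I n x : wpack I n x ^+ 2 <= (dyadic_len R I)^-1 *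
  \1_(`[dyadic_left R I, dyadic_left R I + dyadic_len R I]) x.
Proof.
have l0 := dyadic_len_gt0 I.
have h := norm_wpack I n x.
rewrite -real_normK ?num_real //.
apply: (@le_trans _ _ (((Num.sqrt (dyadic_len R I))^-1 *
  \1_(`[dyadic_left R I, dyadic_left R I + dyadic_len R I]) x) ^+ 2)).
  by rewrite lerXn2r ?nnegrE // (le_trans _ h).
rewrite exprMn exprVn sqr_sqrtr ?(ltW l0) // indicE.
by case: (_ \in _) => /=; rewrite ?expr1n ?expr0n.
Qed.

Lemma square_integrable_wpack I n : square_integrable (wpack I n).
Proof.
split; first exact: measurable_wpack.
apply: integ_le; first by apply: measurable_funX; exact: measurable_wpack.
  by move=> x; rewrite ger0_norm ?sqr_ge0 //; exact: sqr_wpack.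
by apply: integZ; exact: integ_itv.
Qed.

Lemma integ_mul (f w : R -> R) : square_integrable f -> square_integrable w ->
  integ (fun x => f x * w x).
Proof.
move=> [mf f2] [mw w2].
apply: integ_le (integD f2 w2); first exact: measurable_funM.
move=> x; rewrite normrM.
have := sqr_ge0 (`|f x| - `|w x|).
rewrite -[f x ^+ 2]real_normK ?num_real // -[w x ^+ 2]real_normK ?num_real //.
have := sqr_ge0 `|f x|; have := sqr_ge0 `|w x|; lra.
Qed.

Definition rpair (f w : R -> R) : R := \int[mu]_x (f x * w x).

Lemma sqrt2_gt0 : 0 < Num.sqrt 2 :> R. Proof. by rewrite sqrtr_gt0. Qed.

Lemma wpack_split I n (e : bool) x :
  x != dyadic_left R I -> x != dyadic_left R I + dyadic_len R I / 2 ->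
  x != dyadic_left R I + dyadic_len R I ->
  wpack I (e + n.*2) x = (Num.sqrt 2)^-1 *
    (wpack (dyadic_half I false) n x + (-1) ^+ e * wpack (dyadic_half I true) n x).
Proof.
move=> h0 h1 h2; have l0 := dyadic_len_gt0 I; have s2 := sqrt2_gt0.
rewrite /wpack !dyadic_left_half !dyadic_len_half mul0r addr0 mul1r.
set a := dyadic_left R I in h0 h1 h2 *; set l := dyadic_len R I in h1 h2 l0 *.
have sl : 0 < Num.sqrt l by rewrite sqrtr_gt0.
rewrite sqrtrM ?ltW // sqrtrV //.
(* In units of half the interval, the left half is [0 < z < 1] and the right half [1 < z < 2]. On
   each of them one packet on the right-hand side vanishes and [walsh_half] gives the other. *)
pose z := (x - a) / (l / 2).
have ez : (x - a) / l = z / 2 by rewrite /z; field; rewrite gt_eqF.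
have ez1 : (x - (a + l / 2)) / (l / 2) = z - 1 by rewrite /z; field; rewrite gt_eqF.
rewrite -/z ez ez1.
have n0 : z != 0.
  by rewrite mulf_neq0 ?subr_eq0 // invr_neq0 // mulf_neq0 ?gt_eqF.
have n1 : z != 1.
  rewrite -subr_eq0 -ez1 mulf_neq0 //; first by rewrite subr_eq0.
  by rewrite invr_neq0 // mulf_neq0 ?gt_eqF.
have n2 : z != 2.
  apply: contra h2 => /eqP; rewrite /z => h; apply/eqP.
  have : x - a = l; last by move=> <-; rewrite addrC subrK.
  by move: h => /(congr1 (fun t => t * (l / 2))); rewrite divfK ?mulf_neq0 ?gt_eqF // => ->; field.
have w_out y : ~~ (0 <= y <= 1) -> forall m, walsh m y = 0 :> R.
  by move=> /negbTE hy m; rewrite /walsh hy.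
have [zlt|zge] := ltP z 0.
  have o1 : ~~ (0 <= z / 2 <= 1) by apply/negP => /andP[]; lra.
  have o2 : ~~ (0 <= z <= 1) by apply/negP => /andP[]; lra.
  have o3 : ~~ (0 <= z - 1 <= 1) by apply/negP => /andP[]; lra.
  by rewrite (w_out _ o1) (w_out _ o2) (w_out _ o3) !mulr0 addr0 mulr0.
have [zgt|zle] := ltP 2 z.
  have o1 : ~~ (0 <= z / 2 <= 1) by apply/negP => /andP[]; lra.
  have o2 : ~~ (0 <= z <= 1) by apply/negP => /andP[]; lra.
  have o3 : ~~ (0 <= z - 1 <= 1) by apply/negP => /andP[]; lra.
  by rewrite (w_out _ o1) (w_out _ o2) (w_out _ o3) !mulr0 addr0 mulr0.
have zgt0 : 0 < z by rewrite lt_neqAle eq_sym n0.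
have zlt2 : z < 2 by rewrite lt_neqAle n2.
have e2 : (Num.sqrt 2)^-1 * Num.sqrt 2 = 1 :> R by rewrite mulVf ?gt_eqF.
have [z1|z1] := ltP z 1.
  have -> : walsh n (z - 1) = 0 :> R by apply: w_out; apply/negP => /andP[]; lra.
  rewrite !mulr0 addr0.
  have -> : z / 2 = (z + false%:R) / 2 :> R by rewrite addr0.
  rewrite walsh_half ?zgt0 // andbF mul1r invfM invrK.
  by rewrite -!mulrA mulrCA [X in _ = _ * X]mulrA e2 mul1r.
have {}z1 : 1 < z by rewrite lt_neqAle eq_sym n1.
have -> : walsh n z = 0 :> R by apply: w_out; apply/negP => /andP[]; lra.
have -> : z / 2 = (z - 1 + true%:R) / 2 :> R by rewrite subrK.
rewrite walsh_half; last by apply/andP; split; lra.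
rewrite andbT mulr0 add0r invfM invrK.
have -> : (Num.sqrt 2)^-1 * ((-1) ^+ e * ((Num.sqrt l)^-1 * Num.sqrt 2 * walsh n (z - 1))) =
  ((Num.sqrt 2)^-1 * Num.sqrt 2) * ((Num.sqrt l)^-1 * ((-1) ^+ e * walsh n (z - 1))) by ring.
by rewrite e2 mul1r.
Qed.

Lemma rpair_split f I n (e : bool) : square_integrable f ->
  rpair f (wpack I (e + n.*2)) = (Num.sqrt 2)^-1 *
    (rpair f (wpack (dyadic_half I false) n)
     + (-1) ^+ e * rpair f (wpack (dyadic_half I true) n)).
Proof.
move=> hf.
have i0 := integ_mul hf (square_integrable_wpack (dyadic_half I false) n).
have i1 := integ_mul hf (square_integrable_wpack (dyadic_half I true) n).
have i2 := integ_mul hf (square_integrable_wpack I (e + n.*2)).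
rewrite /rpair -RintegralZl // -RintegralD //; last exact: integZ.
rewrite -RintegralZl //; last by apply: integD => //; exact: integZ.
apply: (@Rintegral_off3 _ _ _ (dyadic_left R I) (dyadic_left R I + dyadic_len R I / 2)
  (dyadic_left R I + dyadic_len R I)).
- exact: integ_measurable.
- apply: integ_measurable; apply: integZ; apply: integD => //; exact: integZ.
- by move=> x h0 h1 h2; rewrite wpack_split //; ring.
Qed.

Lemma rpair_split_sqr f I n : square_integrable f ->
  rpair f (wpack I n.*2) ^+ 2 + rpair f (wpack I n.*2.+1) ^+ 2 =
  rpair f (wpack (dyadic_half I false) n) ^+ 2 +
  rpair f (wpack (dyadic_half I true) n) ^+ 2.
Proof.
move=> hf; have := rpair_split I n false hf; have := rpair_split I n true hf.
rewrite add0n add1n /= => -> ->.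
have h : (Num.sqrt 2)^-1 ^+ 2 = 2^-1 :> R by rewrite exprVn sqr_sqrtr.
by rewrite !exprMn h expr0 expr1 mul1r mulN1r; field.
Qed.

Definition dyadic_child I (q : nat) : dyadic := (I.1 - 2, 4 * I.2 + q%:Z).

(** The binary identity is used twice: the indices [4n + r] on [I] pair up into [2n] and [2n + 1] on
    the halves, and these into [n] on the quarters. *)
Lemma rpair_split4 f I n : square_integrable f ->
  \sum_(r < 4) rpair f (wpack I (4 * n + r)) ^+ 2 =
  \sum_(q < 4) rpair f (wpack (dyadic_child I q) n) ^+ 2.
Proof.
move=> hf; rewrite !big_ord_recr !big_ord0 /= !add0r.
have e0 : (4 * n + 0)%N = n.*2.*2 by lia.
have e1 : (4 * n + 1)%N = n.*2.*2.+1 by lia.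
have e2 : (4 * n + 2)%N = n.*2.+1.*2 by lia.
have e3 : (4 * n + 3)%N = n.*2.+1.*2.+1 by lia.
rewrite e0 e1 e2 e3 -[LHS]addrA.
rewrite (rpair_split_sqr I n.*2 hf) (rpair_split_sqr I n.*2.+1 hf) addrACA.
rewrite (rpair_split_sqr (dyadic_half I false) n hf).
rewrite (rpair_split_sqr (dyadic_half I true) n hf).
have half2 b b' : dyadic_half (dyadic_half I b) b' = dyadic_child I (b.*2 + b').
  rewrite /dyadic_half /dyadic_child /=; congr pair; first by lia.
  by case: b; case: b'; lia.
by rewrite !half2 !addrA.
Qed.

End Walsh.

(** * Estimates off exceptional sets *)

Section SetIntegrals.
Context {R : realType}.
Local Notation mu := (@lebesgue_measure R).
Implicit Types (f g : R -> R) (I : dyadic).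

Lemma integ_on (D : set R) f : measurable D -> integ f -> mu.-integrable D (EFin \o f).
Proof. by move=> mD h; apply: integrableS h. Qed.

Lemma integ_abs f : integ f -> integ (fun x => `|f x|).
Proof. by move=> h; exact: (integrable_abse h). Qed.

Lemma integ_mul_indic (D : set R) f : measurable D -> integ f ->
  integ (fun x => f x * \1_D x).
Proof.
move=> mD h; apply: (integ_le _ _ (integrable_abse h)) => /=.
  by apply: measurable_funM; [exact: integ_measurable|exact: measurable_indic].
by move=> x; rewrite normrM indicE; case: (_ \in _); rewrite ?normr1 ?normr0 ?mulr1 ?mulr0.
Qed.

Lemma Rintegral_indic (D : set R) f :
  \int[mu]_(x in D) f x = \int[mu]_x (f x * \1_D x).
Proof.
rewrite Rintegral_mkcond; apply: eq_Rintegral => x _.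
by rewrite patchE indicE; case: ifP; rewrite ?mulr1 ?mulr0.
Qed.

Lemma integ_on_ext (D : set R) f g : measurable D -> integ g ->
  (forall x, D x -> f x = g x) -> mu.-integrable D (EFin \o f).
Proof.
move=> mD ig h.
apply: (@eq_integrable _ _ _ mu _ mD (EFin \o g) (EFin \o f)); last exact: integ_on.
by move=> x /set_mem xD /=; rewrite h.
Qed.

Lemma measurable_dyadic I : measurable (@dyadic_set R I).
Proof. exact: measurable_itv. Qed.

Lemma dyadic_measure I : mu (@dyadic_set R I) = (dyadic_len R I)%:E.
Proof.
rewrite /dyadic_set lebesgue_measure_itv /= lte_fin ltrDl dyadic_len_gt0.
by rewrite -EFinB addrAC subrr add0r.
Qed.

Lemma dyadic_set_half I :
  @dyadic_set R I = @dyadic_set R (dyadic_half I false) `|` @dyadic_set R (dyadic_half I true).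
Proof.
have l0 := @dyadic_len_gt0 R I.
rewrite /dyadic_set !dyadic_left_half !dyadic_len_half mul0r addr0 mul1r.
apply/seteqP; split=> x /=; rewrite !in_itv /=.
  by move=> /andP[h1 h2]; have [h|h] := ltP x (dyadic_left R I + dyadic_len R I / 2);
    [left|right]; apply/andP; split => //; lra.
by case=> /andP[h1 h2]; apply/andP; split; lra.
Qed.

Lemma dyadic_set_half_disj I :
  [disjoint @dyadic_set R (dyadic_half I false) & @dyadic_set R (dyadic_half I true)]%classic.
Proof.
have l0 := @dyadic_len_gt0 R I.
rewrite /dyadic_set !dyadic_left_half !dyadic_len_half mul0r addr0 mul1r.
apply/disj_setPS => x /=; rewrite !in_itv /= => -[/andP[h1 h2] /andP[h3 h4]].
by move: h2; rewrite ltNge h3.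
Qed.

Definition local_integ g := forall I, mu.-integrable (@dyadic_set R I) (EFin \o g).

Definition dint g I : R := \int[mu]_(x in @dyadic_set R I) g x.

Lemma dint_half g I : local_integ g ->
  dint g I = dint g (dyadic_half I false) + dint g (dyadic_half I true).
Proof.
move=> hg; rewrite /dint dyadic_set_half Rintegral_setU //.
- exact: measurable_dyadic.
- exact: measurable_dyadic.
- by rewrite -dyadic_set_half.
- exact: dyadic_set_half_disj.
Qed.

Lemma dyadic_half_half I b b' :
  dyadic_half (dyadic_half I b) b' = dyadic_child I (b.*2 + b').
Proof.
rewrite /dyadic_half /dyadic_child /=; congr pair; first by lia.
by case: b; case: b'; lia.
Qed.

Lemma dint_child g I : local_integ g ->
  dint g I = \sum_(q < 4) dint g (dyadic_child I q).
Proof.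
move=> hg; rewrite (dint_half I hg) (dint_half (dyadic_half I false) hg).
rewrite (dint_half (dyadic_half I true) hg) !dyadic_half_half.
by rewrite !big_ord_recr big_ord0 /= !add0r !addrA.
Qed.

Lemma dint_ge0 g I : (forall x, 0 <= g x) -> 0 <= dint g I.
Proof. by move=> h; apply: Rintegral_ge0. Qed.

Lemma dint_le g h I : local_integ g -> local_integ h -> (forall x, g x <= h x) ->
  dint g I <= dint h I.
Proof.
move=> hg hh gh; apply: le_Rintegral => //; exact: measurable_dyadic.
Qed.

Lemma dint_le_total g I : integ g -> (forall x, 0 <= g x) -> dint g I <= \int[mu]_x g x.
Proof.
move=> ig g0; have mD := measurable_dyadic I.
rewrite /dint Rintegral_indic; apply: le_Rintegral => //.
  exact: integ_mul_indic.
by move=> x _; rewrite indicE; case: (_ \in _); rewrite ?mulr1 ?mulr0.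
Qed.

Lemma dint_cst c I : dint (fun=> c) I = c * dyadic_len R I.
Proof.
have mD := measurable_dyadic I.
by have := @Rintegral_cst _ _ _ mu _ mD c; rewrite [X in fine X]dyadic_measure.
Qed.

End SetIntegrals.

(** * Coefficients and heavy intervals below a root interval *)

Section Root.
Context {R : realType}.
Variable root : dyadic.
Local Notation mu := (@lebesgue_measure R).
Local Notation word := (seq 'I_4).
Implicit Types (f g : R -> R) (u v : word).

Fixpoint word_interval u : dyadic :=
  if u is q :: u' then dyadic_child (word_interval u') q else root.

Definition word_len u : R := dyadic_len R (word_interval u).

Definition coef f u v : R := rpair f (wpack (word_interval u) (word_num v)).

Lemma word_len_gt0 u : 0 < word_len u.
Proof. exact: dyadic_len_gt0. Qed.

Lemma word_len_cons q u : word_len (q :: u) = word_len u / 4.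
Proof.
rewrite /word_len /dyadic_len /= (_ : (word_interval u).1 - 2 = (word_interval u).1 - 1 - 1).
  by rewrite !expfzDr // exprN1; field.
by rewrite -addrA.
Qed.

Lemma coef_split f u v : square_integrable f ->
  \sum_(r < 4) coef f u (r :: v) ^+ 2 = \sum_(q < 4) coef f (q :: u) v ^+ 2.
Proof. by move=> hf; exact: rpair_split4. Qed.

Lemma square_integrable_abs_le f : square_integrable f ->
  forall x, `|f x| <= 1 + f x ^+ 2.
Proof.
move=> _ x; have := sqr_ge0 (`|f x| - 1); rewrite -[f x ^+ 2]real_normK ?num_real //.
by have := normr_ge0 (f x); nra.
Qed.

Lemma local_integ_of_integ f : integ f -> local_integ f.
Proof. by move=> hf I; apply: integ_on => //; exact: measurable_dyadic. Qed.

Lemma dyadic_indic_le I x : \1_(@dyadic_set R I) x <=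
  \1_(`[dyadic_left R I, dyadic_left R I + dyadic_len R I]) x :> R.
Proof.
rewrite !indicE !mem_setE /dyadic_set !in_itv /= ler_nat.
by case: (_ <= x) => //=; case: ltP => // /ltW ->.
Qed.

Lemma local_integ_square f : square_integrable f -> local_integ (fun x => `|f x|).
Proof.
move=> hf I; have mD := @measurable_dyadic R I; have [mf f2] := hf.
have h1 : integ (fun x => `|f x| * \1_(@dyadic_set R I) x).
  apply: (@integ_le _ _ (fun x => f x ^+ 2 +
     \1_(`[dyadic_left R I, dyadic_left R I + dyadic_len R I]) x)).
  - apply: measurable_funM; last exact: measurable_indic.
    by apply: measurableT_comp.
  - move=> x; rewrite normrM normr_id [X in _ * X]ger0_norm; last by rewrite indicE.
    have := dyadic_indic_le I x.
    have := square_integrable_abs_le hf x.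
    set b := \1_(`[_, _]) x.
    have b0 : 0 <= b by rewrite /b indicE.
    rewrite [\1_(dyadic_set I) x]indicE; case: (_ \in _); rewrite ?mulr1 ?mulr0 /=.
      by move=> h1; rewrite mulr1n; lra.
    by move=> _ _; have := sqr_ge0 (f x); lra.
  - by apply: integD => //; exact: integ_itv.
by apply: (integ_on_ext mD h1) => x /mem_set xD; rewrite indicE xD mulr1.
Qed.

Lemma coef_abs_le f u v : square_integrable f ->
  `|coef f u v| <= (Num.sqrt (word_len u))^-1 * dint (fun x => `|f x|) (word_interval u).
Proof.
move=> hf; set I := word_interval u; have mD := @measurable_dyadic R I.
have [mf f2] := hf.
have hw := @square_integrable_wpack R I (word_num v).
have ifw := integ_mul hf hw.
apply: le_trans (le_normr_Rintegral measurableT ifw) _.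
have iI := local_integ_square hf I.
rewrite /dint /dyadic_set Rintegral_itv_bndo_bndc //.
set D := `[dyadic_left R I, dyadic_left R I + dyadic_len R I]%classic.
have mE : measurable D by exact: measurable_itv.
have iE : integ (fun x => `|f x| * \1_D x).
  apply: (@integ_le _ _ (fun x => f x ^+ 2 + \1_D x)).
  - by apply: measurable_funM; [apply: measurableT_comp|exact: measurable_indic].
  - move=> x; rewrite normrM normr_id indicE.
    have := square_integrable_abs_le hf x; have := sqr_ge0 (f x).
    by case: (_ \in _); rewrite ?normr1 ?normr0 ?mulr1 ?mulr0 /=; lra.
  - by apply: integD => //; exact: integ_itv.
rewrite Rintegral_indic -RintegralZl //; apply: le_Rintegral => //.
- exact: integ_abs.
- exact: integZ.
- move=> x _; rewrite normrM mulrCA.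
  have := norm_wpack I (word_num v) x; rewrite -/D -/(word_len u) => h.
  by rewrite ler_wpM2l.
Qed.

Lemma coef_sqr_le f u v : square_integrable f ->
  coef f u v ^+ 2 * word_len u <= dint (fun x => `|f x|) (word_interval u) ^+ 2.
Proof.
move=> hf; have l0 := word_len_gt0 u; have h := coef_abs_le u v hf.
have s0 : 0 < Num.sqrt (word_len u) by rewrite sqrtr_gt0.
have d0 : 0 <= dint (fun x => `|f x|) (word_interval u) by exact: dint_ge0.
rewrite -ler_pdivlMr // -real_normK ?num_real //.
have -> : dint (fun x => `|f x|) (word_interval u) ^+ 2 / word_len u =
  ((Num.sqrt (word_len u))^-1 * dint (fun x => `|f x|) (word_interval u)) ^+ 2.
  by rewrite exprMn exprVn sqr_sqrtr ?ltW // mulrC.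
by rewrite lerXn2r ?nnegrE // mulr_ge0 // invr_ge0 ltW.
Qed.

Lemma dintD f g I : local_integ f -> local_integ g ->
  dint (fun x => f x + g x) I = dint f I + dint g I.
Proof. by move=> hf hg; apply: RintegralD => //; exact: measurable_dyadic. Qed.

Lemma dintZ (k : R) f I : local_integ f -> dint (fun x => k * f x) I = k * dint f I.
Proof. by move=> hf; apply: RintegralZl => //; exact: measurable_dyadic. Qed.

Lemma local_integD f g : local_integ f -> local_integ g ->
  local_integ (fun x => f x + g x).
Proof.
move=> hf hg I; have mD := @measurable_dyadic R I.
exact: (@integrableD _ _ _ mu _ mD _ _ (hf I) (hg I)).
Qed.

Lemma local_integZ (k : R) f : local_integ f -> local_integ (fun x => k * f x).
Proof.
move=> hf I; have mD := @measurable_dyadic R I.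
exact: (@integrableZl _ _ _ mu _ mD k _ (hf I)).
Qed.

Lemma local_integ_cst (c : R) : local_integ (fun=> c).
Proof.
move=> I; have mD := @measurable_dyadic R I.
have i1 : integ (fun x => c * \1_(`[dyadic_left R I, dyadic_left R I + dyadic_len R I]) x).
  by apply: integZ; exact: integ_itv.
apply: (integ_on_ext mD i1) => x xD.
have : x \in `[dyadic_left R I, dyadic_left R I + dyadic_len R I[ by [].
rewrite in_itv /= => /andP[h1 h2].
by rewrite indicE mem_setE in_itv /= h1 (ltW h2) mulr1.
Qed.

Lemma dint_sqr_le f I : square_integrable f ->
  dint (fun x => `|f x|) I ^+ 2 <= dyadic_len R I * dint (fun x => f x ^+ 2) I.
Proof.
move=> hf; have l0 := @dyadic_len_gt0 R I.
have i1 := local_integ_square hf.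
have i2 : local_integ (fun x => f x ^+ 2) by apply: local_integ_of_integ; case: hf.
set d := dint (fun x => `|f x|) I; set Q := dint _ I.
(* Cauchy-Schwarz, by integrating [(|f| - c)^2 >= 0] with [c] the mean of [|f|] over [I]. *)
pose c := d / dyadic_len R I.
have : dint (fun x => 2 * c * `|f x|) I <= dint (fun x => f x ^+ 2 + c ^+ 2) I.
  apply: dint_le; first exact: local_integZ.
    by apply: local_integD => //; exact: local_integ_cst.
  move=> x; rewrite -[f x ^+ 2]real_normK ?num_real // -subr_ge0.
  have -> : `|f x| ^+ 2 + c ^+ 2 - 2 * c * `|f x| = (`|f x| - c) ^+ 2 by ring.
  exact: sqr_ge0.
rewrite dintZ // dintD //; last exact: local_integ_cst.
rewrite dint_cst -/d -/Q => h.
have e1 : 2 * c * d = 2 * (d ^+ 2 / dyadic_len R I) by rewrite /c; ring.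
have e2 : c ^+ 2 * dyadic_len R I = d ^+ 2 / dyadic_len R I.
  by rewrite /c; field; rewrite gt_eqF.
have : d ^+ 2 / dyadic_len R I <= Q by rewrite e1 e2 in h; lra.
by rewrite ler_pdivrMr // mulrC.
Qed.

(** Over an empty frequency word the energy is cut in time down to packets of index 0, and for these
    the bound is Cauchy-Schwarz on a single interval. *)
Lemma energy_coef_le f d u : square_integrable f ->
  energy (coef f) d u [::] <= dint (fun x => f x ^+ 2) (word_interval u).
Proof.
move=> hf; elim: d u => [|d IH] u /=.
  rewrite -(ler_pM2r (word_len_gt0 u)); apply: le_trans (coef_sqr_le _ _ hf) _.
  by apply: le_trans (dint_sqr_le _ hf) _; rewrite mulrC.
rewrite dint_child; last by apply: local_integ_of_integ; case: hf.
by apply: ler_sum => q _; exact: IH.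
Qed.

Lemma energy_coef_le_total f d : square_integrable f ->
  energy (coef f) d [::] [::] <= \int[mu]_x (f x ^+ 2).
Proof.
move=> hf; apply: le_trans (energy_coef_le _ _ hf) _.
by apply: dint_le_total; [case: hf|move=> x; exact: sqr_ge0].
Qed.

Section Exceptional.
Variable H : word -> R.
Hypothesis H_ge0 : forall u, 0 <= H u.
Hypothesis H_sum : forall u, \sum_(q < 4) H (q :: u) = H u.

(* The union of the intervals with word extending u by at most d letters that
   are heavy, i.e. shorter than H. *)
Fixpoint heavy_set d u : set R :=
  if word_len u < H u then dyadic_set (word_interval u)
  else if d is d'.+1 then
    heavy_set d' (ord0 :: u) `|` heavy_set d' (inord 1 :: u) `|`
    heavy_set d' (inord 2 :: u) `|` heavy_set d' (inord 3 :: u)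
  else set0.

Lemma measurable_heavy_set d u : measurable (heavy_set d u).
Proof.
elim: d u => [|d IH] u /=; case: ifP => _ //; try exact: measurable_dyadic.
by do 3 apply: measurableU => //.
Qed.

(** A selected interval is shorter than its value of [H], and [H] is additive over quarters. This
    plays the part of the weak type bound for the dyadic maximal function. *)
Lemma heavy_set_measure d u : (mu (heavy_set d u) <= (H u)%:E)%E.
Proof.
elim: d u => [|d IH] u /=; case: ifP => h.
- by rewrite dyadic_measure lee_fin ltW.
- by rewrite measure0 lee_fin.
- by rewrite dyadic_measure lee_fin ltW.
have e : H u = H (ord0 :: u) + H (inord 1 :: u) + H (inord 2 :: u) + H (inord 3 :: u).
  rewrite -H_sum !big_ord_recl big_ord0 addr0 !addrA.
  by congr (_ + H (_ :: _) + H (_ :: _) + H (_ :: _)); apply/val_inj; rewrite /= inordK.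
have mH := measurable_heavy_set d.
have U (A B : set R) (a b : R) : measurable A -> measurable B ->
    (mu A <= a%:E)%E -> (mu B <= b%:E)%E -> (mu (A `|` B) <= (a + b)%:E)%E.
  move=> mA mB hA hB; have hU : (mu (A `|` B) <= mu A + mu B)%E by exact: measureU2.
  by rewrite EFinD; apply: (le_trans hU); exact: leeD.
by rewrite e; do 3 (apply: (@U) => //; try by do ?apply: measurableU).
Qed.

Lemma word_interval_cons_sub q u :
  @dyadic_set R (word_interval (q :: u)) `<=` dyadic_set (word_interval u).
Proof.
have h I b : @dyadic_set R (dyadic_half I b) `<=` dyadic_set I.
  by rewrite (dyadic_set_half I); case: b; [exact: subsetUr|exact: subsetUl].
rewrite /= (_ : dyadic_child _ q =
  dyadic_half (dyadic_half (word_interval u) (1 < q)%N) (odd q)).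
  by apply: subset_trans (h _ _).
by rewrite dyadic_half_half; case: q => [[|[|[|[|]]]]].
Qed.

Lemma word_interval_sub u u' : suffix u u' ->
  @dyadic_set R (word_interval u') `<=` dyadic_set (word_interval u).
Proof.
case/suffixP => s ->; elim: s => [|q s IH] //=.
by apply: subset_trans IH; exact: (@word_interval_cons_sub q).
Qed.

Lemma heavy_set_cover d u u' : suffix u u' -> (size u' <= size u + d)%N ->
  word_len u' < H u' -> @dyadic_set R (word_interval u') `<=` heavy_set d u.
Proof.
elim: d u => [|d IH] u su sz h /=.
  have e : u = u' by apply: suffix_size_eq => //; have := suffix_leq su; lia.
  by rewrite e h.
case: ifP => hn; first exact: word_interval_sub.
have neq : u' != u by apply: contraTneq h => ->; rewrite hn.
have [q sq _] := suffixS su neq.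
have hq : @dyadic_set R (word_interval u') `<=` heavy_set d (q :: u).
  by apply: IH => //=; lia.
apply: subset_trans hq _; case: q sq => [[|[|[|[|//]]]] hq] _ x hx.
- by left; left; left; move: hx; rewrite (_ : Ordinal hq = ord0) //; apply: val_inj.
- left; left; right; move: hx; rewrite (_ : Ordinal hq = inord 1) //.
  by apply: val_inj; rewrite /= inordK.
- left; right; move: hx; rewrite (_ : Ordinal hq = inord 2) //.
  by apply: val_inj; rewrite /= inordK.
- right; move: hx; rewrite (_ : Ordinal hq = inord 3) //.
  by apply: val_inj; rewrite /= inordK.
Qed.

End Exceptional.

Lemma coef_eq0 f u v : square_integrable f ->
  (forall x, dyadic_set (word_interval u) x -> f x = 0) -> coef f u v = 0.
Proof.
move=> hf h0; apply/eqP; rewrite -normr_le0; apply: le_trans (coef_abs_le _ _ hf) _.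
suff -> : dint (fun x => `|f x|) (word_interval u) = 0 by rewrite mulr0.
rewrite -(mul0r (dyadic_len R (word_interval u))) -dint_cst.
apply: eq_Rintegral => x /set_mem /h0 ->; exact: normr0.
Qed.

End Root.

(** * The restricted estimate under one root interval *)

Section Piece.
Context {R : realType}.
Variable root : dyadic.
Local Notation mu := (@lebesgue_measure R).
Local Notation word := (seq 'I_4).
Implicit Types (f : R -> R).

Definition word_form f1 f2 f3 (S : seq (word * word)) : R :=
  \sum_(s <- S) (Num.sqrt (word_len root s.1))^-1 *
    coef root f1 s.1 (tile_index ord0 :: s.2) *
    coef root f2 s.1 (tile_index (inord 1) :: s.2) *
    coef root f3 s.1 (tile_index (inord 2) :: s.2).

(** Off the heavy intervals the averages bound the sizes by [4 * c1], [4 * c2] and 4, and their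
    product times [tau] is [1536 * x * y / sqrt tau]. The set may have measure [tau / 4] only, since
    four such estimates are added later. *)
Lemma word_form_bound m S f1 f2 (x y A tau : R) (n : nat) :
  quartiles m S -> 0 < x -> 0 < y -> 0 < tau ->
  square_integrable f1 -> square_integrable f2 -> integ f1 ->
  \int[mu]_t `|f1 t| <= x -> \int[mu]_t (f1 t ^+ 2) <= A * x ->
  \int[mu]_t (f2 t ^+ 2) <= y ^+ 2 -> A * tau <= x * 4 ^+ n ->
  exists Omega : set R, [/\ measurable Omega, (mu Omega <= (tau / 4)%:E)%E &
   forall f3, square_integrable f3 -> (forall t, `|f3 t| <= 1) ->
     \int[mu]_t (f3 t ^+ 2) <= 2 * tau -> (forall t, Omega t -> f3 t = 0) ->
     `|word_form f1 f2 f3 S| <= (225 + 96 * n%:R) * (1536 * x * y / Num.sqrt tau)].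
Proof.
move=> SQ x0 y0 tau0 q1 q2 i1 hx hA hy hn.
have st0 : 0 < Num.sqrt tau by rewrite sqrtr_gt0.
have st2 : Num.sqrt tau ^+ 2 = tau by rewrite sqr_sqrtr ?ltW.
(* These thresholds make the measure of the heavy set at most [tau / 8 + tau / 9], which is below
   [tau / 4]. *)
pose c1 := 8 * x / tau; pose c2 := 3 * y / Num.sqrt tau.
have c10 : 0 < c1 by rewrite /c1 divr_gt0 // mulr_gt0.
have c20 : 0 < c2 by rewrite /c2 divr_gt0 // mulr_gt0.
pose I u := word_interval root u.
pose L f u := dint (fun t => `|f t|) (I u).
pose Q f u := dint (fun t => f t ^+ 2) (I u).
(* One additive quantity watches both averages. For [f2] the integral of the square is taken because
   it is additive over quarters; Cauchy-Schwarz leads back to the average of [|f2|]. *)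
pose H u := L f1 u / c1 + Q f2 u / c2 ^+ 2.
have c220 : 0 < c2 ^+ 2 by rewrite exprn_gt0.
have L0 f u : 0 <= L f u by apply: dint_ge0.
have Q0 f u : 0 <= Q f u by apply: dint_ge0 => t; exact: sqr_ge0.
have H0 u : 0 <= H u by rewrite addr_ge0 // divr_ge0 // ltW.
have iL f : square_integrable f -> local_integ (fun t => `|f t|) by exact: local_integ_square.
have iQ f : square_integrable f -> local_integ (fun t => f t ^+ 2).
  by case=> _ h; exact: local_integ_of_integ.
have L_sum f u : square_integrable f -> \sum_(q < 4) L f (q :: u) = L f u.
  by move=> hf; rewrite /L [RHS]dint_child //; exact: iL.
have Q_sum f u : square_integrable f -> \sum_(q < 4) Q f (q :: u) = Q f u.
  by move=> hf; rewrite /Q [RHS]dint_child //; exact: iQ.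
have H_sum u : \sum_(q < 4) H (q :: u) = H u.
  by rewrite big_split /= -!mulr_suml L_sum // Q_sum.
exists (heavy_set root H m [::]); split.
- exact: measurable_heavy_set.
- apply: (le_trans (heavy_set_measure root H0 H_sum m [::])); rewrite lee_fin.
  have h1 : L f1 [::] <= x.
    by apply: le_trans (dint_le_total _ (integ_abs i1) _) hx.
  have h2 : Q f2 [::] <= y ^+ 2.
    apply: le_trans (dint_le_total _ _ _) hy; first by case: q2.
    by move=> t; exact: sqr_ge0.
  have e1 : L f1 [::] / c1 <= tau / 8.
    rewrite ler_pdivrMr // /c1 (_ : tau / 8 * (8 * x / tau) = x) //.
    by field; rewrite gt_eqF.
  have e2 : Q f2 [::] / c2 ^+ 2 <= tau / 9.
    rewrite ler_pdivrMr // /c2 (_ : tau / 9 * (3 * y / Num.sqrt tau) ^+ 2 = y ^+ 2) //.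
    by rewrite expr_div_n st2; field; rewrite gt_eqF.
  by rewrite /H; lra.
move=> f3 q3 b3 h3 v3.
(* The other quartiles have their time interval inside the heavy set, where [f3] vanishes, so their
   third coefficient is 0. *)
pose good (s : word * word) := `[< forall u, suffix u s.1 -> H u <= word_len root u >].
pose S' := [seq s <- S | good s].
have SQ' : quartiles m S'.
  split; first by rewrite filter_uniq; case: SQ.
  by move=> s; rewrite mem_filter => /andP[_]; exact: (proj2 SQ).
pose F (k : 'I_3) := nth f1 [:: f1; f2; f3] k.
have qF k : square_integrable (F k) by case: k => [[|[|[|]]]].
pose sigma (k : 'I_3) := nth 0 [:: 4 * c1; 4 * c2; 4 * 1] k.
pose Ac k := coef root (F k).
have l0 := @word_len_gt0 R root.
have lc q u : word_len root (q :: u) = word_len root u / 4 :> R by exact: word_len_cons.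
have As k u v : \sum_(r < 4) Ac k u (r :: v) ^+ 2 = \sum_(q < 4) Ac k (q :: u) v ^+ 2.
  exact: coef_split.
have goodL s : s \in S' -> forall u, suffix u s.1 -> L f1 u <= c1 * word_len root u
    /\ L f2 u <= c2 * word_len root u.
  rewrite mem_filter => /andP[/asboolP hs _] u /hs; rewrite /H => hu.
  have g1 : L f1 u / c1 <= word_len root u.
    by apply: le_trans hu; rewrite lerDl divr_ge0 // ltW.
  have g2 : Q f2 u / c2 ^+ 2 <= word_len root u.
    by apply: le_trans hu; rewrite lerDr divr_ge0 // ltW.
  split; first by rewrite mulrC -ler_pdivrMr.
  rewrite ler_pdivrMr // in g2.
  have := dint_sqr_le (I u) q2; rewrite -/(L f2 u) -/(Q f2 u) -/(word_len root u) => hd.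
  have cl : 0 <= c2 * word_len root u by rewrite mulr_ge0 // ltW.
  have p : L f2 u ^+ 2 <= (c2 * word_len root u) ^+ 2.
    apply: le_trans hd _; rewrite exprMn [leRHS]mulrC expr2 -mulrA.
    by rewrite ler_wpM2l // ltW.
  by rewrite -(@ler_pXn2r _ 2) // ?nnegrE.
have L3 : forall u, L f3 u <= 1 * word_len root u.
  move=> u.
  rewrite -dint_cst; apply: dint_le => //; first exact: iL.
  exact: local_integ_cst.
have size_k k c : 0 <= c -> (forall s, s \in S' -> forall u, suffix u s.1 ->
    L (F k) u <= c * word_len root u) ->
    size_le (Ac k) (@word_len R root) m S' (tile_index k) (4 * c).
  move=> cc0 hk; apply: (@size_le_average _ _ _ _ (As k) l0 lc (L (F k))) => //.
  - by move=> q u; rewrite -(L_sum _ u (qF k)) (bigD1 q) //= lerDl sumr_ge0.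
  - by move=> u v; exact: coef_sqr_le.
have sz : sizes_le Ac (@word_len R root) m S' sigma.
  apply: ordP3 => /=.
  - by apply: (size_k ord0); [exact: ltW|move=> s sS u su; have [] := goodL s sS u su].
  - have -> : sigma (inord 1) = 4 * c2 by rewrite /sigma inordK.
    apply: (size_k (inord 1)); first exact: ltW.
    move=> s sS u su; have [_] := goodL s sS u su.
    by rewrite (_ : F (inord 1) = f2) // /F inordK.
  - have -> : sigma (inord 2) = 4 * 1 by rewrite /sigma inordK.
    apply: (size_k (inord 2)) => // s sS u su.
    by rewrite (_ : F (inord 2) = f3); [exact: L3|rewrite /F inordK].
have sg0 k : 0 < sigma k.
  by move: k; apply: ordP3; rewrite /sigma /= ?inordK //= mulr_gt0.
have := @form_le R Ac (@word_len R root) m As l0 n S' sigma tau SQ' sz sg0 tau0.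
have -> : sigma (inord 1) = 4 * c2 by rewrite /sigma inordK.
have -> : sigma (inord 2) = 4 * 1 by rewrite /sigma inordK.
have -> : sigma ord0 = 4 * c1 by [].
have e1 : energy (Ac (inord 1)) m.+1 [::] [::] <= (4 * c2) ^+ 2 * tau.
  apply: le_trans (energy_coef_le_total _ _ (qF _)) _.
  rewrite (_ : F (inord 1) = f2); last by rewrite /F inordK.
  apply: le_trans hy _; rewrite /c2.
  have -> : (4 * (3 * y / Num.sqrt tau)) ^+ 2 * tau = 144 * y ^+ 2.
    by rewrite exprMn expr_div_n st2; field; rewrite gt_eqF.
  by rewrite ler_peMl ?sqr_ge0 // (ler_nat R 1 144).
have e2 : energy (Ac (inord 2)) m.+1 [::] [::] <= (4 * 1) ^+ 2 * tau.
  apply: le_trans (energy_coef_le_total _ _ (qF _)) _.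
  rewrite (_ : F (inord 2) = f3); last by rewrite /F inordK.
  apply: le_trans h3 _; rewrite mulr1 ler_wpM2r ?ltW //; lra.
have e0 : energy (Ac ord0) m.+1 [::] [::] <= (4 * c1) ^+ 2 * (tau * 4 ^+ n).
  apply: le_trans (energy_coef_le_total _ _ (qF _)) _.
  apply: le_trans hA _; rewrite /c1.
  have -> : (4 * (8 * x / tau)) ^+ 2 * (tau * 4 ^+ n) = 1024 * (x * 4 ^+ n) * x / tau.
    by field; rewrite gt_eqF.
  rewrite ler_pdivlMr // mulrAC ler_pM2r //.
  apply: le_trans hn _; rewrite ler_peMl ?(ler_nat R 1 1024) //.
  by rewrite mulr_ge0 ?exprn_ge0 // ltW.
move=> /(_ e1 e2 e0) main.
have -> : word_form f1 f2 f3 S = word_form f1 f2 f3 S'.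
  rewrite /word_form /S' big_filter [RHS]big_mkcond big_seq [RHS]big_seq.
  apply: eq_bigr => s sS; case: ifPn => // /asboolPn hs.
  have [u [su hu]] : exists u, suffix u s.1 /\ word_len root u < H u.
    apply: contrapT => hno; apply: hs => u su; rewrite leNgt; apply/negP => hu.
    by apply: hno; exists u.
  have sub : @dyadic_set R (word_interval root s.1) `<=` heavy_set root H m [::].
    apply: subset_trans (word_interval_sub su) _.
    apply: heavy_set_cover => //; first exact: suffix0s.
    rewrite add0n -((proj2 SQ) _ sS); apply: leq_trans (suffix_leq su) _; exact: leq_addr.
  rewrite (@coef_eq0 _ _ f3) ?mulr0 // => t /sub; exact: v3.
apply: (@le_trans _ _ (form Ac (@word_len R root) S')).
  apply: le_trans (ler_norm_sum _ _ _) _; apply: ler_sum => s _.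
  rewrite /form_term prod3E !normrM ger0_norm ?invr_ge0 // !mulrA.
  by rewrite /Ac /F /= !inordK.
apply: le_trans main _; rewrite prod3E.
rewrite (_ : sigma (inord 1) = 4 * c2); last by rewrite /sigma inordK.
rewrite (_ : sigma (inord 2) = 4 * 1); last by rewrite /sigma inordK.
rewrite (_ : sigma ord0 = 4 * c1) //.
rewrite -mulrA; apply: ler_wpM2l; first by rewrite addr_ge0 // mulr_ge0.
rewrite le_eqVlt; apply/orP; left; apply/eqP; rewrite /c1 /c2; field.
by rewrite !gt_eqF.
Qed.

End Piece.

(** * From rectangles to words, and restricted bounds *)

Section Encoding.
Context {R : realType}.
Local Notation mu := (@lebesgue_measure R).
Local Notation word := (seq 'I_4).
Implicit Types (f : R -> R) (s : rectangle).

Lemma quartile_shape s : is_quartile R s -> exists n : nat, s.2 = (2 - s.1.1, n%:Z).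
Proof.
case: s => -[i k] [j l] [/= sub].
rewrite /dyadic_len /= => e.
have ej : j = 2 - i.
  have h : (2 : R) ^ j = 2 ^ (2 - i).
    rewrite e expfzDr // invr_expz; congr (_ * _).
    by rewrite -exprnP expr2; lra.
  by apply: (@ieexprIz R 2) => //; rewrite (eqr_nat R 2 1).
have l0 : 0 <= l.
  have h : @dyadic_set R (j, l) (dyadic_left R (j, l)).
    rewrite /dyadic_set /= in_itv /= lexx /= ltrDl; exact: dyadic_len_gt0.
  have := sub _ h; rewrite /dyadic_left /= pmulr_lge0 ?ler0z //; exact: dyadic_len_gt0.
by exists `|l|%N; rewrite ej gez0_abs.
Qed.

Lemma wave_packet_quartile (I : dyadic) (n k : nat) :
  @wave_packet R (quartile_tile (I, (2 - I.1, n%:Z)) k.+1) = wpack I (4 * n + k).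
Proof.
apply/funext => x; rewrite /wave_packet /quartile_tile /wpack /=; congr (_ * walsh _ _).
rewrite /dyadic_left /dyadic_len /=.
have -> : 4 * n%:Z + (k.+1%:Z - 1) = (4 * n + k)%N%:Z by lia.
rewrite mulrCA -expfzDr // (_ : I.1 + (2 - I.1 - 2) = 0); last by lia.
by rewrite expr0z mulr1 -[_%:~R]/((4 * n + k)%:R) natrK.
Qed.

Definition word_rect (root : dyadic) (p : word * word) : rectangle :=
  (word_interval root p.1, (2 - (word_interval root p.1).1, (word_num p.2)%:Z)).

Definition rform (S : seq rectangle) f1 f2 f3 : R :=
  \sum_(s <- S) (Num.sqrt (dyadic_len R s.1))^-1 *
    rpair f1 (@wave_packet R (quartile_tile s 1)) *
    rpair f2 (@wave_packet R (quartile_tile s 2)) *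
    rpair f3 (@wave_packet R (quartile_tile s 3)).

Lemma word_formE root f1 f2 f3 S :
  word_form root f1 f2 f3 S = rform (map (word_rect root) S) f1 f2 f3.
Proof.
rewrite /rform big_map; apply: eq_bigr => p _.
rewrite !wave_packet_quartile /coef /= !inordK //.
Qed.

Lemma word_interval_exists (J k0 k : int) (d : nat) :
  k0 * (4 ^ d)%N%:Z <= k < (k0 + 1) * (4 ^ d)%N%:Z ->
  exists u : word, size u = d /\ word_interval (J, k0) u = (J - 2 * d%:Z, k).
Proof.
elim: d k => [|d IH] k.
  rewrite expn0 !mulr1 => h; exists [::]; split=> //=; congr pair; lia.
rewrite expnS => h.
have ek := divz_eq k 4; have m0 := @modz_ge0 k 4 isT; have m1 := @ltz_pmod k 4 isT.
have [|u [su eu]] := IH (k %/ 4)%Z; first by nia.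
have lt : (`|(k %% 4)%Z| < 4)%N by lia.
exists (Ordinal lt :: u); rewrite /= su eu; split=> //.
rewrite /dyadic_child /=; congr pair; lia.
Qed.

Lemma word_num_exists (n e : nat) : (n < 4 ^ e)%N ->
  exists v : word, size v = e /\ word_num v = n.
Proof.
elim: e n => [|e IH] n; first by rewrite expn0 ltnS leqn0 => /eqP ->; exists [::].
rewrite expnS => h; have [|v [sv ev]] := IH (n %/ 4)%N; first by rewrite ltn_divLR // mulnC.
exists (inord (n %% 4) :: v); rewrite /= sv ev inordK ?ltn_mod //; split=> //.
by rewrite mulnC -divn_eq.
Qed.

Lemma encode_seq (T : eqType) (U : eqType) (h : T -> U) (P : T -> Prop) (S : seq U) :
  (forall z, z \in S -> exists p, P p /\ h p = z) ->
  exists Sw, map h Sw = S /\ forall p, p \in Sw -> P p.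
Proof.
elim: S => [|z S IH] hS; first by exists [::].
have [|Sw [eS PS]] := IH; first by move=> z' z'S; apply: hS; rewrite inE z'S orbT.
have [p [Pp ep]] := hS z (mem_head _ _).
exists (p :: Sw); rewrite /= ep eS; split=> // p'.
by rewrite inE => /orP[/eqP ->//|/PS].
Qed.

(** A generalized restricted type estimate: the exceptional set is chosen before [f3]. Hence the
    sets of finitely many functionals can be united and the bounds added. *)
Definition restricted_bound (F : (R -> R) -> R) (tau M K : R) :=
  exists Omega : set R, [/\ measurable Omega, (mu Omega <= tau%:E)%E &
   forall f3, square_integrable f3 -> (forall t, `|f3 t| <= 1) ->
     \int[mu]_t (f3 t ^+ 2) <= M -> (forall t, Omega t -> f3 t = 0) -> `|F f3| <= K].

Lemma restricted_boundD F1 F2 F tau1 tau2 M K1 K2 :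
  (forall f3, square_integrable f3 -> F f3 = F1 f3 + F2 f3) ->
  restricted_bound F1 tau1 M K1 -> restricted_bound F2 tau2 M K2 ->
  restricted_bound F (tau1 + tau2) M (K1 + K2).
Proof.
move=> eF [Y1 [mm1 t1 h1]] [Y2 [mm2 t2 h2]]; exists (Y1 `|` Y2); split.
- exact: measurableU.
- have hU : (mu (Y1 `|` Y2) <= mu Y1 + mu Y2)%E by exact: measureU2.
  by rewrite EFinD; apply: (le_trans hU); exact: leeD.
- move=> f3 q3 b3 n3 v3; rewrite eF //; apply: le_trans (ler_normD _ _) _.
  by apply: lerD; [apply: h1|apply: h2] => // t Ot; apply: v3; [left|right].
Qed.

Lemma restricted_bound_le F tau tau' M K K' : tau <= tau' -> K <= K' ->
  restricted_bound F tau M K -> restricted_bound F tau' M K'.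
Proof.
move=> le1 le2 [Y1 [mm1 t1 h1]]; exists Y1; split=> //.
  by apply: (le_trans t1); rewrite lee_fin.
by move=> f3 q3 b3 n3 v3; apply: le_trans le2; exact: h1.
Qed.

Lemma rform_filter (p : pred rectangle) S f1 f2 f3 :
  rform S f1 f2 f3 = rform [seq s <- S | p s] f1 f2 f3 + rform [seq s <- S | ~~ p s] f1 f2 f3.
Proof. by rewrite /rform (bigID p) /= !big_filter. Qed.

Definition rect_height s : nat := (`|s.1.1| + `|s.1.2| + `|s.2.2|)%N.

Lemma int_parity (i : int) : exists i' : int, i = 2 * i' + (odd `|i|%N)%:Z.
Proof.
have e := odd_double_half `|i|%N; move: e; set b := odd _; set h := half _ => e.
case: i @b @h e => n b h; rewrite -mul2n => e; first by exists h%:Z; move: e => /=; lia.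
by exists (- (h%:Z + b%:Z)); move: e => /=; lia.
Qed.

Lemma scale_index (i : int) (N : nat) (b : bool) : odd `|i|%N = b ->
  (`|i| <= N)%N -> exists d : nat,
    [/\ 2 * N%:Z + b%:Z - 2 * d%:Z = i, (N <= d + `|i|)%N & (d <= 2 * N + 1)%N].
Proof.
have [i' e] := int_parity i => eb; rewrite eb in e => hi.
exists `|N%:Z - i'|%N; case: b {eb} e => /= e; split; lia.
Qed.

Lemma rform_piece_bound (b1 b2 : bool) S f1 f2 (x y A tau : R) (n : nat) :
  uniq S -> {in S, forall s, is_quartile R s} ->
  {in S, forall s, odd `|s.1.1|%N = b1 /\ (s.1.2 < 0) = b2} ->
  0 < x -> 0 < y -> 0 < tau ->
  square_integrable f1 -> square_integrable f2 -> integ f1 ->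
  \int[mu]_t `|f1 t| <= x -> \int[mu]_t (f1 t ^+ 2) <= A * x ->
  \int[mu]_t (f2 t ^+ 2) <= y ^+ 2 -> A * tau <= x * 4 ^+ n ->
  restricted_bound (rform S f1 f2) (tau / 4) (2 * tau)
    ((225 + 96 * n%:R) * (1536 * x * y / Num.sqrt tau)).
Proof.
move=> uS SQ Sb x0 y0 tau0 q1 q2 i1 hx hA hy hn.
pose N := (\sum_(s <- S) rect_height s)%N.
have hN s : s \in S -> (rect_height s <= N)%N.
  by move=> sS; rewrite /N (big_rem s) //= leq_addr.
(* Passing to a quarter lowers the scale by 2 and never leaves a half-line. For a given parity of
   the scale and a given side of 0, one large interval adjacent to 0 therefore contains all time
   intervals as descendants. *)
pose root : dyadic := (2 * N%:Z + b1%:Z, - b2%:Z).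
(* Time uses at most [2 * N + 1] digits, which leaves at least [N] of them for a frequency index
   that is itself at most [N]. *)
pose m := (3 * N + 1)%N.
have [s sS|Sw [eS PS]] := @encode_seq _ _ (word_rect root)
    (fun p => tile_size p = m) S.
  have [nf ef] := quartile_shape (SQ s sS); have [pa pb] := Sb s sS.
  have := hN s sS; rewrite /rect_height ef.
  case: s ef sS pa pb => -[i k] w /= -> sS pa pb hs.
  have [|d [ed dN dN1]] := @scale_index i N b1 pa.
    by apply: leq_trans hs; rewrite -addnA leq_addr.
  have dk : (`|k| <= d)%N by clear -dN hs; lia.
  have kd : (`|k| < 4 ^ d)%N by apply: leq_ltn_trans dk _; exact: ltn_expl.
  have [|u [su eu]] := @word_interval_exists (2 * N%:Z + b1%:Z) (- b2%:Z) k d.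
    by clear -pb kd; move: pb; case: b2 => /= pb; lia.
  have dm : (d <= m)%N by clear -dN1; rewrite /m; lia.
  have [|v [sv ev]] := @word_num_exists nf (m - d).
    apply: leq_trans (ltn_expl nf (isT : (1 < 4)%N)) _.
    by rewrite leq_exp2l //; clear -dN1 hs; rewrite /m; lia.
  exists (u, v); split; first by rewrite /tile_size /= su sv subnKC.
  by rewrite /word_rect /= eu ev ed.
have SwQ : quartiles m Sw.
  by split=> //; apply: (@map_uniq _ _ (word_rect root)); rewrite eS.
have [Y [mO tO hO]] := word_form_bound root SwQ x0 y0 tau0 q1 q2 i1 hx hA hy hn.
exists Y; split=> // f3 q3 b3 n3 v3.
by have := hO f3 q3 b3 n3 v3; rewrite word_formE eS.
Qed.

(** The four classes given by the parity of the scale and the side of 0 receive [tau / 4] each; 900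
    is four times 225 and also dominates four times 96. *)
Lemma rform_bound S f1 f2 (x y A tau : R) (n : nat) :
  uniq S -> {in S, forall s, is_quartile R s} ->
  0 < x -> 0 < y -> 0 < tau ->
  square_integrable f1 -> square_integrable f2 -> integ f1 ->
  \int[mu]_t `|f1 t| <= x -> \int[mu]_t (f1 t ^+ 2) <= A * x ->
  \int[mu]_t (f2 t ^+ 2) <= y ^+ 2 -> A * tau <= x * 4 ^+ n ->
  restricted_bound (rform S f1 f2) tau (2 * tau)
    (900 * (1 + n%:R) * (1536 * x * y / Num.sqrt tau)).
Proof.
move=> uS SQ x0 y0 tau0 q1 q2 i1 hx hA hy hn.
pose K := (225 + 96 * n%:R) * (1536 * x * y / Num.sqrt tau).
have piece b1 b2 : restricted_bound
    (rform [seq s <- [seq s <- S | odd `|s.1.1|%N == b1] | (s.1.2 < 0) == b2] f1 f2)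
    (tau / 4) (2 * tau) K.
  apply: (@rform_piece_bound b1 b2) hn => //.
  - by rewrite !filter_uniq.
  - by move=> s; rewrite !mem_filter => /and3P[_ _]; exact: SQ.
  - by move=> s; rewrite !mem_filter => /and3P[/eqP ? /eqP ? _].
have half b1 : restricted_bound (rform [seq s <- S | odd `|s.1.1|%N == b1] f1 f2)
    (tau / 4 + tau / 4) (2 * tau) (K + K).
  apply: restricted_boundD (piece b1 true) (piece b1 false) => f3 _.
  rewrite (rform_filter (fun s => (s.1.2 < 0) == true)); congr (_ + rform _ _ _ _).
  by apply: eq_filter => s /=; case: (_ < 0).
have full : restricted_bound (rform S f1 f2)
    ((tau / 4 + tau / 4) + (tau / 4 + tau / 4)) (2 * tau) (K + K + (K + K)).
  apply: restricted_boundD (half true) (half false) => f3 _.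
  rewrite (rform_filter (fun s => odd `|s.1.1|%N == true)); congr (_ + rform _ _ _ _).
  by apply: eq_filter => s /=; case: (odd _).
apply: restricted_bound_le full; first lra.
have c0 : 0 <= 1536 * x * y / Num.sqrt tau.
  apply: divr_ge0; last exact: sqrtr_ge0.
  apply: mulr_ge0; last exact: ltW.
  by apply: mulr_ge0; [exact: ler0n|exact: ltW].
rewrite /K; move: (1536 * x * y / Num.sqrt tau) c0 => c c0.
have -> : (225 + 96 * n%:R) * c + (225 + 96 * n%:R) * c +
  ((225 + 96 * n%:R) * c + (225 + 96 * n%:R) * c) = (900 + 384 * n%:R) * c by ring.
apply: ler_wpM2r => //.
have := ler0n R n; lra.
Qed.

End Encoding.

(** * Test functions of larger mass, and the logarithmic bound *)

Section Layers.
Context {R : realType}.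
Local Notation mu := (@lebesgue_measure R).
Implicit Types (f : R -> R) (D : set R).

Lemma square_integrable_indic f D : measurable D -> square_integrable f ->
  square_integrable (fun t => f t * \1_D t).
Proof.
move=> mD [mf f2]; split.
  by apply: measurable_funM => //; exact: measurable_indic.
apply: (integ_le _ _ f2).
  by apply: measurable_funX; apply: measurable_funM => //; exact: measurable_indic.
move=> t; rewrite ger0_norm ?sqr_ge0 // exprMn indicE.
by case: (_ \in _); rewrite ?expr1n ?mulr1 // expr0n mulr0 sqr_ge0.
Qed.

Lemma rpair_splitD f D w : measurable D -> square_integrable f -> square_integrable w ->
  rpair f w = rpair (fun t => f t * \1_D t) w + rpair (fun t => f t * \1_(~` D) t) w.
Proof.
move=> mD qf qw; rewrite /rpair -RintegralD //.
- apply: eq_Rintegral => t _; rewrite !indicE in_setC.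
  by case: (_ \in _); rewrite ?mulr1 ?mulr0 ?mul0r ?addr0 ?add0r.
- by apply: integ_mul => //; exact: square_integrable_indic.
- by apply: integ_mul => //; apply: square_integrable_indic => //; exact: measurableC.
Qed.

Lemma square_integrable_wave_packet s m : is_quartile R s ->
  square_integrable (@wave_packet R (quartile_tile s m.+1)).
Proof.
move=> /quartile_shape [n]; case: s => I w /= ->.
by rewrite wave_packet_quartile; exact: square_integrable_wpack.
Qed.

Definition set_additive (F : (R -> R) -> R) := forall D f, measurable D ->
  square_integrable f -> F f = F (fun t => f t * \1_D t) + F (fun t => f t * \1_(~` D) t).

Lemma rform_additive S f1 f2 : {in S, forall s, is_quartile R s} ->
  set_additive (rform S f1 f2).
Proof.
move=> SQ D f mD qf; rewrite /rform -big_split /= big_seq [RHS]big_seq.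
apply: eq_bigr => s sS; rewrite -mulrDr -rpair_splitD //.
exact: square_integrable_wave_packet (SQ s sS).
Qed.

Lemma integ_indic D : measurable D -> (mu D < +oo)%E -> integ \1_D.
Proof.
move=> mD hD; apply/integrableP; split.
  by apply/measurable_EFinP; exact: measurable_indic.
apply: le_lt_trans hD; rewrite -[X in (_ <= mu X)%E]setIT -integral_indic //.
apply: ge0_le_integral => //.
- by apply/measurable_EFinP; apply: measurableT_comp => //; exact: measurable_indic.
- by apply/measurable_EFinP; exact: measurable_indic.
- by move=> t _ /=; rewrite lee_fin ger0_norm.
Qed.

Lemma Rintegral_indic_le f D (tau : R) : measurable D -> (mu D <= tau%:E)%E ->
  square_integrable f -> (forall t, `|f t| <= 1) ->
  \int[mu]_t ((f t * \1_D t) ^+ 2) <= tau.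
Proof.
move=> mD hD qf bf.
have fin : (mu D < +oo)%E by apply: (le_lt_trans hD); exact: ltry.
have i1 : integ \1_D by exact: integ_indic.
apply: (@le_trans _ _ (\int[mu]_t (\1_D t))).
  apply: le_Rintegral => //; first by case: (square_integrable_indic mD qf).
  move=> t _; rewrite exprMn indicE; case: (_ \in _); rewrite ?expr1n ?mulr1 ?expr0n ?mulr0 //=.
  by rewrite -real_normK ?num_real // expr_le1.
rewrite /Rintegral integral_indic // setIT.
by rewrite -lee_fin fineK // ge0_fin_numE.
Qed.

Lemma restricted_bound_mass (F : (R -> R) -> R) (tau M M' K : R) : M' <= M ->
  restricted_bound F tau M K -> restricted_bound F tau M' K.
Proof.
move=> le1 [Y [mY tY hY]]; exists Y; split=> // f3 q3 b3 n3 v3.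
by apply: hY => //; exact: le_trans n3 le1.
Qed.

Lemma square_mass_indic_le f D : measurable D -> square_integrable f ->
  \int[mu]_t ((f t * \1_D t) ^+ 2) <= \int[mu]_t (f t ^+ 2).
Proof.
move=> mD qf; apply: le_Rintegral => //.
- by case: (square_integrable_indic mD qf).
- by case: qf.
move=> t _; rewrite exprMn indicE; case: (_ \in _); rewrite ?expr1n ?mulr1 ?expr0n ?mulr0 //=.
exact: sqr_ge0.
Qed.

(* The part of f3 inside the exceptional set of measure 2 tau is estimated at
   level tau, and the rest at level 2 tau; the bounds form a geometric series. *)
Lemma restricted_bound_layers (F : (R -> R) -> R) (K t : R) : set_additive F -> 0 <= K ->
  (forall tau, 0 < tau -> tau <= t -> restricted_bound F tau (2 * tau) (K / Num.sqrt tau)) ->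
  forall tau, 0 < tau -> tau <= t -> restricted_bound F tau t (4 * K / Num.sqrt tau).
Proof.
move=> addF K0 hF.
have key n : forall tau, 0 < tau -> tau <= t -> t <= 2 ^+ n * tau ->
    restricted_bound F tau t (4 * K / Num.sqrt tau).
  have direct tau : 0 < tau -> tau <= t -> t <= 2 * tau ->
      restricted_bound F tau t (4 * K / Num.sqrt tau).
    move=> tau0 le1 le2; apply: (restricted_bound_mass le2).
    apply: restricted_bound_le (hF tau tau0 le1) => //.
    apply: ler_wpM2r; first by rewrite invr_ge0 sqrtr_ge0.
    by rewrite ler_peMl // (ler_nat R 1 4).
  elim: n => [|n IH] tau tau0 le1 le2.
    by apply: direct => //; rewrite expr0 mul1r in le2; lra.
  have [le3|lt3] := leP t (2 * tau); first exact: direct.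
  have tau20 : 0 < 2 * tau by rewrite mulr_gt0.
  have [|Y' [mY' tY' hY']] := IH (2 * tau) tau20 (ltW lt3).
    by rewrite mulrA -exprSr.
  have [Y [mY tY hY]] := hF tau tau0 le1.
  exists Y; split=> // f3 q3 b3 n3 v3.
  have mC : measurable (~` Y') by exact: measurableC.
  rewrite (addF Y' f3) //; apply: le_trans (ler_normD _ _) _.
  have b_indic E u : `|f3 u * \1_E u| <= 1.
    by rewrite normrM indicE; case: (_ \in _); rewrite ?normr1 ?normr0 ?mulr1 ?mulr0.
  have h1 : `|F (fun u => f3 u * \1_Y' u)| <= K / Num.sqrt tau.
    apply: hY => //; first exact: square_integrable_indic.
      exact: Rintegral_indic_le.
    by move=> u Yu; rewrite v3 // mul0r.
  have h2 : `|F (fun u => f3 u * \1_(~` Y') u)| <= 4 * K / Num.sqrt (2 * tau).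
    apply: hY' => //; first exact: square_integrable_indic.
      exact: le_trans (square_mass_indic_le mC q3) n3.
    by move=> u Yu; rewrite indicE in_setC mem_set //= mulr0.
  apply: le_trans (lerD h1 h2) _.
  (* The induction closes because [1 + 4 / sqrt 2 <= 4], for which [4 / 3] is a sufficient lower
     bound of the root. *)
  have s2 : 4 / 3 <= Num.sqrt 2 :> R.
    by rewrite -[4 / 3]ger0_norm ?divr_ge0 // -sqrtr_sqr ler_wsqrtr //; lra.
  have st0 : 0 < Num.sqrt tau by rewrite sqrtr_gt0.
  rewrite sqrtrM // invfM.
  have -> : K / Num.sqrt tau + 4 * K * ((Num.sqrt 2)^-1 / Num.sqrt tau) =
    (1 + 4 * (Num.sqrt 2)^-1) * K / Num.sqrt tau by ring.
  apply: ler_wpM2r; first by rewrite invr_ge0 ltW.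
  apply: ler_wpM2r => //.
  have : (Num.sqrt 2)^-1 <= 3 / 4 :> R.
    by rewrite -[3 / 4]invrK lef_pV2 ?posrE ?invr_gt0 ?divr_gt0 ?(lt_le_trans _ s2) // invf_div.
  lra.
move=> tau tau0 le1.
apply: (key (Num.Def.archi_bound (t / tau)) tau tau0 le1).
have t0 : 0 <= t by apply: le_trans le1; exact: ltW.
rewrite -ler_pdivrMr //; apply: le_trans (ltW (archi_boundP _)) _; first by rewrite divr_ge0 // ltW.
by rewrite -natrX ler_nat ltnW // ltn_expl.
Qed.

Lemma ln_ge1 (z : R) : 0 <= z -> 1 <= ln (expR 1 + z).
Proof. by move=> z0; rewrite -[leLHS]expRK ler_ln ?posrE ?expR_gt0 ?ltr_wpDr ?expR_gt0 // lerDl. Qed.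

Lemma expR1_le4 : expR 1 <= 4 :> R.
Proof.
have h : expR 1 * expR (- 2^-1) ^+ 2 = 1 :> R.
  by rewrite -expRM_natl -expRD (_ : 1 + _ = 0) ?expR0 //; field.
have h1 : 2^-1 <= expR (- 2^-1) :> R.
  by apply: le_trans (expR_ge1Dx _); lra.
have h0 := expR_gt0 1 : 0 < expR 1 :> R.
have : 4^-1 <= expR (- 2^-1) ^+ 2 :> R.
  by rewrite (_ : 4^-1 = 2^-1 ^+ 2) ?lerXn2r ?nnegrE ?expR_ge0 ?invr_ge0 //; field.
nra.
Qed.

Lemma rform_log_bound : exists C : R, 0 < C /\ forall S f1 f2 (x y A tau : R),
  uniq S -> {in S, forall s, is_quartile R s} ->
  0 < x -> 0 < y -> 0 <= A -> 0 < tau ->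
  square_integrable f1 -> square_integrable f2 -> integ f1 ->
  \int[mu]_t `|f1 t| <= x -> \int[mu]_t (f1 t ^+ 2) <= A * x ->
  \int[mu]_t (f2 t ^+ 2) <= y ^+ 2 ->
  restricted_bound (rform S f1 f2) tau (2 * tau)
    (C * x * y * ln (expR 1 + A * tau / x) / Num.sqrt tau).
Proof.
exists (900 * 3 * 1536); split; first by apply: mulr_gt0; [apply: mulr_gt0|]; rewrite ltr0n.
move=> S f1 f2 x y A tau uS SQ x0 y0 A0 tau0 q1 q2 i1 hx hA hy.
set z := A * tau / x.
have z0 : 0 <= z by rewrite /z divr_ge0 ?mulr_ge0 // ltW.
have lz := ln_ge1 z0; set lg := ln _ in lz *.
(* The number of rounds: [A * tau / x <= exp lg <= 4 ^ n] since [exp 1 <= 4], while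
   [1 + n <= 3 * lg] since [lg >= 1]. *)
pose n := (Num.truncn lg).+1.
have hn1 : lg < n%:R by rewrite truncnS_gt.
have hn2 : n%:R <= lg + 1.
  by rewrite /n -natr1 lerD2r truncn_le; lra.
have hn3 : 1 + n%:R <= 3 * lg by lra.
have hn : A * tau <= x * 4 ^+ n.
  have e : expR lg = expR 1 + z by rewrite lnK // posrE ltr_wpDr ?expR_gt0.
  have : z <= 4 ^+ n.
    apply: (@le_trans _ _ (expR lg)); first by rewrite e lerDr expR_ge0.
    apply: (@le_trans _ _ (expR 1 ^+ n)).
      by rewrite -expRM_natl mulr1 ler_expR ltW.
    by rewrite lerXn2r ?nnegrE ?expR_ge0 // expR1_le4.
  by rewrite /z ler_pdivrMr // [_ ^+ _ * _]mulrC.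
have h := rform_bound uS SQ x0 y0 tau0 q1 q2 i1 hx hA hy hn.
have c0 : 0 <= 1536 * x * y / Num.sqrt tau.
  apply: divr_ge0; last exact: sqrtr_ge0.
  apply: mulr_ge0; last exact: ltW.
  by apply: mulr_ge0; [exact: ler0n|exact: ltW].
have e : 900 * 3 * 1536 * x * y * lg / Num.sqrt tau =
  900 * (3 * lg) * (1536 * x * y / Num.sqrt tau) by ring.
rewrite e {e}; apply: restricted_bound_le h => //.
move: (1536 * x * y / Num.sqrt tau) c0 => c c0.
exact: (ler_wpM2r c0 (ler_wpM2l (ler0n _ _) hn3)).
Qed.

End Layers.

(** * Decomposition of f1 by heights *)

Section Weights.
Context {R : realType}.
Variable eps : R.
Hypothesis eps_gt0 : 0 < eps.
Implicit Types (j : nat) (t : R).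

Definition lev j : R := 1 + ln j.+1%:R.

(** At [height j] the iterated logarithms are [exp j], [j] and [ln j]. This is thus the product of
    the last two factors of the Orlicz function there, shifted so as to be at least 1. *)
Definition weight j : R := j.+1%:R `^ (1 / 2) * lev j `^ (1 / 2 + eps).

Definition height j : R := expR (expR j%:R).

Definition level_share j : R := lev j `^ (- (2 * eps)) - lev j.+1 `^ (- (2 * eps)).

Lemma lev_ge1 j : 1 <= lev j.
Proof. by rewrite /lev lerDl ln_ge0 // (ler_nat R 1). Qed.

Lemma lev_gt0 j : 0 < lev j.
Proof. exact: lt_le_trans ltr01 (lev_ge1 j). Qed.

Lemma lev0 : lev 0 = 1. Proof. by rewrite /lev ln1 addr0. Qed.

Lemma ln_mono (a b : R) : 0 < a -> a <= b -> ln a <= ln b.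
Proof. by move=> a0 ab; rewrite ler_ln ?posrE // (lt_le_trans a0). Qed.

Lemma ln3_mono (a b : R) : 0 < a -> 0 < ln a -> 0 < ln (ln a) -> a <= b ->
  ln (ln (ln a)) <= ln (ln (ln b)).
Proof. by move=> a0 a1 a2 ab; do 3 apply: ln_mono => //. Qed.

Lemma expR_le_ln (a b : R) : expR a <= b -> a <= ln b.
Proof. by move=> h; rewrite -[a]expRK; apply: ln_mono h; exact: expR_gt0. Qed.

Lemma ln_le_expR (a b : R) : 0 < a -> a <= expR b -> ln a <= b.
Proof. by move=> a0 h; rewrite -[b]expRK; exact: ln_mono. Qed.

Lemma one_powR (r : R) : 1 `^ r = 1.
Proof. by rewrite powR1. Qed.

Lemma powR_ge1 (a r : R) : 1 <= a -> 0 <= r -> 1 <= a `^ r.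
Proof.
move=> a1 r0; rewrite /powR gt_eqF ?(lt_le_trans ltr01) //.
by rewrite -[leLHS]expR0 ler_expR mulr_ge0 // ln_ge0.
Qed.

Lemma weight_ge1 j : 1 <= weight j.
Proof.
rewrite /weight mulr_ege1 //; apply: powR_ge1 => //; first by rewrite (ler_nat R 1).
  exact: lev_ge1.
by rewrite addr_ge0 // ltW.
Qed.


Lemma ln_le_sub1 (u : R) : 0 < u -> ln u <= u - 1.
Proof.
move=> u0; rewrite lerBrDl.
by have := expR_ge1Dx (ln u); rewrite lnK // posrE.
Qed.

Lemma ln_ge_sub (u : R) : 0 < u -> 1 - u^-1 <= ln u.
Proof.
move=> u0; have u1 : 0 < u^-1 by rewrite invr_gt0.
by have := ln_le_sub1 u1; rewrite lnV ?posrE //; lra.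
Qed.

Lemma lev_le j : lev j <= j.+1%:R.
Proof. by rewrite /lev -lerBrDl; apply: ln_le_sub1; rewrite ltr0n. Qed.

(** A share is a decrement of [lev^(-2 eps)], hence of order [eps / (j lev^(1 + 2 eps))], and the
    square of the weight is the inverse of this up to the factor [eps]. *)
Lemma level_share_ge : exists c : R, 0 < c /\
  forall j, c <= level_share j * weight j ^+ 2.
Proof.
exists (2 * eps * expR (- (2 * eps)) / 4); split.
  by rewrite divr_gt0 // mulr_gt0 ?expR_gt0 // mulr_gt0.
move=> j; have a1 := lev_ge1 j; have b1 := lev_ge1 j.+1.
have n0 : 0 < j.+1%:R :> R by rewrite ltr0n.
have n1 : 1 <= j.+1%:R :> R by rewrite (ler_nat R 1).
have nS : j.+2%:R = j.+1%:R + 1 :> R by rewrite -natr1.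
have ba : lev j.+1 - lev j = ln (j.+2%:R / j.+1%:R).
  by rewrite /lev ln_div ?posrE ?ltr0n //; lra.
have u0 : 0 < j.+2%:R / j.+1%:R :> R by rewrite divr_gt0 // ltr0n.
have ba_ge : (2 * j.+1%:R)^-1 <= lev j.+1 - lev j.
  rewrite ba; apply: le_trans (ln_ge_sub u0); rewrite invf_div.
  have -> : 1 - j.+1%:R / j.+2%:R = j.+2%:R^-1 :> R.
    by rewrite nS; move: (j.+1%:R : R) n0 => n n0; field; apply: lt0r_neq0; lra.
  by rewrite lef_pV2 ?posrE ?ltr0n ?mulr_gt0 // nS; lra.
have ba_le : lev j.+1 - lev j <= 1.
  rewrite ba; apply: le_trans (ln_le_sub1 u0) _.
  have -> : j.+2%:R / j.+1%:R - 1 = j.+1%:R^-1 :> R.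
    by rewrite nS; move: (j.+1%:R : R) n0 => n n0; field; apply: lt0r_neq0; lra.
  by rewrite invf_le1.
have a0 := lev_gt0 j; have b0 := lev_gt0 j.+1.
rewrite /level_share /weight; set a := lev j in a1 a0 ba_ge ba_le *.
set b := lev j.+1 in b1 b0 ba_ge ba_le *.
(* With this [s] the product equals [j.+1 * a * (1 - exp (- s))]. It is bounded below by
   [1 - exp (- s) >= s * exp (- s)], with [s <= 2 * eps] in the exponential and [b <= 2 * a] in the
   estimate of [ln (b / a)]. *)
pose s := 2 * eps * ln (b / a).
have r0 : 0 < b / a by rewrite divr_gt0.
have lnr_ge : (2 * j.+1%:R)^-1 / (2 * a) <= ln (b / a).
  apply: le_trans (ln_ge_sub r0); rewrite invf_div.
  have -> : 1 - a / b = (b - a) / b by field; rewrite gt_eqF.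
  apply: ler_pM => //; first by rewrite invr_ge0 mulr_ge0 // ltW.
  by rewrite lef_pV2 ?posrE // ?mulr_gt0 //; lra.
have lnr_le : ln (b / a) <= 1.
  apply: le_trans (ln_le_sub1 r0) _.
  have -> : b / a - 1 = (b - a) / a by field; rewrite gt_eqF.
  by rewrite ler_pdivrMr // mul1r; lra.
have lnr_ge0 : 0 <= ln (b / a).
  by apply: le_trans lnr_ge; rewrite divr_ge0 ?invr_ge0 ?mulr_ge0 ?ltW.
have s0 : 0 <= s by rewrite /s mulr_ge0 // mulr_ge0 // ltW.
have sle : s <= 2 * eps by rewrite /s ler_piMr // mulr_ge0 // ltW.
have e : (a `^ (- (2 * eps)) - b `^ (- (2 * eps))) *
   (j.+1%:R `^ (1 / 2) * a `^ (1 / 2 + eps)) ^+ 2 = j.+1%:R * a * (1 - expR (- s)).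
  rewrite exprMn /powR !gt_eqF // -!expRM_natl.
  have -> : expR (2 * (1 / 2 * ln j.+1%:R)) = j.+1%:R :> R.
    by rewrite (_ : 2 * (1 / 2 * ln j.+1%:R) = ln j.+1%:R) ?lnK ?posrE //; field.
  have -> : expR (2 * ((1 / 2 + eps) * ln a)) = a * expR (2 * eps * ln a).
    rewrite -[X in X * expR _](@lnK _ a) ?posrE // -expRD; congr expR; by field.
  have -> : - s = 2 * eps * ln a + (- (2 * eps) * ln b).
    by rewrite /s ln_div ?posrE //; ring.
  rewrite expRD.
  have PP : expR (- (2 * eps) * ln a) * expR (2 * eps * ln a) = 1.
    by rewrite -expRD mulNr addNr expR0.
  move: (expR (- (2 * eps) * ln a)) (expR (2 * eps * ln a)) (expR (- (2 * eps) * ln b)) PP.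
  move=> P' P Q PP.
  have -> : (P' - Q) * (j.+1%:R * (a * P)) = j.+1%:R * a * (P' * P - P * Q) by ring.
  by rewrite PP.
rewrite e.
have h1 : expR (- s) * s <= 1 - expR (- s).
  have := expR_ge1Dx s => hs.
  have es : expR (- s) * expR s = 1 by rewrite -expRD addNr expR0.
  have := expR_gt0 (- s); nra.
have h2 : expR (- (2 * eps)) <= expR (- s) by rewrite ler_expR lerN2.
have na : 0 < j.+1%:R * a by rewrite mulr_gt0.
have -> : 2 * eps * expR (- (2 * eps)) / 4 = j.+1%:R * a *
   (expR (- (2 * eps)) * (2 * eps * ((2 * j.+1%:R)^-1 / (2 * a)))).
  by field; rewrite !gt_eqF.
apply: ler_wpM2l; first exact: ltW.
apply: le_trans h1; apply: ler_pM; [exact: expR_ge0| |exact: h2|].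
  apply: mulr_ge0; first by rewrite mulr_ge0 // ltW.
  by rewrite divr_ge0 ?invr_ge0 ?mulr_ge0 // ltW.
by rewrite /s ler_wpM2l // mulr_ge0 // ltW.
Qed.

Lemma level_share_gt0 j : 0 < level_share j.
Proof.
have [c [c0 hc]] := level_share_ge.
have w0 : 0 < weight j ^+ 2 by rewrite exprn_gt0 // (lt_le_trans ltr01) // weight_ge1.
by rewrite -(pmulr_lgt0 _ w0); exact: lt_le_trans c0 (hc j).
Qed.

Lemma level_share_sum_le n : \sum_(j < n) level_share j <= 1.
Proof.
have -> : \sum_(j < n) level_share j = 1 - lev n `^ (- (2 * eps)).
  elim: n => [|n IH]; first by rewrite big_ord0 lev0 powR1 subrr.
  by rewrite big_ord_recr /= IH /level_share; ring.
by rewrite lerBlDr lerDl powR_ge0.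
Qed.

Lemma orlicz_phi_factors t : 0 <= t ->
  [/\ 1 <= ln (expR 1 + t), 1 <= ln (ln (expR (expR 1) + t)) &
   1 <= ln (ln (ln (expR (expR (expR 1)) + t)))].
Proof.
move=> t0.
have le_t (b : R) : b <= b + t by rewrite lerDl.
split.
- by apply: expR_le_ln; exact: le_t.
- by do 2 apply: expR_le_ln; exact: le_t.
- by do 3 apply: expR_le_ln; exact: le_t.
Qed.

Lemma orlicz_phi_ge0 t : 0 <= t -> 0 <= orlicz_phi eps t.
Proof.
move=> t0; have [h1 _ _] := orlicz_phi_factors t0.
rewrite /orlicz_phi !mulr_ge0 ?powR_ge0 //; exact: le_trans ler01 h1.
Qed.

Lemma powR_mono (a b r : R) : 0 <= a -> 0 <= r -> a <= b -> a `^ r <= b `^ r.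
Proof.
move=> a0 r0 ab; apply: ge0_ler_powR; rewrite ?nnegrE //; exact: le_trans a0 ab.
Qed.

(** The [j]-th part lives between the heights of indices [j - 1] and [j], so the factors are
    evaluated one level too low; this costs only constants. For [j = 0] there is no lower bound on
    [t], and all factors being at least 1 suffices. *)
Lemma orlicz_phi_ge : exists c : R, [/\ 0 < c, c <= 1 &
  forall j t, 0 <= t -> ((0 < j)%N -> height j.-1 <= t) ->
    c * expR j%:R * weight j * t <= orlicz_phi eps t].
Proof.
have h2 : 0 <= (1 / 2 : R) by lra.
have h2e : 0 <= 1 / 2 + eps by rewrite addr_ge0 // ltW.
(* The losses of the three factors: [exp (j - 1)] for [exp j], then [j.+1 <= 3 * log log] and
   [lev j <= 4 * log log log], each iterated logarithm being at least 1. *)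
pose c : R := expR (- 1) * (3^-1 `^ (1 / 2) * 4^-1 `^ (1 / 2 + eps)).
have c0 : 0 < c by rewrite /c !mulr_gt0 ?expR_gt0 ?powR_gt0.
have c1 : c <= 1.
  have x1 : expR (- 1) <= 1 :> R by rewrite expR_le1; lra.
  have x2 : 3^-1 `^ (1 / 2) <= 1 :> R by rewrite -[leRHS](one_powR (1 / 2)) powR_mono //; lra.
  have x3 : 4^-1 `^ (1 / 2 + eps) <= 1 :> R.
    by rewrite -[leRHS](one_powR (1 / 2 + eps)) powR_mono //; lra.
  have x0 : 0 <= expR (- 1) :> R by exact: expR_ge0.
  have y2 := powR_ge0 (3^-1 : R) (1 / 2); have y3 := powR_ge0 (4^-1 : R) (1 / 2 + eps).
  by rewrite /c; apply: mulr_ile1; rewrite ?mulr_ge0 ?mulr_ile1.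
exists c; split=> // j t t0 ht.
have [p1 p2 p3] := orlicz_phi_factors t0.
have [j0|j0] := posnP j.
  rewrite j0 expR0 mulr1 /weight lev0 !powR1 !mulr1.
  apply: (@le_trans _ _ t); first by rewrite ler_piMl.
  rewrite /orlicz_phi -!mulrA ler_peMr // mulr_ege1 // mulr_ege1 // powR_ge1 //.
have {}ht := ht j0.
have hp0 : 0 < height j.-1 by exact: expR_gt0.
have g1 : expR (- 1) * expR j%:R <= ln (expR 1 + t).
  rewrite -expRD (_ : - 1 + j%:R = j.-1%:R :> R); last first.
    by rewrite -{1}(prednK j0) -natr1; ring.
  by apply: expR_le_ln; apply: le_trans ht _; rewrite lerDr expR_ge0.
have g2 : 3^-1 * j.+1%:R <= ln (ln (expR (expR 1) + t)).
  have q : j.-1%:R <= ln (ln (expR (expR 1) + t)).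
    by do 2 apply: expR_le_ln; apply: le_trans ht _; rewrite lerDr expR_ge0.
  have jE : j.+1%:R = j.-1%:R + 2 :> R by rewrite -{1}(prednK j0) -!natr1; ring.
  rewrite jE; lra.
have q0 : 0 < ln (ln (expR (expR 1) + t)) by exact: lt_le_trans ltr01 p2.
have g3 : 4^-1 * lev j <= ln (ln (ln (expR (expR (expR 1)) + t))).
  set r := ln _ in p3 *.
  have qr : ln (ln (ln (expR (expR 1) + t))) <= r.
    have l1 : expR 1 <= ln (expR (expR 1) + t).
      by apply: expR_le_ln; rewrite lerDl.
    have l10 : 0 < ln (expR (expR 1) + t) by exact: lt_le_trans (expR_gt0 1) l1.
    have t1 : 0 < expR (expR 1) + t by apply: lt_le_trans (expR_gt0 (expR 1)) _; rewrite lerDl.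
    apply: (ln3_mono t1 l10 q0).
    rewrite lerD2r ler_expR ler_expR.
    by apply: le_trans (expR_ge1Dx _); rewrite lerDl.
  have : lev j <= 3 + ln (ln (ln (expR (expR 1) + t))).
    rewrite /lev.
    have : ln j.+1%:R <= ln (3 * ln (ln (expR (expR 1) + t))).
      by apply: ln_mono; [rewrite ltr0n|lra].
    rewrite lnM ?posrE // => hl.
    have : ln 3 <= 3 - 1 :> R by exact: ln_le_sub1.
    lra.
  lra.
rewrite /orlicz_phi; move: (ln (expR 1 + t)) (ln (ln (expR (expR 1) + t)))
  (ln (ln (ln (expR (expR (expR 1)) + t)))) g1 g2 g3 {p1 p2 p3 q0} => l1 l2 l3 g1 g2 g3.
have lj := ltW (lev_gt0 j).
have w1 : 3^-1 `^ (1 / 2) * j.+1%:R `^ (1 / 2) <= l2 `^ (1 / 2).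
  by rewrite -powRM ?invr_ge0 //; apply: powR_mono.
have w2 : 4^-1 `^ (1 / 2 + eps) * lev j `^ (1 / 2 + eps) <= l3 `^ (1 / 2 + eps).
  by rewrite -powRM ?invr_ge0 //; apply: powR_mono => //; exact: mulr_ge0.
have -> : c * expR j%:R * weight j * t = t * (expR (- 1) * expR j%:R) *
   (3^-1 `^ (1 / 2) * j.+1%:R `^ (1 / 2)) *
   (4^-1 `^ (1 / 2 + eps) * lev j `^ (1 / 2 + eps)).
  by rewrite /c /weight; ring.
have e0 : 0 <= expR (- 1) * expR j%:R :> R by rewrite mulr_ge0 ?expR_ge0.
have e1 : 0 <= 3^-1 `^ (1 / 2) * j.+1%:R `^ (1 / 2) :> R by rewrite mulr_ge0 ?powR_ge0.
have e2 : 0 <= 4^-1 `^ (1 / 2 + eps) * lev j `^ (1 / 2 + eps) by rewrite mulr_ge0 ?powR_ge0.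
apply: ler_pM => //; first by rewrite !mulr_ge0.
apply: ler_pM => //; first exact: mulr_ge0.
by rewrite ler_wpM2l.
Qed.

Lemma weight_le j : weight j <= expR ((1 + eps) * expR j%:R).
Proof.
have n0 : 0 < j.+1%:R :> R by rewrite ltr0n.
apply: (@le_trans _ _ (j.+1%:R `^ (1 + eps))).
  rewrite (_ : 1 + eps = 1 / 2 + (1 / 2 + eps)); last by field.
  rewrite powRD; last by rewrite pnatr_eq0 /= implybT.
  apply: ler_wpM2l; first exact: powR_ge0.
  by apply: powR_mono; [exact: ltW (lev_gt0 j)|rewrite addr_ge0 // ltW|exact: lev_le].
rewrite /powR gt_eqF // ler_expR ler_wpM2l //; first by rewrite addr_ge0 // ltW.
apply: le_trans (ln_le_sub1 n0) _; apply: le_trans (expR_ge1Dx _).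
by rewrite -natr1; lra.
Qed.

(** The lower bound on [x] makes [height j / x] at most [exp ((4 + eps) * exp j)]: the height, [2^j]
    and [exp j] contribute one [exp j] each to the exponent, the weight [1 + eps]. The dependence on
    [t] then separates as the factor [ln (e + t)]. *)
Lemma log_level_le j (tau t x c : R) : 0 < c -> c <= 1 -> 0 <= tau -> tau <= t ->
  2^-1 ^+ j * expR (- j%:R) / (c * weight j) <= x ->
  ln (expR 1 + height j * tau / x) <= (6 + eps) * expR j%:R * ln (expR 1 + t).
Proof.
move=> c0 c1 tau0 taut hx.
have w1 := weight_ge1 j; have w0 : 0 < weight j by exact: lt_le_trans ltr01 w1.
have t0 : 0 <= t by exact: le_trans tau0 taut.
pose X := height j * (2 ^+ j * expR j%:R * (c * weight j)).
have cw : 0 < c * weight j by exact: mulr_gt0.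
have D0 : 0 < 2^-1 ^+ j * expR (- j%:R) / (c * weight j).
  by apply: divr_gt0.
have x0 : 0 < x by exact: lt_le_trans D0 hx.
have xV : x^-1 <= 2 ^+ j * expR j%:R * (c * weight j).
  have -> : 2 ^+ j * expR j%:R * (c * weight j) =
      (2^-1 ^+ j * expR (- j%:R) / (c * weight j))^-1.
    rewrite expRN exprVn.
    have p2 : 2 ^+ j != 0 :> R by rewrite expf_neq0.
    have pe : expR j%:R != 0 :> R by rewrite gt_eqF // expR_gt0.
    move: (2 ^+ j) (expR j%:R) p2 pe => p e p2 pe.
    by field; rewrite p2 pe !gt_eqF.
  by rewrite lef_pV2 ?posrE.
have ej1 : 1 <= expR j%:R :> R by rewrite -[leLHS]expR0 ler_expR.
have Xle : X <= expR ((4 + eps) * expR j%:R).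
  have -> : (4 + eps) * expR j%:R = expR j%:R + (expR j%:R + expR j%:R + (1 + eps) * expR j%:R).
    by ring.
  rewrite /X !expRD /height; apply: ler_wpM2l; first exact: expR_ge0.
  have jle : j%:R <= expR j%:R :> R by apply: le_trans (expR_ge1Dx _); lra.
  have ej2 : expR j%:R <= expR (expR j%:R) :> R by rewrite ler_expR.
  apply: ler_pM.
  - by rewrite mulr_ge0 ?exprn_ge0 ?expR_ge0.
  - by rewrite mulr_ge0 // ltW.
  - apply: ler_pM; rewrite ?exprn_ge0 ?expR_ge0 //.
    apply: le_trans ej2; rewrite -[X in expR X]mulr1 expRM_natl lerXn2r ?nnegrE ?expR_ge0 //.
    by apply: le_trans (expR_ge1Dx _); lra.
  - by apply: le_trans (weight_le j); rewrite ler_piMl // ltW.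
have X0 : 0 <= X.
  rewrite /X; apply: mulr_ge0; first exact: expR_ge0.
  apply: mulr_ge0; last exact: (ltW cw).
  by rewrite mulr_ge0 ?exprn_ge0 ?expR_ge0.
have L1 := ln_ge1 t0.
apply: (@le_trans _ _ (ln ((expR 1 + t) * (1 + X)))).
  apply: ln_mono.
    apply: lt_le_trans (expR_gt0 1) _; rewrite lerDl.
    apply: divr_ge0; last exact: ltW.
    by rewrite mulr_ge0 ?expR_ge0.
  have : height j * tau / x <= X * t.
    have -> : X * t = height j * t * (2 ^+ j * expR j%:R * (c * weight j)).
      by rewrite /X; ring.
    apply: ler_pM; [by rewrite mulr_ge0 ?expR_ge0|by rewrite invr_ge0 ltW| |exact: xV].
    by rewrite ler_wpM2l ?expR_ge0.
  have : 0 <= expR 1 :> R by exact: expR_ge0.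
  nra.
have p1 : 0 < expR 1 + t by apply: lt_le_trans (expR_gt0 1) _; rewrite lerDl.
have p2 : 0 < 1 + X by apply: lt_le_trans ltr01 _; rewrite lerDl.
rewrite lnM ?posrE //.
have X1 : ln (1 + X) <= (5 + eps) * expR j%:R.
  apply: ln_le_expR => //.
  have -> : (5 + eps) * expR j%:R = expR j%:R + (4 + eps) * expR j%:R by ring.
  have e2 : 2 <= expR (expR j%:R) :> R.
    by apply: le_trans (expR_ge1Dx _); lra.
  have e1 : 1 <= expR ((4 + eps) * expR j%:R).
    by rewrite -[leLHS]expR0 ler_expR mulr_ge0 ?expR_ge0 // addr_ge0 // ltW.
  rewrite expRD; nra.
have lX0 : 0 <= ln (1 + X) by rewrite ln_ge0 // lerDl.
have e0 := eps_gt0; nra.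
Qed.

End Weights.

(** * Splitting the form in its first function *)

Section Levels.
Context {R : realType}.
Local Notation mu := (@lebesgue_measure R).
Implicit Types (f h G w : R -> R) (S : seq rectangle).

Lemma measurable_orlicz_phi (eps : R) : measurable_fun setT (orlicz_phi eps).
Proof.
have add (c : R) : measurable_fun setT (fun t : R => c + t).
  by apply: measurable_funD.
have ln_c (g : R -> R) : measurable_fun setT g -> measurable_fun setT (fun t => ln (g t)).
  by move=> mg; apply: measurableT_comp => //; exact: measurable_ln.
have pw (g : R -> R) (r : R) : measurable_fun setT g -> measurable_fun setT (fun t => g t `^ r).
  by move=> mg; apply: (measurableT_comp (measurable_powR r)).
rewrite /orlicz_phi; apply: measurable_funM.
  apply: measurable_funM; first by apply: measurable_funM => //; apply: (ln_c); exact: add.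
  by apply: (pw); do 2 apply: (ln_c); exact: add.
by apply: (pw); do 3 apply: (ln_c); exact: add.
Qed.

Lemma integ_mul_wave_packet f s m : is_quartile R s -> integ f ->
  integ (fun x => f x * @wave_packet R (quartile_tile s m.+1) x).
Proof.
move=> qs hf; have [_ [mw _]] := (tt, @square_integrable_wave_packet R s m qs).
apply: (@integ_le _ _ (fun x => (Num.sqrt (dyadic_len R s.1))^-1 * `|f x|)).
- by apply: measurable_funM => //; exact: integ_measurable.
- move=> x; rewrite normrM mulrC ler_wpM2r //.
  have [n e] := quartile_shape qs; case: s e {qs mw} => I w /= ->.
  rewrite wave_packet_quartile; apply: le_trans (norm_wpack _ _ _) _.
  by rewrite ler_piMr ?invr_ge0 ?sqrtr_ge0 // indicE lern1; case: (_ \in _).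
- by apply: integZ; exact: integ_abs.
Qed.

Lemma rpair_abs_le f s m : is_quartile R s -> integ f ->
  `|rpair f (@wave_packet R (quartile_tile s m.+1))| <=
  (Num.sqrt (dyadic_len R s.1))^-1 * \int[mu]_x `|f x|.
Proof.
move=> qs hf; have ifw := integ_mul_wave_packet m qs hf.
apply: le_trans (le_normr_Rintegral measurableT ifw) _.
rewrite -RintegralZl //; last exact: integ_abs.
apply: le_Rintegral => //; first exact: integ_abs.
  by apply: integZ; exact: integ_abs.
move=> x _; rewrite normrM mulrC ler_wpM2r //.
have [n e] := quartile_shape qs; case: s e {qs ifw} => I w /= ->.
rewrite wave_packet_quartile; apply: le_trans (norm_wpack _ _ _) _.
by rewrite ler_piMr ?invr_ge0 ?sqrtr_ge0 // indicE lern1; case: (_ \in _).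
Qed.

Lemma rform_split1 S h f2 f3 (D : set R) : {in S, forall s, is_quartile R s} ->
  integ h -> measurable D ->
  rform S h f2 f3 = rform S (fun t => h t * \1_D t) f2 f3 +
                    rform S (fun t => h t * \1_(~` D) t) f2 f3.
Proof.
move=> SQ ih mD; rewrite /rform -big_split /= big_seq [RHS]big_seq.
apply: eq_bigr => s sS; have qs := SQ s sS.
have -> : rpair h (wave_packet (quartile_tile s 1)) =
  rpair (fun t => h t * \1_D t) (wave_packet (quartile_tile s 1)) +
  rpair (fun t => h t * \1_(~` D) t) (wave_packet (quartile_tile s 1)).
  rewrite /rpair -RintegralD //.
  - apply: eq_Rintegral => t _; rewrite !indicE in_setC.
    by case: (_ \in _); rewrite ?mulr1 ?mulr0 ?mul0r ?addr0 ?add0r.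
  - by apply: integ_mul_wave_packet => //; exact: integ_mul_indic.
  - apply: integ_mul_wave_packet => //; apply: integ_mul_indic => //.
    exact: measurableC.
by rewrite mulrDr !mulrDl.
Qed.

(** The constant depends on [S] and [f2]. It serves only to discard the part of [h] above a
    sufficiently large height, whose [L^1] norm is as small as desired. *)
Lemma rform_abs_le S f2 : {in S, forall s, is_quartile R s} ->
  exists K : R, 0 <= K /\ forall h f3, integ h -> square_integrable f3 ->
    (forall t, `|f3 t| <= 1) -> `|rform S h f2 f3| <= K * \int[mu]_x `|h x|.
Proof.
move=> SQ.
pose c (s : rectangle) : R := (Num.sqrt (dyadic_len R s.1))^-1.
pose w3 (s : rectangle) := @wave_packet R (quartile_tile s 3).
pose b (s : rectangle) : R := `|rpair f2 (@wave_packet R (quartile_tile s 2))|.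
have c0 s : 0 <= c s by rewrite invr_ge0 sqrtr_ge0.
pose d (s : rectangle) : R := \int[mu]_x `|w3 s x|.
have d0 s : 0 <= d s by apply: Rintegral_ge0.
exists (\sum_(s <- S) c s * c s * b s * d s); split.
  apply: sumr_ge0 => s _; apply: mulr_ge0 => //.
  by apply: mulr_ge0; [exact: mulr_ge0|exact: normr_ge0].
move=> h f3 ih q3 b3; rewrite mulr_suml; apply: le_trans (ler_norm_sum _ _ _) _.
rewrite big_seq [leRHS]big_seq; apply: ler_sum => s sS; have qs := SQ s sS.
have h1 := rpair_abs_le 0 qs ih; rewrite -/(c s) in h1.
have qw := @square_integrable_wave_packet R s 2 qs.
have h3 : `|rpair f3 (w3 s)| <= d s.
  have i3 := integ_mul q3 qw.
  apply: le_trans (le_normr_Rintegral measurableT i3) _.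
  apply: le_Rintegral => //; first exact: integ_abs.
    have [n e] := quartile_shape qs; rewrite /w3; case: s e {qs i3 qw h1 sS} => I w /= ->.
    rewrite wave_packet_quartile.
    apply: (@integ_le _ _ (fun x => (Num.sqrt (dyadic_len R I))^-1 *
      \1_(`[dyadic_left R I, dyadic_left R I + dyadic_len R I]) x)).
    - by apply: measurableT_comp => //; exact: measurable_wpack.
    - by move=> x; rewrite normr_id; exact: norm_wpack.
    - by apply: integZ; exact: integ_itv.
  by move=> x _; rewrite normrM ler_piMl.
rewrite !normrM ger0_norm // -/(b s).
have -> : c s * c s * b s * d s * \int[mu]_x `|h x| =
  c s * (c s * \int[mu]_x `|h x|) * b s * d s by ring.
have i0 : 0 <= \int[mu]_x `|h x| by apply: Rintegral_ge0.
have b0 : 0 <= b s by exact: normr_ge0.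
apply: ler_pM; [by apply: mulr_ge0 => //; exact: mulr_ge0|exact: normr_ge0| |exact: h3].
by apply: ler_wpM2r; [exact: normr_ge0|apply: ler_wpM2l].
Qed.

End Levels.

Lemma indic_mul_subset {R : realType} (A B : set R) (x : R) : A `<=` B ->
  \1_B x * \1_A x = \1_A x :> R.
Proof.
move=> AB; have sub : x \in A -> x \in B by rewrite !inE; exact: AB.
rewrite !indicE; move: sub; case: (x \in A) => [->//|_]; last by rewrite mulr0.
by rewrite mulr1.
Qed.

Lemma indic_add_subset {R : realType} (A B : set R) (x : R) : A `<=` B ->
  \1_A x + \1_B x * \1_(~` A) x = \1_B x :> R.
Proof.
move=> AB; have sub : x \in A -> x \in B by rewrite !inE; exact: AB.
rewrite !indicE in_setC; move: sub; case: (x \in A) => [->//|_] /=.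
  by rewrite mulr0 addr0.
by rewrite mulr1 add0r.
Qed.

(** * Summation over the heights *)

Section Decomposition.
Context {R : realType}.
Variable eps : R.
Hypothesis eps_gt0 : 0 < eps.
Local Notation mu := (@lebesgue_measure R).
Variables (h G : R -> R).
Hypothesis mh : measurable_fun setT h.
Hypothesis mG : measurable_fun setT G.
Hypothesis hG : forall x, `|h x| <= G x.
Local Notation phiG := (fun x => orlicz_phi eps (G x)).
Hypothesis phi_le1 : (\int[mu]_x (orlicz_phi eps (G x))%:E <= 1)%E.

Definition below (j : nat) : set R := [set x | `|h x| <= height j].

Definition level (j : nat) (x : R) : R :=
  \1_(below j) x * (if j is j'.+1 then \1_(~` below j') x else 1).

Lemma measurable_le_set (f g : R -> R) : measurable_fun setT f ->
  measurable_fun setT g -> measurable [set x | f x <= g x].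
Proof.
move=> mf mg; have := measurable_fun_ler mf mg.
move=> /(_ measurableT [set true] I); rewrite setTI.
by congr (measurable _); apply/seteqP; split.
Qed.

Lemma measurable_below j : measurable (below j).
Proof. by apply: measurable_le_set => //; apply: measurableT_comp. Qed.

Lemma G_ge0 x : 0 <= G x.
Proof. exact: le_trans (normr_ge0 _) (hG x). Qed.

Lemma integ_phi : integ phiG.
Proof.
have mphi : measurable_fun setT phiG.
  by apply: (measurableT_comp (measurable_orlicz_phi eps)).
apply/integrableP; split; first exact/measurable_EFinP.
apply: (@le_lt_trans _ _ 1%E); last exact: ltry.
apply: le_trans phi_le1; apply: ge0_le_integral => //.
- by apply/measurable_EFinP; apply: measurableT_comp.
- exact/measurable_EFinP.
- by move=> x _ /=; rewrite lee_fin ger0_norm // orlicz_phi_ge0 // G_ge0.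
Qed.

Lemma phi_int_le1 : \int[mu]_x phiG x <= 1.
Proof.
rewrite -lee_fin fineK; first exact: phi_le1.
exact: (integrable_fin_num measurableT integ_phi).
Qed.

Lemma height_mono j k : (j <= k)%N -> height j <= height k :> R.
Proof. by move=> jk; rewrite !ler_expR ler_nat. Qed.

Lemma level_01 j x : level j x = 0 \/ level j x = 1.
Proof.
rewrite /level indicE; case: j => [|j]; first by rewrite mulr1; case: (_ \in _); [right|left].
by rewrite indicE; do 2 case: (_ \in _); rewrite ?mulr1 ?mulr0 ?mul0r; [right|left|left|left].
Qed.

Lemma level_ge0 j x : 0 <= level j x.
Proof. by case: (level_01 j x) => ->. Qed.

Lemma level_le1 j x : level j x <= 1.
Proof. by case: (level_01 j x) => ->. Qed.

Lemma levelP j x : level j x = 1 ->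
  `|h x| <= height j /\ ((0 < j)%N -> height j.-1 <= `|h x|).
Proof.
rewrite /level !indicE; case: j => [|j] /=.
  rewrite mulr1; case: (boolP (_ \in _)) => [/set_mem hx _|_ /= /eqP]; first by split.
  by rewrite eq_sym oner_eq0.
case: (boolP (x \in below j.+1)) => [/set_mem hx|_]; last first.
  by rewrite mul0r => /eqP; rewrite eq_sym oner_eq0.
rewrite indicE; case: (boolP (x \in _)) => [/set_mem hn _|_]; last first.
  by rewrite mulr0 => /eqP; rewrite eq_sym oner_eq0.
by split=> // _; apply: ltW; rewrite ltNge; apply/negP.
Qed.

Lemma measurable_level j : measurable_fun setT (level j).
Proof.
apply: measurable_funM; first exact: measurable_indic (measurable_below j).
case: j => [|j] //; apply: measurable_indic; apply: measurableC; exact: measurable_below.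
Qed.

Definition level_part j x : R := h x * level j x.

Lemma integ_mul_level f j : integ f -> integ (fun x => f x * level j x).
Proof.
move=> hf; apply: (integ_le _ _ (integ_abs hf)).
  by apply: measurable_funM; [exact: integ_measurable|exact: measurable_level].
move=> x; rewrite normrM [X in _ * X]ger0_norm ?level_ge0 //.
by rewrite ler_piMr // level_le1.
Qed.

Section Constants.
Variable c : R.
Hypothesis c_gt0 : 0 < c.
Hypothesis c_le1 : c <= 1.
Hypothesis c_phi : forall j t, 0 <= t -> ((0 < j)%N -> height j.-1 <= t) ->
  c * expR j%:R * weight eps j * t <= orlicz_phi eps t.

Lemma integ_h : integ h.
Proof.
apply: (@integ_le _ _ (fun x => c^-1 * phiG x)) => //; last exact: integZ integ_phi.
move=> x; rewrite ler_pdivlMl //.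
have := @c_phi 0 (G x) (G_ge0 x) (fun h => False_ind _ (elimF idP erefl h)).
rewrite expR0 mulr1 /weight lev0 !one_powR !mulr1 => hc.
by apply: le_trans hc; rewrite ler_pM2l.
Qed.

Definition level_phi j : R := \int[mu]_x (phiG x * level j x).

(** The summand [2^-1 ^+ j] bounds the mass away from 0, as [log_level_le] requires, and adds at
    most 2 to the sum over all levels. *)
Definition level_mass j : R := (level_phi j + 2^-1 ^+ j) * expR (- j%:R) / (c * weight eps j).

Lemma level_phi_ge0 j : 0 <= level_phi j.
Proof.
by apply: Rintegral_ge0 => x _; rewrite mulr_ge0 ?level_ge0 // orlicz_phi_ge0 // G_ge0.
Qed.

Lemma weight_gt0 j : 0 < weight eps j.
Proof. exact: lt_le_trans ltr01 (weight_ge1 eps_gt0 j). Qed.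

Lemma cw_gt0 j : 0 < c * weight eps j.
Proof. by rewrite mulr_gt0 // weight_gt0. Qed.

Lemma half_pow_gt0 j : 0 < 2^-1 ^+ j :> R.
Proof. by rewrite exprn_gt0 // invr_gt0. Qed.

Lemma level_mass_gt0 j : 0 < level_mass j.
Proof.
apply: divr_gt0; last exact: cw_gt0.
apply: mulr_gt0; last exact: expR_gt0.
by apply: ltr_wpDl; [exact: level_phi_ge0|exact: half_pow_gt0].
Qed.

Lemma integ_hl j : integ (level_part j).
Proof. exact: integ_mul_level integ_h. Qed.

(** On its level [|h|], and so also [G], is at least the previous height, where the Orlicz function
    dominates [c * exp j * weight * G]. Working with [G] lets real and imaginary parts share the
    normalization by the modulus. *)
Lemma level_part_int_le j : \int[mu]_x `|level_part j x| <= level_mass j.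
Proof.
pose k := expR (- j%:R) / (c * weight eps j).
have k0 : 0 <= k by rewrite divr_ge0 ?expR_ge0 // ltW // cw_gt0.
apply: (@le_trans _ _ (\int[mu]_x (k * (phiG x * level j x)))).
  apply: le_Rintegral => //.
  - exact: integ_abs (integ_hl j).
  - apply: integZ; exact: integ_mul_level integ_phi.
  move=> x _; rewrite /level_part normrM [X in _ * X]ger0_norm ?level_ge0 //.
  have [->|e] := level_01 j x; first by rewrite !mulr0.
  rewrite e !mulr1; have [hx1 hx2] := levelP e.
  have hc := @c_phi j (G x) (G_ge0 x) (fun j0 => le_trans (hx2 j0) (hG x)).
  apply: le_trans (hG x) _.
  have eG : G x = k * (c * expR j%:R * weight eps j * G x).
    rewrite /k expRN; field.
    by rewrite !gt_eqF ?expR_gt0 ?weight_gt0.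
  rewrite [leLHS]eG; exact: (ler_wpM2l k0 hc).
rewrite RintegralZl //; last exact: integ_mul_level integ_phi.
rewrite /level_mass -mulrA [leRHS]mulrC -/k ler_wpM2l // -/(level_phi j) lerDl.
exact: ltW (half_pow_gt0 j).
Qed.

Lemma level_part_sqr_le j x : level_part j x ^+ 2 <= height j * `|level_part j x|.
Proof.
rewrite -real_normK ?num_real // expr2 ler_wpM2r // /level_part normrM.
rewrite [X in _ * X]ger0_norm ?level_ge0 //.
have [->|e] := level_01 j x; first by rewrite mulr0 expR_ge0.
by rewrite e mulr1; have [] := levelP e.
Qed.

Lemma square_integrable_hl j : square_integrable (level_part j).
Proof.
have mhl : measurable_fun setT (level_part j) by exact: integ_measurable (integ_hl j).
split=> //; apply: (@integ_le _ _ (fun x => height j * `|level_part j x|)).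
- exact: measurable_funX.
- by move=> x; rewrite ger0_norm ?sqr_ge0 //; exact: level_part_sqr_le.
- by apply: integZ; exact: integ_abs (integ_hl j).
Qed.

Lemma level_part_sqr_int_le j : \int[mu]_x (level_part j x ^+ 2) <= height j * level_mass j.
Proof.
apply: (@le_trans _ _ (\int[mu]_x (height j * `|level_part j x|))).
  apply: le_Rintegral => //; first by case: (square_integrable_hl j).
    by apply: integZ; exact: integ_abs (integ_hl j).
  by move=> x _; exact: level_part_sqr_le.
rewrite RintegralZl //; last exact: integ_abs (integ_hl j).
by rewrite ler_wpM2l ?expR_ge0 // level_part_int_le.
Qed.

Section Sum.
Variables (S : seq rectangle) (f2 : R -> R) (y t C1 c2 : R).
Hypothesis uS : uniq S.
Hypothesis SQ : {in S, forall s, is_quartile R s}.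
Hypothesis q2 : square_integrable f2.
Hypothesis hy : \int[mu]_x (f2 x ^+ 2) <= y ^+ 2.
Hypothesis y_gt0 : 0 < y.
Hypothesis t_gt0 : 0 < t.
Hypothesis C1_gt0 : 0 < C1.
Hypothesis c2_gt0 : 0 < c2.
Hypothesis c2_share : forall j, c2 <= level_share eps j * weight eps j ^+ 2.
Hypothesis C1_form : forall (f1 : R -> R) (x A tau : R), 0 < x -> 0 <= A -> 0 < tau ->
  square_integrable f1 -> integ f1 ->
  \int[mu]_s `|f1 s| <= x -> \int[mu]_s (f1 s ^+ 2) <= A * x ->
  restricted_bound (rform S f1 f2) tau (2 * tau)
    (C1 * x * y * ln (expR 1 + A * tau / x) / Num.sqrt tau).

Definition rate : R := y * ln (expR 1 + t) / Num.sqrt t.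

(** Here 4 is the loss from layering [f3], [C1] comes from the form bound, [6 + eps] from
    [log_level_le], and [sqrt (c2 / 16)] from comparing the share of [t / 16] with the weight. *)
Definition level_const : R := 4 * C1 * (6 + eps) / (Num.sqrt (c2 / 16) * c).

Lemma rate_gt0 : 0 < rate.
Proof.
rewrite /rate divr_gt0 ?sqrtr_gt0 // mulr_gt0 //.
by apply: lt_le_trans ltr01 (ln_ge1 _); exact: ltW.
Qed.

Lemma level_const_gt0 : 0 < level_const.
Proof.
apply: divr_gt0; last by rewrite mulr_gt0 // sqrtr_gt0 divr_gt0.
by rewrite mulr_gt0 ?addr_gt0 // mulr_gt0.
Qed.

Lemma level_share_le1 j : level_share eps j <= 1.
Proof.
apply: le_trans (level_share_sum_le eps j.+1); rewrite big_ord_recr /= lerDr.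
by apply: sumr_ge0 => i _; exact: ltW (level_share_gt0 eps_gt0 i).
Qed.

(** All growth in [j] cancels: the logarithm gives [exp j] and the small measure gives [weight j],
    and [level_mass j] contains the inverses of both. What is left is summable because the integrals
    [level_phi j] add up to at most 1. *)
Lemma level_bound j : restricted_bound (rform S (level_part j) f2)
  (level_share eps j / 16 * t) t (level_const * (level_phi j + 2^-1 ^+ j) * rate).
Proof.
have sh0 := level_share_gt0 eps_gt0 j; have w0 := weight_gt0 j.
have x0 := level_mass_gt0 j; have st0 : 0 < Num.sqrt t by rewrite sqrtr_gt0.
have ln1 : 1 <= ln (expR 1 + t) by apply: ln_ge1; exact: ltW.
have [lt_ elt] : exists z, z = ln (expR 1 + t) by exists (ln (expR 1 + t)).
rewrite -elt in ln1.
have ln0 : 0 < lt_ by exact: lt_le_trans ltr01 ln1.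
have a0 : 0 < 6 + eps by rewrite addr_gt0.
have CX : 0 <= C1 * level_mass j * y.
  by apply: mulr_ge0; [apply: mulr_ge0; exact: ltW|exact: ltW].
pose K := C1 * level_mass j * y * ((6 + eps) * expR j%:R * lt_).
have K0 : 0 <= K.
  apply: mulr_ge0; first exact: CX.
  by apply: mulr_ge0; [apply: mulr_ge0; [exact: ltW|exact: expR_ge0]|exact: ltW].
pose tau := level_share eps j / 16 * t.
have tau0 : 0 < tau by rewrite /tau mulr_gt0 // divr_gt0.
have taut : tau <= t.
  rewrite /tau ler_piMl //; first exact: ltW.
  rewrite ler_pdivrMr // mul1r; apply: le_trans (level_share_le1 j) _.
  by rewrite (ler_nat R 1 16).
have hF tau' : 0 < tau' -> tau' <= t ->
    restricted_bound (rform S (level_part j) f2) tau' (2 * tau') (K / Num.sqrt tau').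
  move=> tau'0 le1.
  have hb := C1_form x0 (expR_ge0 (expR j%:R)) tau'0 (square_integrable_hl j)
    (integ_hl j) (level_part_int_le j) (level_part_sqr_int_le j).
  apply: restricted_bound_le hb => //.
  apply: ler_wpM2r; first by rewrite invr_ge0 sqrtr_ge0.
  apply: ler_wpM2l; first exact: CX.
  rewrite elt; apply: (@log_level_le _ eps eps_gt0 j tau' t (level_mass j) c) => //; first exact: ltW.
  rewrite /level_mass; apply: ler_wpM2r; first by rewrite invr_ge0 ltW // cw_gt0.
  apply: ler_wpM2r; first exact: expR_ge0.
  by rewrite lerDr; exact: level_phi_ge0.
have addF : set_additive (rform S (level_part j) f2) by exact: rform_additive.
have h1 := restricted_bound_layers addF K0 hF tau0 taut.
apply: restricted_bound_le h1 => //.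
pose s0 := Num.sqrt (c2 / 16).
have s00 : 0 < s0 by rewrite sqrtr_gt0 divr_gt0.
have key : (Num.sqrt tau)^-1 <= weight eps j / (s0 * Num.sqrt t).
  have q0 : 0 < s0 * Num.sqrt t by rewrite mulr_gt0.
  rewrite -[leRHS]invrK lef_pV2 ?posrE ?sqrtr_gt0 ?invr_gt0 ?divr_gt0 //.
  rewrite invf_div.
  have e1 : Num.sqrt ((s0 * Num.sqrt t / weight eps j) ^+ 2) = s0 * Num.sqrt t / weight eps j.
    by rewrite sqrtr_sqr gtr0_norm // divr_gt0.
  have c16 : 0 <= c2 / 16 by rewrite divr_ge0 // ltW.
  rewrite -e1 ler_wsqrtr // expr_div_n exprMn !sqr_sqrtr //; last exact: ltW.
  rewrite ler_pdivrMr ?exprn_gt0 // /tau.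
  have -> : level_share eps j / 16 * t * weight eps j ^+ 2 =
    level_share eps j * weight eps j ^+ 2 / 16 * t by ring.
  by rewrite ler_pM2r // ler_pM2r // invr_gt0.
apply: (@le_trans _ _ (4 * K * (weight eps j / (s0 * Num.sqrt t)))).
  by apply: ler_wpM2l => //; rewrite mulr_ge0.
rewrite le_eqVlt; apply/orP; left; apply/eqP.
rewrite /K /level_const /rate -elt -/s0 /level_mass expRN.
have pe := expR_gt0 (j%:R : R).
move: (expR j%:R) pe => e pe; move: (Num.sqrt t) st0 => r r0.
by field; rewrite !gt_eqF.
Qed.

Lemma below_mono j : below j `<=` below j.+1.
Proof. by move=> x hx; exact: (le_trans hx (height_mono (leqnSn j))). Qed.

Lemma indic_below_mul j x : \1_(below j.+1) x * \1_(below j) x = \1_(below j) x :> R.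
Proof. by apply: indic_mul_subset; exact: below_mono. Qed.

Lemma level_phi_sum J : \sum_(j < J.+1) level_phi j = \int[mu]_x (phiG x * \1_(below J) x).
Proof.
elim: J => [|J IH].
  rewrite big_ord_recr big_ord0 /= add0r; apply: eq_Rintegral => x _.
  by rewrite /level mulr1.
have ia := integ_mul_indic (measurable_below J) integ_phi.
have ib := integ_mul_level J.+1 integ_phi.
rewrite big_ord_recr IH /=; apply: (etrans (esym (RintegralD measurableT ia ib))).
apply: eq_Rintegral => x _; rewrite -mulrDr; congr (_ * _).
by apply: indic_add_subset; exact: below_mono.
Qed.

Lemma level_phi_sum_le1 J : \sum_(j < J.+1) level_phi j <= 1.
Proof.
rewrite level_phi_sum; apply: le_trans phi_int_le1; apply: le_Rintegral => //.
- exact: integ_mul_indic (measurable_below J) integ_phi.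
- exact: integ_phi.
move=> x _; rewrite indicE; case: (_ \in _); rewrite ?mulr1 ?mulr0 //.
by rewrite orlicz_phi_ge0 // G_ge0.
Qed.

Lemma half_pow_sum_le2 J : \sum_(j < J) 2^-1 ^+ j <= 2 :> R.
Proof.
have -> : \sum_(j < J) 2^-1 ^+ j = 2 - 2 * 2^-1 ^+ J :> R.
  elim: J => [|J IH]; first by rewrite big_ord0 expr0 mulr1 subrr.
  by rewrite big_ord_recr /= IH exprS; field.
by rewrite gerBl mulr_ge0 // ltW // half_pow_gt0.
Qed.

Lemma below_bound J : restricted_bound (rform S (fun x => h x * \1_(below J) x) f2)
  (\sum_(j < J.+1) (level_share eps j / 16 * t)) t
  (\sum_(j < J.+1) (level_const * (level_phi j + 2^-1 ^+ j) * rate)).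
Proof.
elim: J => [|J IH].
  rewrite !big_ord_recr !big_ord0 /= !add0r.
  have -> : (fun x => h x * \1_(below 0) x) = level_part 0.
    by apply/funext => x; rewrite /level_part /level mulr1.
  exact: level_bound.
rewrite big_ord_recr [in X in restricted_bound _ _ _ X]big_ord_recr /=.
apply: restricted_boundD IH (level_bound J.+1) => f3 _.
have i1 := integ_mul_indic (measurable_below J.+1) integ_h.
rewrite (rform_split1 f2 f3 SQ i1 (measurable_below J)); congr (rform _ _ _ _ + rform _ _ _ _).
  by apply/funext => x; rewrite -mulrA indic_below_mul.
by apply/funext => x; rewrite /level_part /level mulrA.
Qed.

Lemma rest_int_le J : \int[mu]_x `|h x * \1_(~` below J) x| <= expR (- J.+1%:R) / c.
Proof.
have mC : measurable (~` below J) by apply: measurableC; exact: measurable_below.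
have k0 : 0 <= expR (- J.+1%:R) / c by rewrite divr_ge0 ?expR_ge0 // ltW.
apply: (@le_trans _ _ (\int[mu]_x (expR (- J.+1%:R) / c * phiG x))).
  apply: le_Rintegral => //.
  - exact: integ_abs (integ_mul_indic mC integ_h).
  - exact: integZ integ_phi.
  move=> x _; have p0 : 0 <= orlicz_phi eps (G x) by rewrite orlicz_phi_ge0 // G_ge0.
  rewrite normrM indicE; case: (boolP (x \in _)) => [/set_mem hn|_]; last first.
    by rewrite normr0 mulr0; exact: mulr_ge0.
  rewrite normr1 mulr1; apply: le_trans (hG x) _.
  have hJ : height J <= G x.
    by apply: le_trans (hG x); apply: ltW; rewrite ltNge; apply/negP.
  have hc := @c_phi J.+1 (G x) (G_ge0 x) (fun=> hJ).
  have hc' : c * expR J.+1%:R * G x <= orlicz_phi eps (G x).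
    apply: le_trans hc; apply: ler_wpM2r; first exact: G_ge0.
    by rewrite ler_peMr ?weight_ge1 // mulr_ge0 ?expR_ge0 // ltW.
  have eG : G x = expR (- J.+1%:R) / c * (c * expR J.+1%:R * G x).
    by rewrite expRN; field; rewrite !gt_eqF ?expR_gt0.
  rewrite [leLHS]eG; exact: (ler_wpM2l k0 hc').
rewrite RintegralZl //; last exact: integ_phi.
by rewrite ler_piMr // phi_int_le1.
Qed.

(** The sums of [level_phi j] and of [2^-j] contribute [1 + 2 = 3]. The last summand is the part
    above [height J], with [J] depending on [S] and [f2] so that the crude bound is at most [rate];
    it takes no exceptional set. *)
Lemma decomposition_bound :
  restricted_bound (rform S h f2) (t / 16) t ((3 * level_const + 1) * rate).
Proof.
have [K [K0 hK]] := rform_abs_le f2 SQ.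
have r0 := rate_gt0; have c'0 : 0 < c * rate by exact: mulr_gt0.
pose J := Num.Def.archi_bound (K / (c * rate)).
have hJ : K * (expR (- J.+1%:R) / c) <= rate.
  have : K / (c * rate) <= expR J.+1%:R.
    apply: le_trans (ltW (archi_boundP (divr_ge0 K0 (ltW c'0)))) _.
    apply: le_trans (expR_ge1Dx _).
    by rewrite -/J -natr1; lra.
  rewrite ler_pdivrMr // => hk.
  have -> : K * (expR (- J.+1%:R) / c) = K / (expR J.+1%:R * c).
    by rewrite expRN; field; rewrite !gt_eqF ?expR_gt0.
  rewrite ler_pdivrMr ?mulr_gt0 ?expR_gt0 //.
  apply: le_trans hk _; rewrite le_eqVlt; apply/orP; left; apply/eqP; ring.
have mB := measurable_below J; have mC := measurableC mB.
have rest : restricted_bound (rform S (fun x => h x * \1_(~` below J) x) f2) 0 t rate.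
  exists set0; split; first exact: measurable0.
    by rewrite measure0.
  move=> f3 q3 b3 _ _; apply: le_trans hJ.
  apply: le_trans (hK _ f3 (integ_mul_indic mC integ_h) q3 b3) _.
  by rewrite ler_wpM2l // rest_int_le.
have full := restricted_boundD (F := rform S h f2) _ (below_bound J) rest.
apply: restricted_bound_le (full _).
- rewrite addr0 -mulr_suml -mulr_suml.
  have -> : t / 16 = 1 / 16 * t by field.
  rewrite ler_pM2r // ler_pM2r ?invr_gt0 //; exact: level_share_sum_le.
- rewrite -mulr_suml -mulr_sumr big_split /= mulrDl mul1r lerD2r ler_pM2r //.
  rewrite [3 * _]mulrC ler_pM2l ?level_const_gt0 //.
  have := level_phi_sum_le1 J; have := half_pow_sum_le2 J.+1; lra.
- by move=> f3 _; exact: rform_split1 SQ integ_h mB.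
Qed.

End Sum.
End Constants.
End Decomposition.

Lemma orlicz_restricted_bound {R : realType} (eps : R) : 0 < eps ->
  exists C : R, 0 < C /\ forall (S : seq rectangle) (h G f2 : R -> R) (y t : R),
    uniq S -> {in S, forall s, is_quartile R s} ->
    measurable_fun setT h -> measurable_fun setT G -> (forall x, `|h x| <= G x) ->
    (\int[lebesgue_measure]_x (orlicz_phi eps (G x))%:E <= 1)%E ->
    square_integrable f2 -> \int[lebesgue_measure]_x (f2 x ^+ 2) <= y ^+ 2 ->
    0 < y -> 0 < t ->
    restricted_bound (rform S h f2) (t / 16) t (C * (y * ln (expR 1 + t) / Num.sqrt t)).
Proof.
move=> eps0.
have [c [c0 c1 hc]] := orlicz_phi_ge eps0.
have [c2 [c20 hc2]] := level_share_ge eps0.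
have [C1 [C10 hC1]] := @rform_log_bound R.
exists (3 * level_const eps c C1 c2 + 1); split.
  by rewrite addr_gt0 // mulr_gt0 // level_const_gt0.
move=> S h G f2 y t uS SQ mh mG hG phi1 q2 hy y0 t0.
apply: (decomposition_bound eps0 mh mG hG phi1 c0 c1 hc SQ) hc2 _ => //.
by move=> f1 x A tau x0 A0 tau0 q1 i1 hx hA; apply: hC1.
Qed.

(** * The weak type bound *)

Section Operator.
Context {R : realType}.
Local Notation mu := (@lebesgue_measure R).
Implicit Types (f g h : R -> R) (S : seq rectangle) (F : R -> R[i]).

Definition real_operator S h g (x : R) : R :=
  \sum_(s <- S) (Num.sqrt (dyadic_len R s.1))^-1 *
    rpair h (wave_packet (quartile_tile s 1)) *
    rpair g (wave_packet (quartile_tile s 2)) * wave_packet (quartile_tile s 3) x.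

Definition re F (x : R) : R := complex.Re (F x).
Definition im F (x : R) : R := complex.Im (F x).

Lemma modulusE (z : R[i]) :
  modulus z = Num.sqrt (complex.Re z ^+ 2 + complex.Im z ^+ 2).
Proof. by case: z. Qed.

Lemma modulus_ge0 (z : R[i]) : 0 <= modulus z.
Proof. by rewrite modulusE sqrtr_ge0. Qed.

Lemma Re_le_modulus (z : R[i]) : `|complex.Re z| <= modulus z.
Proof.
rewrite modulusE -sqrtr_sqr; apply: ler_wsqrtr.
by rewrite lerDl sqr_ge0.
Qed.

Lemma Im_le_modulus (z : R[i]) : `|complex.Im z| <= modulus z.
Proof.
rewrite modulusE -sqrtr_sqr; apply: ler_wsqrtr.
by rewrite lerDr sqr_ge0.
Qed.

Lemma modulus_le (z : R[i]) : modulus z <= `|complex.Re z| + `|complex.Im z|.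
Proof.
have p : 0 <= `|complex.Re z| + `|complex.Im z| by rewrite addr_ge0.
rewrite modulusE -[leRHS]ger0_norm // -sqrtr_sqr; apply: ler_wsqrtr.
rewrite sqrrD !real_normK ?num_real // lerD2r lerDl mulrn_wge0 //.
Qed.

Lemma quartile_operator_parts (S : {fset rectangle}) F1 F2 x :
  quartile_operator S F1 F2 x =
  (real_operator S (re F1) (re F2) x - real_operator S (im F1) (im F2) x) +i*
  (real_operator S (re F1) (im F2) x + real_operator S (im F1) (re F2) x).
Proof.
rewrite /quartile_operator /real_operator -sumrB -big_split /=.
elim/big_rec3: _ => [//|s a b c _ ->].
rewrite /pairing /re /im /rpair; simpc; congr (_ +i* _); ring.
Qed.

Lemma real_operatorZ S (k : R) h g x : {in S, forall s, is_quartile R s} -> integ h ->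
  real_operator S (fun t => k * h t) g x = k * real_operator S h g x.
Proof.
move=> SQ ih; rewrite /real_operator mulr_sumr big_seq [RHS]big_seq.
apply: eq_bigr => s sS; have iw := integ_mul_wave_packet 0 (SQ s sS) ih.
have -> : rpair (fun t => k * h t) (wave_packet (quartile_tile s 1)) =
    k * rpair h (wave_packet (quartile_tile s 1)).
  by rewrite /rpair -RintegralZl //; apply: eq_Rintegral => t _; rewrite mulrA.
by ring.
Qed.

Lemma real_operator_integral S h g f3 : {in S, forall s, is_quartile R s} ->
  square_integrable f3 ->
  integ (fun x => real_operator S h g x * f3 x) /\
  \int[mu]_x (real_operator S h g x * f3 x) = rform S h g f3.
Proof.
move=> SQ q3; rewrite /real_operator /rform.
elim: S SQ => [|s S IH] SQ.
  have e0 : (fun x => (\sum_(s <- [::]) (Num.sqrt (dyadic_len R s.1))^-1 *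
    rpair h (wave_packet (quartile_tile s 1)) *
    rpair g (wave_packet (quartile_tile s 2)) * wave_packet (quartile_tile s 3) x) * f3 x)
    = fun=> 0 :> R by apply/funext => x; rewrite big_nil mul0r.
  split; first by rewrite e0; exact: (integrable0 mu setT).
  by rewrite e0 big_nil (Rintegral_cst mu measurableT 0) mul0r.
have [|i1 e1] := IH; first by move=> z zS; apply: SQ; rewrite inE zS orbT.
have qs : is_quartile R s by apply: SQ; rewrite inE eqxx.
have qw := @square_integrable_wave_packet R s 2 qs.
pose k := (Num.sqrt (dyadic_len R s.1))^-1 * rpair h (wave_packet (quartile_tile s 1)) *
    rpair g (wave_packet (quartile_tile s 2)).
have i2 : integ (fun x => k * (f3 x * wave_packet (quartile_tile s 3) x)).
  by apply: integZ; exact: integ_mul.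
have i12 := integD i2 i1.
have e : (fun x => (\sum_(s <- s :: S) (Num.sqrt (dyadic_len R s.1))^-1 *
    rpair h (wave_packet (quartile_tile s 1)) *
    rpair g (wave_packet (quartile_tile s 2)) * wave_packet (quartile_tile s 3) x) * f3 x)
  = (fun x => k * (f3 x * wave_packet (quartile_tile s 3) x) +
     (\sum_(s <- S) (Num.sqrt (dyadic_len R s.1))^-1 *
    rpair h (wave_packet (quartile_tile s 1)) *
    rpair g (wave_packet (quartile_tile s 2)) * wave_packet (quartile_tile s 3) x) * f3 x).
  by apply/funext => x; rewrite big_cons mulrDl /k; congr (_ + _); ring.
rewrite e; split=> //.
by rewrite RintegralD // e1 big_cons RintegralZl //; exact: integ_mul.
Qed.

Lemma square_integrableD f g : square_integrable f -> square_integrable g ->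
  square_integrable (fun x => f x + g x).
Proof.
move=> [mf f2] [mg g2]; split; first exact: measurable_funD.
apply: (@integ_le _ _ (fun x => 2 * (f x ^+ 2 + g x ^+ 2))).
- by apply: measurable_funX; exact: measurable_funD.
- by move=> x; rewrite ger0_norm ?sqr_ge0 //; have := sqr_ge0 (f x - g x); nra.
- by apply: integZ; exact: integD.
Qed.

Lemma square_integrableZ (k : R) f : square_integrable f ->
  square_integrable (fun x => k * f x).
Proof.
move=> [mf f2]; split; first exact: measurable_funM.
apply: (@integ_le _ _ (fun x => k ^+ 2 * f x ^+ 2)); last exact: integZ.
- by apply: measurable_funX; exact: measurable_funM.
- by move=> x; rewrite exprMn ger0_norm // mulr_ge0 ?sqr_ge0.
Qed.

Lemma square_integrable_real_operator S h g : {in S, forall s, is_quartile R s} ->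
  square_integrable (real_operator S h g).
Proof.
elim: S => [|s S IH] SQ.
  have -> : real_operator [::] h g = fun=> 0.
    by apply/funext => x; rewrite /real_operator big_nil.
  have -> : (fun=> 0) = (fun x : R => 0 * wpack (0, 0) 0 x).
    by apply/funext => x; rewrite mul0r.
  by apply: square_integrableZ; exact: square_integrable_wpack.
pose k := (Num.sqrt (dyadic_len R s.1))^-1 * rpair h (wave_packet (quartile_tile s 1)) *
    rpair g (wave_packet (quartile_tile s 2)).
have -> : real_operator (s :: S) h g =
    fun x => k * wave_packet (quartile_tile s 3) x + real_operator S h g x.
  by apply/funext => x; rewrite /real_operator big_cons.
apply: square_integrableD.
  apply: square_integrableZ; apply: square_integrable_wave_packet.
  by apply: SQ; rewrite inE eqxx.
by apply: IH => z zS; apply: SQ; rewrite inE zS orbT.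
Qed.

End Operator.

(** * From restricted bounds to superlevel sets *)

Section WeakType.
Context {R : realType}.
Local Notation mu := (@lebesgue_measure R).
Implicit Types (f g h : R -> R).

(** The contradiction is reached at the true measure [t'] of the superlevel set, which exceeds [t],
    and the bounds have to be brought back to [t]. As [ln (e + t) >= 1], [ln (e + t') <= ln (e + t)
    + t'/t - 1 <= ln (e + t) * (t'/t)]. *)
Lemma decay_mono (t t' : R) : 0 < t -> t <= t' ->
  ln (expR 1 + t') / (t' * Num.sqrt t') <= ln (expR 1 + t) / (t * Num.sqrt t).
Proof.
move=> t0 tt'; have t'0 : 0 < t' by exact: lt_le_trans t0 tt'.
have [e ee] : exists e, e = expR 1 :> R by exists (expR 1).
have e0 : 0 < e by rewrite ee expR_gt0.
rewrite -ee; have L1 : 1 <= ln (e + t) by rewrite ee; apply: ln_ge1; exact: ltW.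
have s0 : 0 < Num.sqrt t by rewrite sqrtr_gt0.
have s'0 : 0 < Num.sqrt t' by rewrite sqrtr_gt0.
have ss' : Num.sqrt t <= Num.sqrt t' by rewrite ler_wsqrtr.
have et : 0 < e + t by rewrite addr_gt0.
have r1 : 1 <= t' / t by rewrite ler_pdivlMr // mul1r.
have r0 : 0 < t' / t by rewrite divr_gt0.
have h1 : ln (e + t') <= ln (e + t) * (t' / t).
  apply: (@le_trans _ _ (ln ((e + t) * (t' / t)))).
    apply: ln_mono; first by rewrite addr_gt0.
    have -> : (e + t) * (t' / t) = e * (t' / t) + t' by field; rewrite gt_eqF.
    by rewrite lerD2r ler_peMr // ltW.
  rewrite lnM ?posrE //; have := ln_le_sub1 r0; nra.
rewrite ler_pdivrMr ?mulr_gt0 //; apply: le_trans h1 _.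
have -> : ln (e + t) / (t * Num.sqrt t) * (t' * Num.sqrt t') =
  ln (e + t) * (t' / t) * (Num.sqrt t' / Num.sqrt t) by field; rewrite !gt_eqF.
rewrite ler_peMr //; first by rewrite mulr_ge0 ?(ltW r0) // (le_trans ler01 L1).
by rewrite ler_pdivlMr // mul1r.
Qed.

Lemma measure_bigU (I : eqType) (r : seq I) (A : I -> set R) (a : R) :
  (forall i, measurable (A i)) -> (forall i, (mu (A i) <= a%:E)%E) ->
  [/\ measurable (\big[setU/set0]_(i <- r) A i),
      (mu (\big[setU/set0]_(i <- r) A i) <= ((size r)%:R * a)%:E)%E &
      forall i, i \in r -> A i `<=` \big[setU/set0]_(j <- r) A j].
Proof.
move=> mA hA; elim: r => [|i r [IH1 IH2 IH3]].
  by rewrite big_nil measure0 mul0r; split.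
rewrite big_cons; split; first exact: measurableU.
- have hU : (mu (A i `|` \big[setU/set0]_(j <- r) A j) <=
     mu (A i) + mu (\big[setU/set0]_(j <- r) A j))%E by exact: (measureU2 mu (mA i) IH1).
  apply: (le_trans hU); rewrite /= -natr1 mulrDl mul1r addrC EFinD.
  exact: leeD.
- move=> k; rewrite inE => /orP[/eqP ->|kr]; first exact: subsetUl.
  by apply: subset_trans (IH3 _ kr) _; exact: subsetUr.
Qed.

Lemma Rintegral_sum_seq (I : Type) (r : seq I) (F : I -> R -> R) :
  (forall i, integ (F i)) -> integ (fun x => \sum_(i <- r) F i x) /\
  \int[mu]_x (\sum_(i <- r) F i x) = \sum_(i <- r) \int[mu]_x F i x.
Proof.
move=> iF; elim: r => [|i r [IH1 IH2]].
  have e : (fun x : R => \sum_(i <- [::]) F i x) = fun=> 0 by apply/funext => x; rewrite big_nil.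
  split; first by rewrite e; exact: (integrable0 mu setT).
  by rewrite e big_nil (Rintegral_cst mu measurableT 0) mul0r.
have e : (fun x : R => \sum_(i <- i :: r) F i x) = fun x => F i x + \sum_(j <- r) F j x.
  by apply/funext => x; rewrite big_cons.
rewrite e big_cons; split; first exact: integD.
by rewrite (RintegralD measurableT (iF i) IH1) IH2.
Qed.

Lemma integ_indic_finite (D : set R) : measurable D -> integ \1_D -> (mu D < +oo)%E.
Proof.
move=> mD /integrableP[_ h]; apply: le_lt_trans h.
rewrite -[X in (mu X <= _)%E]setIT -integral_indic //.
apply: ge0_le_integral => //.
- by apply/measurable_EFinP; exact: measurable_indic.
- by apply/measurable_EFinP; apply: measurableT_comp => //; exact: measurable_indic.
- by move=> t _ /=; rewrite lee_fin ler_norm.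
Qed.

Lemma Rintegral_indic1 (D : set R) : measurable D -> \int[mu]_x \1_D x = fine (mu D).
Proof. by move=> mD; rewrite /Rintegral integral_indic // setIT. Qed.

Lemma measurable_lt_set f g : measurable_fun setT f ->
  measurable_fun setT g -> measurable [set x | f x < g x].
Proof.
move=> mf mg; have := measurable_fun_ltr mf mg.
move=> /(_ measurableT [set true] I); rewrite setTI.
by congr (measurable _); apply/seteqP; split.
Qed.

Lemma square_integrable_abs f : square_integrable f -> square_integrable (fun x => `|f x|).
Proof.
move=> [mf f2]; split; first by apply: measurableT_comp.
have -> : (fun x => `|f x| ^+ 2) = (fun x => f x ^+ 2); last by [].
by apply/funext => x; rewrite real_normK ?num_real.
Qed.

(* The superlevel set is tested, outside its exceptional sets, against the signs
   of the V k. *)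
Lemma weak_type_of_restricted (V : 'I_4 -> R -> R) (F : 'I_4 -> (R -> R) -> R) (D t : R) :
  0 < D -> 0 < t -> (forall k, square_integrable (V k)) ->
  (forall k f3, square_integrable f3 -> integ (fun x => V k x * f3 x) /\
     \int[mu]_x (V k x * f3 x) = F k f3) ->
  (forall k t', 0 < t' ->
     restricted_bound (F k) (t' / 16) t' (D * (ln (expR 1 + t') / Num.sqrt t'))) ->
  (mu [set x | (6 * D * (ln (expR 1 + t) / (t * Num.sqrt t)) < \sum_(k < 4) `|V k x|)%R]
    <= t%:E)%E.
Proof.
move=> D0 t0 qV iV hF.
set q := ln (expR 1 + t) / (t * Num.sqrt t).
have q0 : 0 < q.
  rewrite /q divr_gt0 // ?mulr_gt0 ?sqrtr_gt0 //.
  by apply: lt_le_trans ltr01 (ln_ge1 _); exact: ltW.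
pose U x := \sum_(k < 4) `|V k x|.
pose th := 6 * D * q.
have th0 : 0 < th by rewrite /th mulr_gt0 // mulr_gt0.
have qU : square_integrable U.
  rewrite /U; have -> : (fun x => \sum_(k < 4) `|V k x|) = fun x =>
      `|V ord0 x| + (`|V (lift ord0 ord0) x| + (`|V (lift ord0 (lift ord0 ord0)) x| +
      `|V (lift ord0 (lift ord0 (lift ord0 ord0))) x|)).
    by apply/funext => x; rewrite !big_ord_recl big_ord0 addr0.
  by do 3 (apply: square_integrableD; first exact: square_integrable_abs);
    exact: square_integrable_abs.
set E0 := [set x | _].
have E0E : E0 = [set x | th < U x] by [].
have mE0 : measurable E0 by rewrite E0E; apply: measurable_lt_set => //; case: qU.
(* Chebyshev's inequality for the square integrable [U]. Finiteness makes the measure of [E0] a real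
   number, at which the restricted bounds can be taken. *)
have fE0 : (mu E0 < +oo)%E.
  apply: integ_indic_finite => //.
  apply: (@integ_le _ _ (fun x => (th ^+ 2)^-1 * U x ^+ 2)).
  - exact: measurable_indic.
  - move=> x; rewrite ger0_norm ?indicE //; case: (boolP (x \in E0)) => [/set_mem hx|_] /=.
      rewrite ler_pdivlMl ?exprn_gt0 // mulr1.
      by rewrite lerXn2r ?nnegrE // ?ltW // (lt_trans th0).
    by rewrite mulr_ge0 ?invr_ge0 ?sqr_ge0.
  - by apply: integZ; case: qU.
rewrite leNgt; apply/negP => hlt.
have eE0 : mu E0 = (fine (mu E0))%:E by rewrite fineK // ge0_fin_numE.
move: hlt; rewrite eE0 lte_fin; set t' := fine (mu E0) => tt'.
have t'0 : 0 < t' by exact: lt_trans t0 tt'.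
have [E hE] : exists E : 'I_4 -> set R, forall k, [/\ measurable (E k),
    (mu (E k) <= (t' / 16)%:E)%E &
    forall f3, square_integrable f3 -> (forall x, `|f3 x| <= 1) ->
      \int[mu]_x (f3 x ^+ 2) <= t' -> (forall x, E k x -> f3 x = 0) ->
      `|F k f3| <= D * (ln (expR 1 + t') / Num.sqrt t')].
  have [E hE] := choice (fun k => hF k t' t'0); exists E => k; exact: hE.
have mE k : measurable (E k) by case: (hE k).
have [mEa hEa sEa] := @measure_bigU _ (enum 'I_4) E (t' / 16) mE
  (fun k => let: And3 _ h _ := hE k in h).
set Ea := \big[setU/set0]_(i <- enum 'I_4) E i in mEa hEa sEa.
pose F' := E0 `\` Ea.
have mF' : measurable F' by exact: measurableD.
have fF' : (mu F' < +oo)%E.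
  by apply: le_lt_trans fE0; apply: le_measure; rewrite ?inE //; exact: subDsetl.
have eF' : mu F' = (fine (mu F'))%:E by rewrite fineK // ge0_fin_numE.
have leF' : (mu F' <= t'%:E)%E.
  by rewrite -eE0; apply: le_measure; rewrite ?inE //; exact: subDsetl.
pose p := fine (mu F').
(* Four exceptional sets of measure [t' / 16] remove at most a quarter of [E0]. *)
have hp : 3 / 4 * t' <= p.
  have : (mu E0 <= mu (F' `|` Ea))%E.
    apply: le_measure; rewrite ?inE //; first exact: measurableU.
    by move=> x hx; have [hxE|hxE] := pselect (Ea x); [right|left].
  have hU : (mu (F' `|` Ea) <= mu F' + mu Ea)%E by exact: measureU2.
  move=> h1; have := le_trans h1 hU; rewrite eE0 eF' => h2.
  have := le_trans h2 (leeD (lexx _) hEa).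
  by rewrite -EFinD lee_fin size_enum_ord -/t' -/p; lra.
pose f3 k x := Num.sg (V k x) * \1_F' x.
have mf3 k : measurable_fun setT (f3 k).
  apply: measurable_funM; last exact: measurable_indic.
  by apply: measurableT_comp; [exact: measurable_sg|case: (qV k)].
have b3 k x : `|f3 k x| <= \1_F' x.
  rewrite /f3 normrM indicE normr_sg; case: (_ \in F'); rewrite /= ?normr0 ?mulr0 //.
  by rewrite normr1 mulr1 lern1; case: (_ != _).
have s3 k x : f3 k x ^+ 2 <= \1_F' x.
  have := b3 k x; rewrite -real_normK ?num_real // indicE; have := normr_ge0 (f3 k x).
  by case: (_ \in F') => /= h1 h2; nra.
have q3 k : square_integrable (f3 k).
  split=> //; apply: (@integ_le _ _ \1_F').
  - exact: measurable_funX.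
  - by move=> x; rewrite ger0_norm ?sqr_ge0.
  - exact: integ_indic.
have m3 k : \int[mu]_x (f3 k x ^+ 2) <= t'.
  apply: (@le_trans _ _ (\int[mu]_x \1_F' x)).
    apply: le_Rintegral => //; [by case: (q3 k)|exact: integ_indic].
  by rewrite Rintegral_indic1 // -lee_fin -eF'.
have v3 k x : E k x -> f3 k x = 0.
  move=> Ex; rewrite /f3 indicE memNset ?mulr0 //= => -[_]; apply.
  by apply: (sEa k) => //; rewrite mem_enum.
have hk k : F k (f3 k) <= D * (ln (expR 1 + t') / Num.sqrt t').
  have [_ _ h] := hE k; apply: le_trans (ler_norm _) _; apply: h => //.
  - by move=> x; apply: le_trans (b3 k x) _; rewrite indicE lern1; case: (_ \in _).
  - by move=> x; exact: v3.
have iVf k : integ (fun x => V k x * f3 k x) by case: (iV k (f3 k) (q3 k)).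
have [iS eS] := @Rintegral_sum_seq _ (enum 'I_4) (fun k x => V k x * f3 k x) iVf.
have main : th * p <= \sum_(k <- enum 'I_4) F k (f3 k).
  have -> : \sum_(k <- enum 'I_4) F k (f3 k) =
      \int[mu]_x \sum_(k <- enum 'I_4) V k x * f3 k x.
    by rewrite eS; apply: eq_bigr => k _; case: (iV k (f3 k) (q3 k)).
  rewrite -[p](Rintegral_indic1 mF') -RintegralZl //; last exact: integ_indic.
  apply: le_Rintegral => //; first by apply: integZ; exact: integ_indic.
  move=> x _.
  have -> : \sum_(k <- enum 'I_4) V k x * f3 k x = U x * \1_F' x.
    rewrite /U mulr_suml big_enum /=; apply: eq_bigr => k _.
    by rewrite /f3 mulrA [V k x * _]mulrC -normrEsg.
  rewrite indicE; case: (boolP (x \in F')) => [/set_mem [hx _]|_] /=; rewrite ?mulr0 // !mulr1.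
  exact: ltW.
have : th * p <= 4 * (D * (ln (expR 1 + t') / Num.sqrt t')).
  apply: le_trans main _.
  have -> : 4 * (D * (ln (expR 1 + t') / Num.sqrt t')) =
      \sum_(k <- enum 'I_4) D * (ln (expR 1 + t') / Num.sqrt t').
    by rewrite big_const_seq count_predT size_enum_ord /=; ring.
  by apply: ler_sum => k _.
have := decay_mono t0 (ltW tt'); rewrite -/q.
have s0 : 0 < Num.sqrt t' by rewrite sqrtr_gt0.
move: (ln (expR 1 + t')) => l.
rewrite ler_pdivrMr ?mulr_gt0 // => h1 h2.
have h3 : l / Num.sqrt t' <= q * t'.
  by rewrite ler_pdivrMr // -mulrA.
(* The constant 6 in the threshold makes the left side [9 / 2] times [D * (q * t')], more than the 4
   that the four forms allow. *)
have h4 : th * (3 / 4 * t') <= 4 * (D * (q * t')).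
  apply: le_trans (_ : th * p <= _); first by rewrite ler_pM2l.
  apply: le_trans h2 _; rewrite ler_pM2l // ler_pM2l //.
have : 0 < D * (q * t') by exact: mulr_gt0 D0 (mulr_gt0 q0 t'0).
have e : th * (3 / 4 * t') = 9 / 2 * (D * (q * t')) by rewrite /th; field.
by rewrite e in h4; lra.
Qed.

End WeakType.

(** * Complex-valued functions and the quasi-norm of [X] *)

Section MixedNorm.
Context {R : realType}.
Local Notation mu := (@lebesgue_measure R).
Implicit Types (f : R -> R[i]).

Lemma measurable_modulus f : cmeasurable f -> measurable_fun setT (fun x => modulus (f x)).
Proof.
move=> [mre mim].
have -> : (fun x => modulus (f x)) =
    Num.sqrt \o (fun x => complex.Re (f x) ^+ 2 + complex.Im (f x) ^+ 2).
  by apply/funext => x; rewrite modulusE.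
apply: measurableT_comp; first exact: continuous_measurable_fun (@sqrt_continuous R).
by apply: measurable_funD; exact: measurable_funX.
Qed.

Definition part (b : bool) f : R -> R := if b then im f else re f.

Lemma norm_part b f x : `|part b f x| <= modulus (f x).
Proof. by case: b; [exact: Im_le_modulus|exact: Re_le_modulus]. Qed.

Lemma measurable_part b f : cmeasurable f -> measurable_fun setT (part b f).
Proof. by move=> [mre mim]; case: b. Qed.

(** The two binary digits of [k] choose real or imaginary parts of [f1] and of [f2]; the packets are
    real, so these four operators suffice. *)
Lemma modulus_quartile_operator_le (S : {fset rectangle}) f1 f2 x :
  modulus (quartile_operator S f1 f2 x) <=
  \sum_(k < 4) `|real_operator S (part (odd k) f1) (part (1 < k)%N f2) x|.
Proof.
rewrite quartile_operator_parts; apply: (le_trans (modulus_le _)); rewrite [X in X <= _]/=.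
rewrite !big_ord_recl big_ord0 addr0.
rewrite (_ : odd (lift ord0 ord0) = true) // (_ : odd (lift ord0 (lift ord0 ord0)) = false) //.
rewrite (_ : odd (lift ord0 (lift ord0 (lift ord0 ord0))) = true) //.
rewrite (_ : (1 < @ord0 3)%N = false) // (_ : (1 < lift ord0 ord0)%N = false) //.
rewrite (_ : (1 < lift ord0 (lift ord0 ord0))%N = true) //.
rewrite (_ : (1 < lift ord0 (lift ord0 (lift ord0 ord0)))%N = true) //= /part.
have a1 := ler_normB (real_operator S (re f1) (re f2) x) (real_operator S (im f1) (im f2) x).
have a2 := ler_normD (real_operator S (re f1) (im f2) x) (real_operator S (im f1) (re f2) x).
lra.
Qed.

Lemma cmeasurable_quartile_operator (S : {fset rectangle}) f1 f2 :
  {in S, forall s, is_quartile R s} -> cmeasurable (quartile_operator S f1 f2).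
Proof.
move=> SQ; have mV (f g : R -> R) : measurable_fun setT (real_operator S f g).
  by case: (square_integrable_real_operator f g SQ).
split; under eq_fun do rewrite quartile_operator_parts.
  exact: (measurable_funB (mV _ _) (mV _ _)).
exact: (measurable_funD (mV _ _) (mV _ _)).
Qed.

Lemma square_integrable_part b f (y : R) : cmeasurable f ->
  (\int[mu]_x (modulus (f x) ^+ 2)%:E <= (y ^+ 2)%:E)%E ->
  square_integrable (part b f) /\ \int[mu]_x (part b f x ^+ 2) <= y ^+ 2.
Proof.
move=> mf hf; have mm := measurable_modulus mf.
have im2 : integ (fun x => modulus (f x) ^+ 2).
  apply/integrableP; split; first by apply/measurable_EFinP; exact: measurable_funX.
  apply: le_lt_trans (ltry (y ^+ 2)); apply: le_trans hf.
  apply: ge0_le_integral => //.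
  - by apply/measurable_EFinP; apply: measurableT_comp => //; exact: measurable_funX.
  - by apply/measurable_EFinP; exact: measurable_funX.
  - by move=> x _ /=; rewrite lee_fin ger0_norm // sqr_ge0.
have le2 x : part b f x ^+ 2 <= modulus (f x) ^+ 2.
  by rewrite -real_normK ?num_real // ler_sqr ?nnegrE ?modulus_ge0 // norm_part.
have mp := measurable_part b mf.
have ip : integ (fun x => part b f x ^+ 2).
  apply: (integ_le _ _ im2); first exact: measurable_funX.
  by move=> x; rewrite ger0_norm ?sqr_ge0.
split=> //; apply: (@le_trans _ _ (\int[mu]_x (modulus (f x) ^+ 2))).
  by apply: le_Rintegral.
rewrite -lee_fin fineK; first exact: hf.
exact: (integrable_fin_num measurableT im2).
Qed.

Lemma powR_three_halves (t : R) : 0 < t -> t `^ (3 / 2) = t * Num.sqrt t.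
Proof.
move=> t0; have -> : 3 / 2 = 1 + 2^-1 :> R by field.
by rewrite powRD ?gt_eqF ?implybT // powRr1 ?ltW // powR12_sqrt // ltW.
Qed.

Lemma X_norm_le (eps : R) : 0 < eps -> exists C : R, 0 < C /\
  forall (S : {fset rectangle}) f1 f2 (lam y : R),
    (forall s, s \in S -> is_quartile R s) -> cmeasurable f1 -> cmeasurable f2 ->
    0 < lam -> (\int[mu]_x (orlicz_phi eps (modulus (f1 x) / lam))%:E <= 1)%E ->
    0 < y -> (\int[mu]_x (modulus (f2 x) ^+ 2)%:E <= (y ^+ 2)%:E)%E ->
    (X_norm (quartile_operator S f1 f2) <= (C * (lam * y))%:E)%E.
Proof.
move=> eps0; have [C [C0 hC]] := @orlicz_restricted_bound R eps eps0.
have [c [c0 c1 hc]] := orlicz_phi_ge eps0.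
exists (6 * C); split; first by rewrite mulr_gt0.
move=> S f1 f2 lam y SQ mf1 mf2 lam0 hphi y0 h2.
(* Division by [lam] normalizes the Orlicz integral to at most 1; [lam] returns in front of the
   operator by linearity in [f1]. *)
pose G x := modulus (f1 x) / lam.
pose h b x := lam^-1 * part b f1 x.
have mG : measurable_fun setT G by apply: measurable_funM => //; exact: measurable_modulus.
have mh b : measurable_fun setT (h b) by apply: measurable_funM => //; exact: measurable_part.
have hG b x : `|h b x| <= G x.
  rewrite /h /G normrM ger0_norm ?invr_ge0 ?(ltW lam0) // mulrC.
  by rewrite ler_wpM2r ?invr_ge0 ?(ltW lam0) // norm_part.
have ih b : integ (h b) := integ_h (mh b) mG (hG b) hphi c0 hc.
pose V (k : 'I_4) := real_operator S (h (odd k)) (part (1 < k)%N f2).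
have VE (x : R) : modulus (quartile_operator S f1 f2 x) <= lam * \sum_(k < 4) `|V k x|.
  apply: le_trans (modulus_quartile_operator_le _ _ _ _) _.
  rewrite mulr_sumr; apply: ler_sum => k _; rewrite /V.
  have -> : part (odd k) f1 = fun x => lam * h (odd k) x.
    by apply/funext => z; rewrite /h mulrA divff ?gt_eqF // mul1r.
  by rewrite real_operatorZ // normrM gtr0_norm.
apply: ge_ereal_sup => _ [t /= t0 <-].
set q := ln (expR 1 + t) / (t * Num.sqrt t).
have W : (mu [set x | (6 * (C * y) * q < \sum_(k < 4) `|V k x|)%R] <= t%:E)%E.
  apply: (@weak_type_of_restricted R V (fun k => rform S (h (odd k)) (part (1 < k)%N f2)))
    => //; first exact: mulr_gt0.
  - by move=> k; exact: square_integrable_real_operator.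
  - by move=> k f3 q3; exact: real_operator_integral.
  - move=> k t' t'0; have [q2 le2] := square_integrable_part (1 < k)%N mf2 h2.
    have -> : C * y * (ln (expR 1 + t') / Num.sqrt t') =
        C * (y * ln (expR 1 + t') / Num.sqrt t') by rewrite !mulrA.
    exact: (hC S (h (odd k)) G _ y t' (fset_uniq S) SQ (mh _) mG (hG _) hphi q2 le2 y0 t'0).
have L1 : 1 <= ln (expR 1 + t) by apply: ln_ge1; exact: ltW.
have L0 : 0 < ln (expR 1 + t) by exact: lt_le_trans ltr01 L1.
have q0 : 0 < q by rewrite divr_gt0 // mulr_gt0 // sqrtr_gt0.
have dr : (decreasing_rearrangement (quartile_operator S f1 f2) t <=
    (lam * (6 * (C * y) * q))%:E)%E.
  apply: ereal_inf_lbound; exists (lam * (6 * (C * y) * q)) => //; split.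
    by apply/ltW/mulr_gt0 => //; apply/mulr_gt0 => //; rewrite !mulr_gt0.
  apply: le_trans W; apply: le_measure; rewrite ?inE.
  - by apply: measurable_lt_set => //; exact: measurable_modulus (cmeasurable_quartile_operator _ _ SQ).
  - by apply: measurable_lt_set => //; apply: measurable_sum => k; apply: measurableT_comp => //;
      case: (square_integrable_real_operator (h (odd k)) (part (1 < k)%N f2) SQ).
  - by move=> x /= hx; have := lt_le_trans hx (VE x); rewrite ltr_pM2l.
have k0 : 0 < t `^ (3 / 2) / ln (expR 1 + t) by rewrite divr_gt0 // powR_gt0.
apply: le_trans (lee_wpmul2l _ dr) _; first by rewrite lee_fin ltW.
rewrite -EFinM lee_fin powR_three_halves // /q le_eqVlt; apply/orP; left; apply/eqP.
have s0 : 0 < Num.sqrt t by rewrite sqrtr_gt0.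
by field; rewrite !gt_eqF.
Qed.

End MixedNorm.
Theorem theorem5 (R : realType) (eps : R) (heps : 0 < eps) :
  exists C : R, 0 < C /\
    forall S : {fset rectangle}, (forall s, s \in S -> is_quartile R s) ->
    forall f1 f2 : R -> R[i], in_Orlicz (orlicz_phi eps) f1 -> in_L2 f2 ->
      (X_norm (quartile_operator S f1 f2)
        <= C%:E * Orlicz_norm (orlicz_phi eps) f1 * L2_norm f2)%E.
Proof.
have [C [C0 hC]] := X_norm_le heps.
exists C; split=> // S SQ f1 f2 [mf1 r_fin] [mf2 y_fin].
have r_ge0 : (0 <= Orlicz_norm (orlicz_phi eps) f1)%E.
  by apply: le_ereal_inf_tmp => _ [lam [lam0 _] <-]; rewrite lee_fin ltW.
have y_ge0 : (0 <= L2_norm f2)%E by exact: Lnorm_ge0.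
have er : Orlicz_norm (orlicz_phi eps) f1 = (fine (Orlicz_norm (orlicz_phi eps) f1))%:E.
  by rewrite fineK // ge0_fin_numE.
have ey : L2_norm f2 = (fine (L2_norm f2))%:E by rewrite fineK // ge0_fin_numE.
move: er ey r_ge0 y_ge0; set r := fine _; set y := fine _ => er ey.
rewrite er ey !lee_fin => r0 y0.
have l2 : (\int[lebesgue_measure]_x (modulus (f2 x) ^+ 2)%:E = (y ^+ 2)%:E)%E.
  have := @poweR_Lnorm _ _ R lebesgue_measure (fun x => (modulus (f2 x))%:E)
    2 (negbT (pnatr_eq0 _ 2)).
  rewrite -/(L2_norm f2) ey poweR_EFin powR_mulrn // => ->.
  apply: eq_integral => x _; rewrite abse_EFin poweR_EFin powR_mulrn //.
  by rewrite real_normK ?num_real.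
(* The infimum in the Orlicz norm need not be attained by an admissible [lam], and either norm may
   be 0 while [hC] asks for positive numbers; both are therefore enlarged by a small [d]. *)
apply/lee_addgt0Pr => e e0.
have k0 : 0 < C * (r + y + 1) by rewrite mulr_gt0 // ltr_wpDl // addr_ge0.
(* Since [d <= 1], enlarging both factors changes their product by
   [d * (r + y + d) <= d * (r + y + 1)]. *)
pose d := Num.min 1 (e / (C * (r + y + 1))).
have d0 : 0 < d by rewrite lt_min ltr01 divr_gt0.
have d1 : d <= 1 by rewrite ge_min lexx.
have de : d * (C * (r + y + 1)) <= e by rewrite -ler_pdivlMr // ge_min lexx orbT.
have [_ [lam [lam0 hlam] <-]] : exists2 z, [set lam%:E | lam in [set lam : R | 0 < lam /\
    (\int[lebesgue_measure]_x (orlicz_phi eps (modulus (f1 x) / lam))%:E <= 1)%E]] z &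
    (z < (r + d)%:E)%E.
  by apply: ereal_inf_lt; rewrite -/(Orlicz_norm (orlicz_phi eps) f1) er lte_fin ltrDl.
rewrite lte_fin => lam_lt.
have yd0 : 0 < y + d by rewrite ltr_wpDl.
apply: le_trans (hC S f1 f2 lam (y + d) SQ mf1 mf2 lam0 hlam yd0 _) _.
  by rewrite l2 lee_fin ler_sqr ?nnegrE ?(ltW yd0) // lerDl ltW.
rewrite -!EFinM -EFinD lee_fin.
apply: le_trans (_ : C * ((r + d) * (y + d)) <= _).
  by rewrite ler_pM2l // ler_pM2r // ltW.
have : C * (d * d) <= C * d by rewrite ler_pM2l // ler_piMr // ltW.
nra.
Qed.
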